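(* Take $s>0$ and let $D\subseteq\mathbb R^d$ be an open, bounded, non-empty set. There exists a complex Gaussian field $Z$ (with values in one of the spaces $\mathscr L_{-t}(D)$, $t>0$) such that $$\langle Z,\phi\rangle\sim\mathcal{CN}\left(0,\|\phi\|_{\mathscr L_s}^2,0\right)$$ for all $\phi\in C_0^\infty(D)$. (This field $Z$ is called the complex fractional Gaussian field of order $s$.)
   Context: $L^2(D)=L^2(D,\mathbb C)$ and $C_0^\infty(D)$ is the space of complex-valued test functions on $D$. Let $(w_n)_{n\in\mathbb N}\subset H_0^1(D)$ be an orthonormal basis of $L^2(D;\mathbb R)$ (hence of $L^2(D)$) consisting of weak solutions of $-\Delta w_n=\lambda_nw_n$ in $D$, $w_n=0$ on $\partial D$, with $(\lambda_n)_{n\in\mathbb N}\subset(0,\infty)$ nondecreasing; by Weyl's law $n^2\lambda_n^{-d}$ converges to a positive constant. For $s>0$, the fractional Laplacian is $(-\Delta)^su=\sum_n\lambda_n^s(u,w_n)_{L^2}w_n$, with domain $\mathscr L_s(D)=\{u\in L^2(D):(-\Delta)^su\in L^2(D)\}$, a complex Hilbert space with inner product $(u,v)_{\mathscr L_s}=((-\Delta)^su,(-\Delta)^sv)_{L^2}$ and norm $\|\cdot\|_{\mathscr L_s}$; one has $C_0^\infty(D)\subseteq\mathscr L_s(D)$. For $t>0$, $\mathscr L_{-t}(D)$ is the space of all $u=\sum_na_nw_n$ with $(a_n)\subset\mathbb C$ and $\sum_n\lambda_n^{-2t}|a_n|^2<\infty$, regarded as elements of the dual $\mathscr L_t'(D)$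 (and acting on test functions as distributions by $\langle u,\phi\rangle=\sum_na_n\langle w_n,\phi\rangle$, where $\langle w_n,\phi\rangle=\int_Dw_n\phi\,dx$). It is a complex Hilbert space with inner product $(u,v)_{\mathscr L_{-t}}=((-\Delta)^{-t}u,(-\Delta)^{-t}v)_{L^2}$, where $(-\Delta)^{-t}u=\sum_n\lambda_n^{-t}a_nw_n$. A complex Gaussian field with values in a separable complex Banach space $B$ is a Borel measurable map $Z$ from a probability space to $B$ such that $f(Z)$ is a complex Gaussian random variable (real and imaginary parts jointly Gaussian, degenerate cases allowed) for every $f\in B'$. $\mathcal{CN}(\mu,\sigma^2,\rho)$ denotes the complex Gaussian law with mean $\mu$, variance $\mathbb E|\xi-\mu|^2=\sigma^2$ and pseudo-variance $\mathbb E(\xi-\mu)^2=\rho$. *)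

(* Defs.v *)
From HB Require Import structures.
From mathcomp Require Import all_boot all_order all_algebra.
From mathcomp Require Import complex.
From mathcomp Require Import all_classical all_reals all_analysis.
From mathcomp Require Import ring lra.

Set Implicit Arguments.
Unset Strict Implicit.
Unset Printing Implicit Defensive.

Import Order.TTheory GRing.Theory Num.Theory.
Import numFieldNormedType.Exports.

Local Open Scope classical_set_scope.
Local Open Scope ring_scope.

(** * Lebesgue measure on R^d *)

Notation borel V := (g_sigma_algebraType (@open V)).

Section lebesgue_tuple.
Context {R : realType}.
Local Notation M := (measurableTypeR R).

Section cons.
Variables (n : nat) (mu : {sigma_finite_measure set (n.-tuple M) -> \bar R}).

Definition tcons (p : M * n.-tuple M) : n.+1.-tuple M := [tuple of p.1 :: p.2].

Lemma measurable_tcons : measurable_fun setT tcons.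
Proof. exact: (measurable_cons measurable_fst measurable_snd). Qed.

Definition lebesgue_cons : set (n.+1.-tuple M) -> \bar R :=
  pushforward (@lebesgue_measure R \x mu)%E tcons.

Let lebesgue_cons0 : lebesgue_cons set0 = 0%E.
Proof. by rewrite /lebesgue_cons /pushforward preimage_set0 measure0. Qed.

Let lebesgue_cons_ge0 A : (0 <= lebesgue_cons A)%E.
Proof. by apply: measure_ge0; exact: measurable_tcons. Qed.

Let lebesgue_cons_sigma_additive : semi_sigma_additive lebesgue_cons.
Proof.
by apply: measure_semi_sigma_additive; exact: measurable_tcons.
Qed.

HB.instance Definition _ := isMeasure.Build _ _ _ lebesgue_cons
  lebesgue_cons0 lebesgue_cons_ge0 lebesgue_cons_sigma_additive.

Let lebesgue_cons_sigma_finite : sigma_finite setT lebesgue_cons.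
Proof.
pose g (u : n.+1.-tuple M) : M * n.-tuple M := (thead u, [tuple of behead u]).
have mg : measurable_fun setT g.
  by apply/measurable_fun_pair; [exact: measurable_tnth|exact: measurable_behead].
have gK p : g (tcons p) = p.
  by case: p => x t; rewrite /g /tcons; congr pair; apply/val_inj.
have /sigma_finiteP[F [TF ndF Foo]] := sigma_finiteT (@lebesgue_measure R).
have /sigma_finiteP[G [TG ndG Goo]] := sigma_finiteT mu.
exists (fun k => g @^-1` (F k `*` G k)).
  apply/esym; rewrite -subTset => u _; have [i _ Fi] : (\bigcup_i F i) (thead u).
    by rewrite -TF.
  have [j _ Gj] : (\bigcup_j G j) [tuple of behead u] by rewrite -TG.
  exists (maxn i j) => //; split => /=.
  - by move: Fi; exact/subsetPset/ndF/leq_maxl.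
  - by move: Gj; exact/subsetPset/ndG/leq_maxr.
move=> k; have [mF Fk] := Foo k; have [mG Gk] := Goo k; split.
  by rewrite -[X in measurable X]setTI; apply: mg => //; exact: measurableX.
rewrite /lebesgue_cons /pushforward -comp_preimage.
rewrite (_ : g \o tcons = id) ?preimage_id; last by apply/funext => p; exact: gK.
by rewrite product_measure1E// lte_mul_pinfty// ge0_fin_numE.
Qed.

HB.instance Definition _ := Measure_isSigmaFinite.Build _ _ _ lebesgue_cons
  lebesgue_cons_sigma_finite.

End cons.

Fixpoint lebesgue_tuple n : {sigma_finite_measure set (n.-tuple M) -> \bar R} :=
  match n with
  | 0 => \d_[tuple]
  | n'.+1 => lebesgue_cons (lebesgue_tuple n')
  end.

End lebesgue_tuple.

Section lebesgue_vec.
Context {R : realType} {d : nat}.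
Local Notation M := (measurableTypeR R).
Local Notation V := 'rV[R]_d.

Definition row_of_tuple (u : d.-tuple M) : borel V := \row_i tnth u i.

Let measurable_row_ball (c : V) (e : R) :
  measurable (row_of_tuple @^-1` ball c e).
Proof.
have [e0|e0] := ltP 0 e; last first.
  rewrite (_ : _ @^-1` _ = set0)//; apply/seteqP; split=> // u /= [e0' _].
  by move: e0'; rewrite ltNge e0.
rewrite (_ : _ @^-1` _ =
    \bigcap_(i in [set: 'I_d]) (@tnth d M ^~ i) @^-1` (ball (c ord0 i) e)).
  apply: fin_bigcap_measurable => // i _.
  rewrite -[X in measurable X]setTI; apply: measurable_tnth => //.
  rewrite ball_itv; exact: measurable_itv.
apply/seteqP; split => u /=.
  by move=> [_ cu] i _ /=; have := cu ord0 i; rewrite mxE.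
move=> cu; split=> // i j; rewrite ord1 mxE; exact: cu.
Qed.

Lemma measurable_row_of_tuple : measurable_fun setT row_of_tuple.
Proof.
apply: (@measurability _ _ _ (borel V) setT row_of_tuple (@open V)) => // _ [U oU <-]; rewrite setTI.
pose I := ('rV[rat]_d * nat)%type.
pose b (i : I) : set V := ball (map_mx (@ratr R) i.1 : V) (i.2.+1%:R^-1 : R).
have -> : U = \bigcup_(i : I) (if `[< b i `<=` U >] then b i else set0).
  apply/seteqP; split=> [x Ux|x [i _]]; last by case: asboolP => // bU /bU.
  have := open_nbhs_nbhs (conj oU Ux); rewrite -nbhs_ballE => -[e /= e0 eU].
  have [n ne] : exists n : nat, n.+1%:R^-1 < e / 2.
    have e20 : 0 < e / 2 by rewrite divr_gt0.
    by have [n _ /(_ n (leqnn n))] := near_infty_natSinv_lt (PosNum e20); exists n.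
  have n0 : 0 < n.+1%:R^-1 :> R by [].
  have hq j : exists q : rat, `|x ord0 j - ratr q| < n.+1%:R^-1.
    have /rat_in_itvoo[q] : x ord0 j - n.+1%:R^-1 < x ord0 j + n.+1%:R^-1.
      by rewrite ltrD2l (lt_trans _ n0)// oppr_lt0.
    by rewrite in_itv/= => qx; exists q; rewrite ltr_distlC.
  pose q : 'rV[rat]_d := \row_j xchoose (hq j).
  have xq : b (q, n) x.
    split=> // i j; rewrite ord1 /= !mxE -ball_normE /= distrC.
    exact: (xchooseP (hq j)).
  exists (q, n) => //; case: asboolP => // -[] y qy; apply: eU.
  have xy := ball_triangle (ball_sym xq) qy.
  by apply: (le_ball _ xy); rewrite (splitr e) lerD// ltW.
rewrite preimage_bigcup; apply: countable_bigcupT_measurable => [|i].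
  exact: (@countableP ('rV[rat]_d * nat)%type).
by case: asboolP => _; [exact: measurable_row_ball|rewrite preimage_set0].
Qed.

Definition lebesgue_vec : set (borel V) -> \bar R :=
  pushforward (@lebesgue_tuple R d) row_of_tuple.

Let lebesgue_vec0 : lebesgue_vec set0 = 0%E.
Proof. by rewrite /lebesgue_vec /pushforward preimage_set0 measure0. Qed.

Let lebesgue_vec_ge0 A : (0 <= lebesgue_vec A)%E.
Proof. by apply: measure_ge0; exact: measurable_row_of_tuple. Qed.

Let lebesgue_vec_sigma_additive : semi_sigma_additive lebesgue_vec.
Proof.
by apply: measure_semi_sigma_additive; exact: measurable_row_of_tuple.
Qed.

HB.instance Definition _ := isMeasure.Build _ _ _ lebesgue_vec
  lebesgue_vec0 lebesgue_vec_ge0 lebesgue_vec_sigma_additive.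

End lebesgue_vec.

(** * Function spaces on a domain of R^d *)

Notation normc := ComplexField.Normc.normc.

Section function_spaces.
Context {R : realType} {d : nat}.
Local Notation V := 'rV[R]_d.
Local Notation leb := (@lebesgue_vec R d).
Implicit Types (D : set V) (f g : V -> R) (u v : V -> R[i]).

Definition partial (i : 'I_d) f : V -> R := 'D_(delta_mx ord0 i) f.

Definition iter_partial (s : seq 'I_d) f : V -> R := foldr partial f s.

Definition smooth f := forall s : seq 'I_d,
  continuous (iter_partial s f) /\
  forall i x, derivable (iter_partial s f) x (delta_mx ord0 i).

(* real-valued elements of C_0^oo(D), extended by 0 to R^d *)
Definition real_test_function D f :=
  [/\ smooth f, compact (closure [set x | f x != 0])
    & closure [set x | f x != 0] `<=` D].

Definition test_function D u :=
  real_test_function D (fun x => complex.Re (u x)) /\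
  real_test_function D (fun x => complex.Im (u x)).

(* Elements of L^2 are represented by functions; only the values on D matter. *)
Definition real_L2 D f :=
  measurable_fun (D : set (borel V)) f /\
  leb.-integrable D (fun x => (f x ^+ 2)%:E).

Definition L2 D u :=
  real_L2 D (fun x => complex.Re (u x)) /\
  real_L2 D (fun x => complex.Im (u x)).

Definition real_L2norm D f : R := Num.sqrt (\int[leb]_(x in D) (f x ^+ 2)).

Definition L2norm D u : R := Num.sqrt (\int[leb]_(x in D) (normc (u x) ^+ 2)).

Definition cintegral D u : R[i] :=
  ((\int[leb]_(x in D) complex.Re (u x)) +i*
   (\int[leb]_(x in D) complex.Im (u x)))%C.

Definition weak_gradient D f (G : 'I_d -> V -> R) := forall i,
  real_L2 D (G i) /\
  forall phi, real_test_function D phi ->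
    \int[leb]_(x in D) (f x * partial i phi x) =
    - \int[leb]_(x in D) (G i x * phi x).

(* f belongs to H^1_0(D), the closure of C_0^oo(D) in H^1(D), and has weak
   gradient G *)
Definition H10 D f (G : 'I_d -> V -> R) :=
  [/\ real_L2 D f, weak_gradient D f G
    & exists phi : nat -> V -> R,
      [/\ forall n, real_test_function D (phi n),
          real_L2norm D (fun x => phi n x - f x) @[n --> \oo] --> 0
        & forall i,
          real_L2norm D (fun x => partial i (phi n) x - G i x)
            @[n --> \oo] --> 0]].

(* f is a weak solution in H^1_0(D) of - Delta f = l f *)
Definition weak_eigenfunction D (l : R) f := exists G, H10 D f G /\
  forall phi, real_test_function D phi ->
    \sum_i \int[leb]_(x in D) (G i x * partial i phi x) =
    l * \int[leb]_(x in D) (f x * phi x).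

Definition orthonormal_basis D (w : nat -> V -> R) :=
  [/\ forall n, real_L2 D (w n),
      forall n m, \int[leb]_(x in D) (w n x * w m x) = (n == m)%:R
    & forall f, real_L2 D f -> forall e : R, 0 < e ->
      exists N (c : nat -> R),
        real_L2norm D (fun x => f x - \sum_(k < N) c k * w k x) < e].

End function_spaces.

Record dirichlet_eigenbasis (R : realType) (d : nat) (D : set 'rV[R]_d) := {
  eigfun : nat -> 'rV[R]_d -> R ;
  eigval : nat -> R ;
  eigfun_basis : orthonormal_basis D eigfun ;
  eigfun_weak : forall n, weak_eigenfunction D (eigval n) (eigfun n) ;
  eigval_gt0 : forall n, 0 < eigval n ;
  eigval_nondecreasing : {homo eigval : m n / (m <= n)%N >-> m <= n} }.

(** * Fractional powers of the Laplacian *)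

Section fractional_laplacian.
Context {R : realType} {d : nat} {D : set 'rV[R]_d}.
Variable B : dirichlet_eigenbasis D.
Local Notation V := 'rV[R]_d.
Local Notation w := (eigfun B).
Local Notation lambda := (eigval B).
Implicit Types (u v : V -> R[i]) (s t : R) (a : nat -> R[i]).

(* (u, w_n)_{L^2}, which is also <w_n, u> since w_n is real-valued *)
Definition coef u n : R[i] := cintegral D (fun x => u x * (w n x)%:C%C).

(* v is the sum in L^2(D) of the series \sum_n lambda_n^s (u, w_n) w_n *)
Definition is_fracLaplacian s u v := L2 D v /\
  L2norm D (fun x => v x -
    \sum_(k < n) (lambda k `^ s)%:C%C * coef u k * (w k x)%:C%C)
  @[n --> \oo] --> 0.

Definition fracLaplacian s u : V -> R[i] :=
  xget (fun=> 0) [set v | is_fracLaplacian s u v].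

Definition Ls s : set (V -> R[i]) :=
  [set u | L2 D u /\ exists v, is_fracLaplacian s u v].

Definition Ls_norm s u : R := L2norm D (fracLaplacian s u).

(* A formal series \sum_n a_n w_n is represented by its coefficients; it
   belongs to L^2(D) iff (a_n) is in l^2, with the same norm. *)
Definition fracLaplacian_series s a n : R[i] := (lambda n `^ s)%:C%C * a n.

End fractional_laplacian.

Section l2.
Context {R : realType}.
Implicit Types (a b : nat -> R[i]).

Definition l2 : set (nat -> R[i]) :=
  [set a | cvgn (series (fun n => normc (a n) ^+ 2))].

Definition l2norm a : R := Num.sqrt (limn (series (fun n => normc (a n) ^+ 2))).

Let normc_ge0 (z : R[i]) : 0 <= normc z.
Proof. by case: z => x y; exact: sqrtr_ge0. Qed.

Let nd a : nondecreasing_seq (series (fun n => normc (a n) ^+ 2)).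
Proof. by apply: nondecreasing_series => n _ _; exact: sqr_ge0. Qed.

Lemma l2_le a (M : R) :
  (forall n, series (fun n => normc (a n) ^+ 2) n <= M) ->
  0 <= M -> l2 a /\ l2norm a <= Num.sqrt M.
Proof.
move=> aM M0; have ca : l2 a.
  by apply: nondecreasing_is_cvgn; [exact: nd|exists M => _ [n _ <-]; exact: aM].
split=> //; rewrite ler_sqrt//; apply: limr_le => //.
by apply: nearW.
Qed.

Lemma l2norm_ge a n : l2 a -> series (fun n => normc (a n) ^+ 2) n <= l2norm a ^+ 2.
Proof.
move=> ca; rewrite sqr_sqrtr; last first.
  by apply: limr_ge => //; apply: nearW => m; apply: sumr_ge0 => i _; exact: sqr_ge0.
exact: nondecreasing_cvgn_le.
Qed.

Lemma l2norm_ge0 a : 0 <= l2norm a. Proof. exact: sqrtr_ge0. Qed.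

Lemma l2Z (c : R[i]) a : l2 a ->
  l2 (fun n => c * a n) /\ l2norm (fun n => c * a n) = normc c * l2norm a.
Proof.
move=> ca; rewrite /l2 /l2norm /=.
rewrite (_ : (fun n => normc (c * a n) ^+ 2) =
             normc c ^+ 2 \*: (fun n => normc (a n) ^+ 2)); last first.
  by apply/funext => n /=; rewrite ComplexField.Normc.normcM exprMn.
split; first exact: is_cvg_seriesZ.
by rewrite lim_seriesZ// sqrtrM ?sqr_ge0// sqrtr_sqr ger0_norm.
Qed.

Lemma cauchy_schwarz_sum (x y : nat -> R) n :
  \sum_(0 <= k < n) x k * y k <=
  Num.sqrt (\sum_(0 <= k < n) x k ^+ 2) * Num.sqrt (\sum_(0 <= k < n) y k ^+ 2).
Proof.
elim: n => [|n IH]; first by rewrite !big_geq// sqrtr0 mulr0.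
have s0 (z : nat -> R) : 0 <= \sum_(0 <= k < n) z k ^+ 2.
  by apply: sumr_ge0 => i _; exact: sqr_ge0.
rewrite !big_nat_recr//=; apply: (le_trans (lerD IH (lexx _))).
rewrite -[leRHS]sqrtrM ?addr_ge0 ?sqr_ge0//.
apply: (le_trans (ler_norm _)); rewrite -sqrtr_sqr ler_wsqrtr//.
set p := Num.sqrt _; set q := Num.sqrt _.
have <- : p ^+ 2 = \sum_(0 <= k < n) x k ^+ 2 by exact: sqr_sqrtr.
have <- : q ^+ 2 = \sum_(0 <= k < n) y k ^+ 2 by exact: sqr_sqrtr.
rewrite -subr_ge0 (_ : _ - _ = (p * y n - x n * q) ^+ 2) ?sqr_ge0//; ring.
Qed.

Lemma l2D a b : l2 a -> l2 b ->
  l2 (fun n => a n + b n) /\ l2norm (fun n => a n + b n) <= l2norm a + l2norm b.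
Proof.
move=> la lb; have A0 := l2norm_ge0 a; have B0 := l2norm_ge0 b.
have [||lab] := @l2_le (fun n => a n + b n) ((l2norm a + l2norm b) ^+ 2).
- move=> n; rewrite /series/=.
  have cs : \sum_(0 <= k < n) normc (a k) * normc (b k) <= l2norm a * l2norm b.
    apply: (le_trans (cauchy_schwarz_sum _ _ _)).
    apply: ler_pM; rewrite ?sqrtr_ge0// -[leRHS]ger0_norm// -sqrtr_sqr ler_wsqrtr//.
      exact: l2norm_ge.
    exact: l2norm_ge.
  apply: (@le_trans _ _
    (\sum_(0 <= k < n) (normc (a k) ^+ 2 + normc (b k) ^+ 2 +
                        (normc (a k) * normc (b k)) *+ 2))).
    apply: ler_sum => k _; rewrite addrAC -sqrrD.
    rewrite lerXn2r ?nnegrE ?addr_ge0 ?normc_ge0//; exact: le_normcD.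
  rewrite 2!big_split/= sumrMnl sqrrD [leRHS]addrAC.
  apply: lerD; last by rewrite lerMn2r.
  by apply: lerD; exact: l2norm_ge.
- exact: sqr_ge0.
by rewrite sqrtr_sqr ger0_norm ?addr_ge0.
Qed.

Lemma l2norm_eq0 a : l2 a -> l2norm a = 0 -> forall n, a n = 0.
Proof.
move=> la a0 n; have := l2norm_ge n.+1 la; rewrite a0 expr0n/= /series/=.
rewrite big_nat_recr//= => an; apply/ComplexField.Normc.eq0_normc/eqP.
rewrite -sqrf_eq0 eq_le sqr_ge0 andbT; apply: le_trans an.
by rewrite lerDr sumr_ge0// => i _; exact: sqr_ge0.
Qed.
End l2.

(** * The spaces L_{-t}(D) *)

(* L_{-t}(D) is the space of formal series \sum_n a_n w_n with
   (- Delta)^{-t} (a_n) in l^2, normed by the l^2 norm of (- Delta)^{-t} (a_n) *)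

Section Lneg.
Context {R : realType} {d : nat} {D : set 'rV[R]_d}.
Variables (B : dirichlet_eigenbasis D) (t : R).

Definition Lneg_pred : {pred (nat -> R[i])} :=
  mem [set a | l2 (fracLaplacian_series B (- t) a)].

Record Lneg := LnegSub { lneg_coef :> nat -> R[i]; _ : lneg_coef \in Lneg_pred }.

HB.instance Definition _ := [isSub for lneg_coef].
HB.instance Definition _ := [Choice of Lneg by <:].

Let fracD (a b : nat -> R[i]) : fracLaplacian_series B (- t) (a + b) =
  fun n => fracLaplacian_series B (- t) a n + fracLaplacian_series B (- t) b n.
Proof. by apply/funext => n; rewrite /fracLaplacian_series mulrDr. Qed.

Let fracZ (c : R[i]) (a : nat -> R[i]) : fracLaplacian_series B (- t) (c *: a) =
  fun n => c * fracLaplacian_series B (- t) a n.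
Proof. by apply/funext => n; rewrite /fracLaplacian_series mulrCA. Qed.

Lemma Lneg_submod_closed : submod_closed Lneg_pred.
Proof.
split=> [|c a b]; rewrite !inE /=.
  rewrite -[0](scale0r (0 : nat -> R[i])) fracZ.
  have [||//] := @l2_le R (fun n => 0 * fracLaplacian_series B (- t) 0 n) 0 => //.
  move=> n; rewrite /series/= big1// => i _.
  by rewrite !mul0r subr0 addr0 expr0n addr0 sqrtr0 expr0n.
move=> la lb; rewrite fracD fracZ.
by apply: (l2D _ lb).1; exact: (l2Z c la).1.
Qed.

HB.instance Definition _ := GRing.isSubmodClosed.Build _ _ Lneg_pred
  Lneg_submod_closed.
HB.instance Definition _ := [SubChoice_isSubLmodule of Lneg by <:].

Let LnegP (a : Lneg) : l2 (fracLaplacian_series B (- t) a).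
Proof. by have := valP a; rewrite inE. Qed.

Definition Lneg_norm (a : Lneg) : R[i] :=
  (l2norm (fracLaplacian_series B (- t) a))%:C%C.

Lemma Lneg_normD (a b : Lneg) : Lneg_norm (a + b) <= Lneg_norm a + Lneg_norm b.
Proof.
rewrite /Lneg_norm -rmorphD lecR fracD.
by apply: (l2D _ _).2; exact: LnegP.
Qed.

Lemma Lneg_normZ (c : R[i]) (a : Lneg) : Lneg_norm (c *: a) = `|c| * Lneg_norm a.
Proof.
rewrite /Lneg_norm fracZ (l2Z _ (@LnegP a)).2 rmorphM; congr (_ * _).
Qed.

Lemma Lneg_norm_eq0 (a : Lneg) : Lneg_norm a = 0 -> a = 0.
Proof.
move=> /eqP; rewrite -(rmorph0 (real_complex R)) (inj_eq (@complexI R)) => /eqP a0.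
apply/val_inj/funext => n; have /eqP := l2norm_eq0 (@LnegP a) a0 n.
rewrite mulf_eq0 => /orP[|/eqP//].
rewrite -(rmorph0 (real_complex R)) (inj_eq (@complexI R)).
by rewrite gt_eqF// powR_gt0// eigval_gt0.
Qed.


HB.instance Definition _ := Lmodule_isNormed.Build R[i] Lneg
  Lneg_normD Lneg_normZ Lneg_norm_eq0.

(* <\sum_n a_n w_n, phi> = \sum_n a_n <w_n, phi> *)
Definition pairing (a : Lneg) (phi : 'rV[R]_d -> R[i]) : R[i] :=
  limn (series (fun n => lneg_coef a n * coef B phi n : R[i]^o)).

End Lneg.

(** * Complex Gaussian variables and fields *)

Section gaussian.
Context {R : realType} {dT : measure_display} {T : measurableType dT}.
Variable P : probability T R.

(* [normal_prob m 0] is not the Dirac mass at m in the library, whence the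
   separate treatment of the degenerate case *)
Definition gaussian (X : T -> R) :=
  measurable_fun setT X /\
  exists m s : R, forall A : set (measurableTypeR R), measurable A ->
    pushforward P (X : T -> measurableTypeR R) A =
    if s == 0 then \d_m A else normal_prob m s A.

(* joint Gaussianity of the real and imaginary parts *)
Definition complex_gaussian (X : T -> R[i]) := forall a b : R,
  gaussian (fun x => a * complex.Re (X x) + b * complex.Im (X x)).

Definition cexpectation (X : T -> R[i]) : R[i] :=
  (fine ('E_P[fun x => complex.Re (X x)])%E +i*
   fine ('E_P[fun x => complex.Im (X x)])%E)%C.

(* X has law CN(mu, sigma2, rho) *)
Definition CN (mu : R[i]) (sigma2 : R) (rho : R[i]) (X : T -> R[i]) :=
  [/\ complex_gaussian X, cexpectation X = mu,
      ('E_P[fun x => (normc (X x - mu) ^+ 2)%R])%E = sigma2%:E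
    & cexpectation (fun x => (X x - mu) ^+ 2) = rho].

(* [{linear B -> R[i]^o}] together with continuity is the dual B'. The
   definition makes sense for any complex normed space, complete or not. *)
Definition complex_gaussian_field (B : normedModType R[i]) (Z : T -> B) :=
  measurable_fun setT (Z : T -> borel B) /\
  forall f : {linear B -> R[i]^o}, continuous f ->
    complex_gaussian (fun x => f (Z x)).

End gaussian.

(* Main.v *)
From HB Require Import structures.
Require Import Defs.
From mathcomp Require Import all_boot all_order all_algebra.
From mathcomp Require Import complex.
From mathcomp Require Import all_classical all_reals all_analysis.
From mathcomp Require Import measurable_realfun ring lra.
Import Order.TTheory GRing.Theory Num.Theory.
Import numFieldNormedType.Exports.
Local Open Scope classical_set_scope.
Local Open Scope ring_scope.
Set Implicit Arguments.
Unset Strict Implicit.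
Unset Printing Implicit Defensive.

(**
The field is the random series Z = sum_n lambda_n^s xi_n w_n, where the xi_n
are independent standard complex Gaussian variables. For a test function phi,
the pairing <Z, phi> = sum_n lambda_n^s xi_n <w_n, phi> is a sum of
independent circular Gaussian variables, hence circular with variance
sum_n lambda_n^(2s) |<w_n, phi>|^2, and by orthonormality of the w_n this is
the squared norm of phi in L_s (fracLaplacian_norm, pairing_CN). Four points
carry the argument.

Convergence. With t = s + d, the expectation of sum_n lambda_n^(-2t)
|lambda_n^s xi_n|^2 is sum_n lambda_n^(-2d), so that Z lies almost surely in
L_(-t) as soon as this series converges (sum_eigval_le). This needs only a
crude form of Weyl's law, N <= C (1 + lambda_N)^d (eigenvalue_count). Extended
by 0, an eigenfunction moves in L^2 by at most a constant times
|v| lambda_n^(1/2) under the translation by v (H10_shift and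
eigenfunction_energy, by approximation with test functions). If the side h of
the cube Q = [0, h]^d is small compared to lambda_N^(-1/2), each of
w_0, ..., w_(N-1) is therefore close in L^2 to its averages over the cubes
x + Q. By Bessel's inequality for the indicator function of x + Q, the squares
of these averages sum to at most 1/|Q| at each x. Integration over D bounds N
by a constant times |D|/|Q|.

Test functions. From lambda_n <w_n, phi> = - <w_n, Delta phi> the coefficients
of phi decay faster than every power of lambda_n (coef_decay). Thus
sum_n lambda_n^s <w_n, phi> w_n has absolutely summable coefficients and, D
having finite measure, converges absolutely almost everywhere on D; Fatou's
lemma turns this into convergence in L^2 (orthonormal_series), which shows
that phi belongs to L_s.

Gaussian variables. The binary digits of even rank and those of odd rank of a
uniform number in [0, 1] form two independent uniform numbers (evenbits_pair).
Splitting the odd half again and again gives a sequence of independent uniform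
numbers, which the quantile transform makes standard normal. Linear
combinations remain normal because the product of two standard normal
densities is invariant under rotation (stdnormal_rotation), and almost sure
limits of centred normal variables are centred normal (centered_normal_lim).

Values in L_(-t). Finite series with rational coefficients are dense, so the
Borel sets of L_(-t) are generated by countably many balls and Z is measurable
because the norms of its differences with fixed elements are
(measurable_Lneg). A continuous linear functional f satisfies
|f(w_n)| <= C lambda_n^(-t), so that f(Z) is the limit of partial sums whose
variances converge (gaussian_field_gaussian).
*)

(** * Binary digits and independent uniform variables *)

Section push.
Context d d' (T1 : measurableType d) (T2 : measurableType d') (R : realType).
Variables (m : {measure set T1 -> \bar R}) (f : T1 -> T2).
Hypothesis mf : measurable_fun setT f.
Definition image_measure : {measure set T2 -> \bar R} :=
  @measure_function_pushforward__canonical__measure_function_Measure _ _ T1 T2 R m f mf.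
End push.

Section affine.
Context {R : realType}.
Notation M := (measurableTypeR R).
Notation leb := (@lebesgue_measure R).

Definition affine (c d : R) : M -> M := fun x => c * x + d.

Lemma measurable_affine c d : measurable_fun setT (affine c d).
Proof. by apply: measurable_funD => //; exact: measurable_funM. Qed.

(** Both sides are measures of A that agree on bounded intervals. *)
Lemma lebesgue_affine (c d : R) (A : set M) : 0 < c -> measurable A ->
  (c%:E * leb (affine c d @^-1` A))%E = leb A.
Proof.
move=> c0 mA.
pose mu : {measure set M -> \bar R} := mscale (NngNum (ltW c0)) (image_measure leb
    (measurable_affine c d)).
have H : forall A, measurable A -> leb A = mu A.
  apply: lebesgue_measure_unique => _ [[a b]] _ <-; rewrite [LHS]lebesgue_measure_itv.
  rewrite /mu /= /mscale /= /pushforward.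
  rewrite (_ : affine c d @^-1` _ = `](a - d) / c, (b - d) / c]%classic); last first.
    apply/seteqP; split => x; rewrite /= !in_itv/= /affine;
      by rewrite ltr_pdivrMr// ler_pdivlMr// ltrBlDr lerBrDr ![_ * c]mulrC.
  rewrite !lebesgue_measure_itv/= !lte_fin ltr_pM2r ?invr_gt0// ltrD2r.
  case: ifPn => _; last by rewrite mule0.
  by rewrite -!EFinB -EFinM; congr EFin; field; rewrite gt_eqF.
exact/esym/H.
Qed.
End affine.

Section doubling.
Context {R : realType}.
Notation M := (measurableTypeR R).
Notation leb := (@lebesgue_measure R).
Definition unifP : probability M R := uniform_prob (@ltr01 R).

Lemma unifPE (A : set M) : measurable A -> unifP A = leb (A `&` `[0, 1]%classic).
Proof.
move=> mA; rewrite /unifP /= /uniform_prob integral_uniform_pdf.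
rewrite (eq_integral (fun=> 1%E)); last first.
  move=> x; rewrite inE/= in_itv/= => -[_ x01].
  by rewrite /uniform_pdf x01 subr0 invr1.
by rewrite integral_cst ?mul1e//; exact: measurableI.
Qed.

(** The first binary digit of a point of [0, 1]; with [doubling], which shifts
the digits by one place, it gives access to all of them. *)
Definition fstbit (x : M) : R := if x < 2^-1 then 0 else 1.
Definition doubling (x : M) : M := 2 * x - fstbit x.

(** The number whose digits are those of x at the even ranks 0, 2, 4, ... *)
Definition evenbits (x : M) : R :=
  limn (series (fun k => fstbit (iter k.*2 doubling x) / 2 ^+ k.+1)).

Lemma measurable_fstbit : measurable_fun setT fstbit.
Proof. by apply: measurable_fun_ifT => //; exact: measurable_fun_ltr. Qed.

Lemma measurable_doubling : measurable_fun setT doubling.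
Proof. apply: measurable_funB => //; exact: measurable_fstbit. Qed.

Lemma measurable_iter_doubling n : measurable_fun setT (iter n doubling).
Proof. by elim: n => [|n IH]; [exact: measurable_id|exact: (measurableT_comp
    measurable_doubling IH)]. Qed.

Let term x k := fstbit (iter k.*2 doubling x) / 2 ^+ k.+1.

Lemma fstbit01 x : 0 <= fstbit x <= 1.
Proof. by rewrite /fstbit; case: ifP; rewrite ?lexx ?ler01. Qed.

Lemma evenbits_cvg x : cvgn (series (term x)).
Proof.
apply: (@series_le_cvg R (term x) (geometric 2^-1 2^-1)).
- by move=> n; rewrite /term mulr_ge0//; case/andP: (fstbit01 (iter n.*2 doubling x)).
- by move=> n; rewrite /= mulr_ge0// exprn_ge0.
- move=> n; rewrite /term /= exprS invfM -exprVn ler_piMl//.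
  by case/andP: (fstbit01 (iter n.*2 doubling x)).
- by apply: is_cvg_geometric_series; rewrite ger0_norm// invf_lt1// ltr1n.
Qed.

Lemma measurable_evenbits : measurable_fun setT evenbits.
Proof.
apply: (@measurable_fun_cvg _ _ _ _ (fun n x => series (term x) n)) => //.
- move=> n; rewrite /series /=; apply: measurable_sum => k.
  apply: measurable_funM => //.
  exact: (measurableT_comp measurable_fstbit (measurable_iter_doubling _)).
- by move=> x _; exact: evenbits_cvg.
Qed.

(** The digit of rank 0 is the leading digit of [evenbits x], and deleting the
digits of rank 0 and 1 of x deletes that digit. *)
Lemma evenbitsE x : evenbits x = (fstbit x + evenbits (doubling (doubling x))) / 2.
Proof.
rewrite /evenbits -/(term x) -/(term (doubling (doubling x))).
have H n : series (term x) n.+1 = (fstbit x + series (term (doubling (doubling x))) n) / 2.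
  rewrite /series /= big_nat_recl// mulrDl; congr (_ + _).
  rewrite mulr_suml; apply: eq_bigr => k _.
  by rewrite /term doubleS -!iterSr exprS invfM mulrCA mulrC.
have : series (term x) n.+1 @[n --> \oo] --> limn (series (term x)).
  by have := @evenbits_cvg x; rewrite -(cvg_shiftS (series (term x))).
under eq_cvg do rewrite H.
move=> /cvg_lim <- //; apply: cvg_lim => //.
apply: cvgM; last exact: cvg_cst.
by apply: cvgD; [exact: cvg_cst|exact: evenbits_cvg].
Qed.

Lemma evenbits01 x : 0 <= evenbits x <= 1.
Proof.
have C n : 0 <= series (term x) n <= 1 - (2^-1) ^+ n.
  elim: n => [|n /andP[H1 H2]]; first by rewrite /series /= big_geq// expr0 subrr lexx.
  have : 0 <= term x n <= (2^-1) ^+ n.+1.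
    rewrite /term exprVn; case/andP: (fstbit01 (iter n.*2 doubling x)) => b0 b1.
    by rewrite divr_ge0//= ler_piMl.
  rewrite seriesSr exprS => /andP[H3 H4]; apply/andP; split; lra.
apply/andP; split.
  by apply: limr_ge; [exact: evenbits_cvg|apply: nearW => n; case/andP: (C n)].
apply: limr_le; [exact: evenbits_cvg|apply: nearW => n; case/andP: (C n) => _ H].
by apply: (le_trans H); rewrite gerBl exprn_ge0.
Qed.
End doubling.

Lemma measurable_preimage d d' (T1 : measurableType d) (T2 : measurableType d')
    (f : T1 -> T2) (A : set T2) :
  measurable_fun setT f -> measurable A -> measurable (f @^-1` A).
Proof. by move=> mf mA; rewrite -[X in measurable X]setTI; exact: mf. Qed.

Section pair.
Context {R : realType}.
Notation M := (measurableTypeR R).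
Notation leb := (@lebesgue_measure R).
Notation P := (@unifP R).

Let mbit i : measurable ([set x : M | fstbit x = i]).
Proof. exact: (measurable_preimage measurable_fstbit (measurable_set1 i)). Qed.

Lemma unifPE_co (A : set M) : measurable A -> P A = leb (A `&` `[0, 1[%classic).
Proof.
move=> mA; rewrite unifPE//.
rewrite (_ : A `&` `[0, 1]%classic = (A `&` `[0, 1[%classic) `|` (A `&` [set 1])); last first.
  rewrite -setIUr; congr (_ `&` _); apply/seteqP; split => x /=; rewrite !in_itv/=.
    by case/andP=> -> /=; rewrite le_eqVlt => /orP[/eqP ->|->]; [right|left].
  by case=> [/andP[-> /ltW ->]//|->]; rewrite ler01 lexx.
have m1 : measurable (A `&` [set (1:R)]) by exact: measurableI.
have m2 : measurable (A `&` `[0, 1[%classic) by exact: measurableI.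
apply/eqP; rewrite eq_le; apply/andP; split; last first.
  by apply: le_measure; rewrite ?inE//; exact: measurableU.
have := measureU2 leb m2 m1.
move=> /le_trans; apply.
have : (leb (A `&` [set 1%R]) <= leb [set 1%R])%E by apply: le_measure; rewrite ?inE//;
    exact: subIsetr.
by rewrite lebesgue_measure_set1 => H; rewrite -[leRHS]adde0 leeD2l.
Qed.

(** The first digit is fair and independent of the digits that follow: on each
half of [0, 1] the doubling map is affine with slope 2. *)
Lemma unifP_half (A : set M) : measurable A ->
  P ([set x | fstbit x = 0] `&` doubling @^-1` A) = ((2^-1)%:E * P A)%E /\
  P ([set x | fstbit x = 1] `&` doubling @^-1` A) = ((2^-1)%:E * P A)%E.
Proof.
move=> mA.
have mb i : measurable ([set x : M | fstbit x = i] `&` doubling @^-1` A).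
  by apply: measurableI => //; exact: (measurable_preimage measurable_doubling).
have S (d : R) (B : set M) : measurable B -> leb (affine 2 d @^-1` B) = ((2^-1)%:E * leb B)%E.
  by move=> mB; rewrite -(@lebesgue_affine R 2 d B)// muleA -EFinM mulVf// mul1e.
split.
- rewrite unifPE// unifPE_co// -(S 0); last exact: measurableI.
  congr (leb _); apply/seteqP; split => x; rewrite /= /fstbit /doubling /affine /fstbit
      !in_itv/=.
    case: ltP => [x2|x2 [[/eqP]]]; last by rewrite oner_eq0.
    by move=> [[_ xA] /andP[x0 x1]]; rewrite subr0 in xA; rewrite addr0; split => //;
        apply/andP; split; lra.
  rewrite addr0 => -[xA /andP[x0 x1]]; have x2 : x < 2^-1 by lra.
  by rewrite x2 subr0; split => //; apply/andP; split; lra.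
- rewrite unifPE// unifPE// -(S (-1)); last exact: measurableI.
  congr (leb _); apply/seteqP; split => x; rewrite /= /fstbit /doubling /affine /fstbit
      !in_itv/=.
    case: ltP => [x2 [[/eqP]]|x2]; first by rewrite eq_sym oner_eq0.
    by move=> [[_ xA] /andP[x0 x1]]; split => //; apply/andP; split; lra.
  move=> -[xA /andP[x0 x1]]; have x2 : (x < 2^-1) = false by apply/negbTE; rewrite -leNgt; lra.
  by rewrite x2; split => //; apply/andP; split; lra.
Qed.

Lemma unifP_doubling (A : set M) : measurable A -> P (doubling @^-1` A) = P A.
Proof.
move=> mA; have [H0 H1] := unifP_half mA.
have mD : measurable (@doubling R @^-1` A) by rewrite -[X in measurable X]setTI;
    apply: measurable_doubling.
rewrite (_ : doubling @^-1` A = ([set x | fstbit x = 0] `&` doubling @^-1` A) `|` ([set x |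
    fstbit x = 1] `&` doubling @^-1` A)).
  rewrite measureU; [|exact: measurableI|exact: measurableI|].
    transitivity (((2^-1)%:E * P A) + ((2^-1)%:E * P A))%E; first by congr (_ + _)%E.
    by rewrite -ge0_muleDl ?lee_fin ?invr_ge0// -EFinD -[X in (X + X)%R]mul1r -splitr mul1e.
  apply/seteqP; split => // x /= [[-> _] [/eqP]]; by rewrite eq_sym oner_eq0.
rewrite -setIUl; apply/seteqP; split => x /=; last by case.
by move=> xA; split => //; rewrite /fstbit; case: ifP; [left|right].
Qed.

(** The joint distribution function F of the two halves of the digits is
determined by a functional equation. Conditioning on the first digit gives
F(a, b) = (F(b, 2a) + F(b, 2a - 1)) / 2, with the arguments exchanged because
the odd digits of x are the even digits of [doubling x]. The product of two
uniform distribution functions satisfies it too; for 0 < a < 1 one of the two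
terms is a known boundary value, so that each use of the equation halves the
distance between the two solutions. *)
Let F (a b : R) : R :=
  fine (P [set x : M | evenbits x <= a /\ evenbits (doubling x) <= b]).

Let mle a : measurable [set x : M | evenbits x <= a].
Proof.
rewrite -[X in measurable X]setTI -/(evenbits @^-1` [set x | x <= a]).
by rewrite -set_itvNyc; apply: measurable_evenbits.
Qed.
Let mled a : measurable [set x : M | evenbits (doubling x) <= a].
Proof.
rewrite (_ : [set x : M | _] = doubling @^-1` [set x | evenbits x <= a])//.
rewrite -[X in measurable X]setTI.
by apply: measurable_doubling => //; exact: mle.
Qed.
Let mF a b : measurable [set x : M | evenbits x <= a /\ evenbits (doubling x) <= b].
Proof. exact: (measurableI _ _ (mle a) (mled b)). Qed.

Let F_rec a b : F a b = (F b (2 * a) + F b (2 * a - 1)) / 2.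
Proof.
apply: EFin_inj; rewrite EFinM EFinD {1}/F fineK; last exact: fin_num_measure.
pose E c := [set x : M | evenbits x <= b /\ evenbits (doubling x) <= c].
have [H0 _] := unifP_half (mF b (2 * a)); have [_ H1] := unifP_half (mF b (2 * a - 1)).
rewrite (_ : [set x : M | _] = ([set x | fstbit x = 0] `&` doubling @^-1` (E (2 * a))) `|`
    ([set x | fstbit x = 1] `&` doubling @^-1` (E (2 * a - 1)))).
  have mD A : measurable A -> measurable (@doubling R @^-1` A) by move=> ?;
      rewrite -[X in measurable X]setTI; apply: measurable_doubling.
  rewrite measureU.
  - rewrite /E /= H0 H1 /F !fineK ?fin_num_measure// muleC [X in (_ + X)%E]muleC -ge0_muleDl//.
  - exact: (measurableI _ _ (mbit _) (mD _ (mF _ _))).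
  - exact: (measurableI _ _ (mbit _) (mD _ (mF _ _))).
  - apply/seteqP; split => // x /= [[-> _] [/eqP]]; by rewrite eq_sym oner_eq0.
apply/seteqP; split => x /=.
  move=> [H2 H3]; move: (H2); rewrite evenbitsE /fstbit; case: ifPn => _ H.
    by left; split => //; split => //; lra.
  by right; split => //; split => //; lra.
move=> [[b0 [H2 H3]]|[b0 [H2 H3]]]; split => //; rewrite evenbitsE b0; lra.
Qed.
Let H a : R := fine (P [set x : M | evenbits x <= a]).

Let F_ge1r a b : 1 <= b -> F a b = H a.
Proof.
move=> b1; congr (fine (P _)); apply/seteqP; split => x /= => [[]//|xa]; split => //.
by have /andP[_ h] := evenbits01 (doubling x); exact: le_trans h b1.
Qed.

Let F_ge1l a b : 1 <= a -> F a b = H b.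
Proof.
move=> a1; rewrite /H -(unifP_doubling (mle b)); congr (fine (P _)).
apply/seteqP; split => x /= => [[]//|xa]; split => //.
by have /andP[_ h] := evenbits01 x; exact: le_trans h a1.
Qed.

Let H_rec a : H a = (H (2 * a) + H (2 * a - 1)) / 2.
Proof. by rewrite -(@F_ge1r a 1)// F_rec !F_ge1l. Qed.

Let H_ge1 a : 1 <= a -> H a = 1.
Proof.
move=> a1; rewrite /H (_ : [set x | _] = setT) ?probability_setT//.
apply/seteqP; split => x //= _.
by have /andP[_ h] := evenbits01 x; exact: le_trans h a1.
Qed.

Let H_ge0 a : 0 <= H a.
Proof. exact: fine_ge0. Qed.

Let H_le0 a : a <= 0 -> H a = 0.
Proof.
move=> a0; have [|a0'] := ltP a 0 => [al0|].
  rewrite /H (_ : [set x | _] = set0) ?measure0//.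
  apply/seteqP; split => x //= h.
  by have /andP[h' _] := evenbits01 x; have := le_lt_trans h al0; rewrite ltNge h'.
have N1 : H (-1) = 0.
  rewrite /H (_ : [set x | _] = set0) ?measure0//.
  apply/seteqP; split => x //= h.
  by have /andP[h' _] := evenbits01 x; have := le_trans h' h; rewrite ler0N1.
have -> : a = 0 by apply/eqP; rewrite eq_le a0 a0'.
have := H_rec 0; rewrite mulr0 sub0r N1; lra.
Qed.

(** The distribution function of the uniform law. *)
Let clamp (a : R) := if a <= 0 then 0 else if 1 <= a then 1 else a.

Let clamp01 a : 0 <= clamp a <= 1.
Proof.
rewrite /clamp; case: (leP a 0) => [|a0]; first by rewrite lexx ler01.
by case: (leP 1 a) => [|/ltW ->]; rewrite ?lexx ?ler01// ltW.
Qed.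

Let eq0_pow2 (x : R) : (forall n, `|x| <= 2^-1 ^+ n) -> x = 0.
Proof.
move=> xn; apply/eqP; rewrite -normr_le0.
have c : (2^-1 : R) ^+ n @[n --> \oo] --> 0.
  by apply: cvg_expr; rewrite ger0_norm// invf_lt1// ltr1n.
by apply: (cvgr_to_ge c); apply: nearW.
Qed.

Let clamp_rec a : clamp a = (clamp (2 * a) + clamp (2 * a - 1)) / 2.
Proof. by rewrite /clamp; do ![case: ifPn]; rewrite -?ltNge => *; lra. Qed.

Let clamp_ge1 a : 1 <= a -> clamp a = 1.
Proof. by move=> a1; rewrite /clamp a1 leNgt (lt_le_trans ltr01 a1). Qed.

Let H_clamp a : H a = clamp a.
Proof.
apply/eqP; rewrite -subr_eq0; apply/eqP; apply: eq0_pow2 => n.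
elim: n a => [|n IH] a.
  have := clamp01 a; have : H a <= 1 by rewrite -lee_fin fineK ?fin_num_measure//
      probability_le1.
  have := H_ge0 a; rewrite expr0 ler_norml => ? ? /andP[? ?]; apply/andP; split; lra.
have [a0|a0] := leP a 0.
  by rewrite H_le0// /clamp a0 subrr normr0 exprn_ge0.
have [a1|a1] := leP 1 a.
  by rewrite H_ge1// clamp_ge1// subrr normr0 exprn_ge0.
rewrite H_rec clamp_rec exprS.
have [a2|a2] := leP a 2^-1.
  have e0 : 2 * a - 1 <= 0 by lra.
  rewrite (H_le0 e0) (_ : clamp (2 * a - 1) = 0) ?addr0; last by rewrite /clamp e0.
  by rewrite -mulrBl normrM mulrC ger0_norm// ler_pM2l// IH.
have e1 : 1 <= 2 * a by lra.
rewrite (H_ge1 e1) (clamp_ge1 e1).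
rewrite -mulrBl normrM mulrC ger0_norm// ler_pM2l//.
by rewrite opprD addrACA subrr add0r IH.
Qed.

Let F_clamp a b : F a b = clamp a * clamp b.
Proof.
have F0 a' b' : 0 <= F a' b' by exact: fine_ge0.
have Fl a' b' : F a' b' <= H a'.
  rewrite -lee_fin !fineK ?fin_num_measure//; apply: le_measure; rewrite ?inE//.
  by move=> x [].
have Fr a' b' : F a' b' <= H b'.
  rewrite -lee_fin !fineK ?fin_num_measure// -(unifP_doubling (mle b')).
  apply: le_measure; rewrite ?inE//.
  - exact: mled.
  - by move=> x [].
apply/eqP; rewrite -subr_eq0; apply/eqP; apply: eq0_pow2 => n.
elim: n a b => [|n IH] a b.
  have := clamp01 a; have := clamp01 b; have := F0 a b; have := Fl a b.
  rewrite H_clamp expr0 ler_norml => ? ? /andP[? ?] /andP[? ?]; apply/andP; split; nra.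
have [a0|a0] := leP a 0.
  have /eqP := Fl a b; rewrite H_le0// => /eqP h.
  have -> : F a b = 0 by apply/eqP; rewrite eq_le h F0.
  by rewrite /clamp a0 mul0r subrr normr0 exprn_ge0.
have [a1|a1] := leP 1 a.
  by rewrite F_ge1l// H_clamp (clamp_ge1 a1) mul1r subrr normr0 exprn_ge0.
rewrite F_rec clamp_rec exprS.
have -> (x y z u v : R) : (x + y) / 2 - (u + v) / 2 * z = ((x - z * u) + (y - z * v)) / 2 by
    ring.
rewrite normrM mulrC ger0_norm// ler_pM2l//.
have [a2|a2] := leP a 2^-1.
  have e0 : 2 * a - 1 <= 0 by lra.
  have h := Fr b (2 * a - 1); rewrite H_le0// in h.
  have -> : F b (2 * a - 1) = 0 by apply/eqP; rewrite eq_le h F0.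
  rewrite (_ : clamp (2 * a - 1) = 0); last by rewrite /clamp e0.
  by rewrite mulr0 subrr addr0 IH.
have e1 : 1 <= 2 * a by lra.
rewrite (F_ge1r _ e1) H_clamp (clamp_ge1 e1).
by rewrite mulr1 subrr add0r IH.
Qed.

(** Independence and uniformity in terms of distribution functions, as obtained
from the functional equation. *)
Lemma unifP_evenbits_le (a b : R) :
  P [set x : M | evenbits x <= a /\ evenbits (doubling x) <= b] =
  (P `]-oo, a]%classic * P `]-oo, b]%classic)%E.
Proof.
have C c : P `]-oo, c]%classic = (clamp c)%:E.
  rewrite unifPE// /clamp; case: (leP c 0) => [c0|c0].
    have : (P `]-oo, c]%classic <= leb [set 0%R])%E.
      rewrite unifPE//; apply: le_measure; rewrite ?inE//; first exact: measurableI.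
      by move=> x [/=]; rewrite !in_itv/= => xc /andP[x0 _]; apply/eqP;
          rewrite eq_le x0 (le_trans xc).
    by rewrite lebesgue_measure_set1 unifPE// => h; apply/eqP; rewrite eq_le h measure_ge0.
  rewrite (_ : _ `&` _ = `[0, Num.min c 1]%classic); last first.
    apply/seteqP; split => x /=; rewrite !in_itv/= le_min.
      by move=> [-> /andP[-> ->]].
    by move=> /and3P[-> -> ->].
  rewrite lebesgue_measure_itv/= lte_fin lt_min c0 ltr01 sube0.
  by case: (leP 1 c) => c1; rewrite ?(min_r c1) ?(min_l (ltW c1)).
rewrite !C -EFinM -F_clamp fineK//; exact: fin_num_measure.
Qed.
End pair.

Definition rays (R : realType) : set (set (measurableTypeR R)) :=
  [set X | exists a : R, X = `]-oo, a]%classic].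

Lemma measurable_rays (R : realType) :
  @measurable _ (measurableTypeR R) = <<s @rays R >>.
Proof.
apply/seteqP; split; last first.
  by apply: smallest_sub; [exact: sigma_algebra_measurable|move=> _ [a ->];
      exact: measurable_itv].
apply: smallest_sub; first exact: smallest_sigma_algebra.
move=> _ [[a b] _ <-] /=.
  rewrite (_ : `]a, b]%classic = `]-oo, b]%classic `\` `]-oo, a]%classic); last first.
    apply/seteqP; split => x /=; rewrite !in_itv/=.
      by move=> /andP[ax xb]; split => //; apply/negP; rewrite -ltNge.
    by move=> [-> /negP]; rewrite -ltNge => ->.
  apply: (@measurableD _ (g_sigma_algebraType (@rays R))); apply: sub_sigma_algebra.
    by exists b.
  by exists a.
Qed.

(** The rays form a class that is stable under intersection and generates the
Borel sets. *)
Lemma measure_eq_cdf (R : realType) (m1 m2 : {measure set (measurableTypeR R) -> \bar R}) :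
  (m1 setT < +oo)%E ->
  (forall a : R, m1 `]-oo, a]%classic = m2 `]-oo, a]%classic) ->
  forall A, measurable A -> m1 A = m2 A.
Proof.
move=> foo m12 A mA.
apply: (measure_unique (@rays R) (fun n => `]-oo, n%:R]%classic)) => //.
- exact: measurable_rays.
- move=> _ _ [a ->] [b ->]; exists (Num.min a b).
  by apply/seteqP; split => x /=; rewrite !in_itv/= le_min; [move=> [-> ->]|move=> /andP[]].
- by move=> n; exists n%:R.
- apply/seteqP; split => // x _; exists (Num.truncn `|x|).+1 => //=.
  rewrite in_itv/= (le_trans (ler_norm x))// ltW//.
  exact: truncnS_gt.
- by move=> _ [a ->].
- move=> n; apply: le_lt_trans foo; apply: le_measure; rewrite ?inE//.
Qed.

Section pair_law.
Context {R : realType}.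
Notation M := (measurableTypeR R).
Notation P := (@unifP R).

(** Two finite measures on the line with the same distribution function
coincide; this extends the independence from rays to Borel sets. *)
Lemma evenbits_pair (E : set (M * M)) : measurable E ->
  P [set x | E (evenbits x : M, evenbits (doubling x) : M)] = (P \x P)%E E.
Proof.
have mev : measurable_fun setT (evenbits : M -> M) by exact: measurable_evenbits.
have mevd : measurable_fun setT (evenbits \o doubling : M -> M).
  exact: measurableT_comp measurable_evenbits measurable_doubling.
have mp : measurable_fun setT (fun x : M => (evenbits x : M, evenbits (doubling x) : M)).
  exact/measurable_fun_pair.
move=> mE; apply/esym; pose m' : {measure set (M * M) -> \bar R} := image_measure P mp.
rewrite (@product_measure_unique _ _ M M R P P m')// => A B mA mB.
rewrite /m' /= /pushforward.
(* one variable at a time: first an arbitrary set against a ray, and then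
   against an arbitrary set *)
have mpre C : measurable C -> measurable ((evenbits : M -> M) @^-1` C).
  exact: measurable_preimage.
have mpred C : measurable C -> measurable ((evenbits \o doubling : M -> M) @^-1` C).
  exact: measurable_preimage.
have step1 (b : R) C : measurable C ->
    P ((evenbits : M -> M) @^-1` C `&` (evenbits \o doubling) @^-1` `]-oo, b]%classic) =
    (P C * P `]-oo, b]%classic)%E.
  move=> mC; have mb : measurable ((evenbits \o doubling : M -> M) @^-1` `]-oo, b]%classic) by
      exact: mpred.
  pose m1 : {measure set M -> \bar R} := image_measure (mrestr P mb) mev.
  have fP : P `]-oo, b]%classic \is a fin_num by exact: fin_num_measure.
  pose m2 : {measure set M -> \bar R} := mscale (NngNum (fine_ge0 (measure_ge0 P `]-oo,
      b]%classic))) P.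
  have := @measure_eq_cdf R m1 m2; rewrite /m1 /m2 /= /pushforward /mscale/= /mrestr => -> //.
  - by rewrite fineK// muleC.
  - rewrite preimage_setT setTI; apply: (le_lt_trans (probability_le1 _ _)) => //.
    exact: ltry.
  - by move=> a; rewrite fineK// muleC -unifP_evenbits_le; congr (P _).
pose m1 : {measure set M -> \bar R} := image_measure (mrestr P (mpre _ mA)) mevd.
have fP : P A \is a fin_num by exact: fin_num_measure.
pose m2 : {measure set M -> \bar R} := mscale (NngNum (fine_ge0 (measure_ge0 P A))) P.
have := @measure_eq_cdf R m1 m2; rewrite /m1 /m2 /= /pushforward /mscale/= /mrestr => H.
have <- : P ((evenbits \o doubling : M -> M) @^-1` B `&` (evenbits : M -> M) @^-1` A) =
    P ((fun x : M => (evenbits x : M, evenbits (doubling x) : M)) @^-1` (A `*` B)).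
  by congr (P _); apply/seteqP; split => x /= [].
apply: (etrans (H _ _ _ mB)); last by rewrite fineK.
- rewrite preimage_setT setTI; apply: (le_lt_trans (probability_le1 _ _)); last exact: ltry.
  exact: (mpre A mA).
- by move=> a; rewrite setIC step1// fineK.
Qed.
End pair_law.

(** * The quantile transform *)

Section quantile.
Context {R : realType} (Q : probability (measurableTypeR R) R).
Notation M := (measurableTypeR R).
(** The generalized inverse of the distribution function of Q. Off ]0, 1[ the
set may be empty or unbounded, and the value 0 there only matters on a null
set. *)
Definition quantile (u : M) : M :=
  if 0 < u < 1 then sup [set x : R | (Q `]-oo, x]%classic < u%:E)%E] else 0.

Let mono (x y : R) : x <= y -> (Q `]-oo, x]%classic <= Q `]-oo, y]%classic)%E.
Proof.
move=> xy; apply: le_measure; rewrite ?inE//.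
by move=> z /=; rewrite !in_itv/= => /le_trans; apply.
Qed.

Let idR : M -> R := idfun.
#[local] HB.instance Definition _ :=
  @isMeasurableFun.Build _ _ _ _ idR (@measurable_id _ _ setT).
Let cdfE x : cdf (idR : {RV Q >-> R}) x = Q `]-oo, x]%classic.
Proof. by []. Qed.

Let Qfin x : Q `]-oo, x]%classic = (fine (Q `]-oo, x]%classic))%:E.
Proof. by rewrite fineK ?fin_num_measure. Qed.

(** The Galois connection between a distribution function and its quantile
function. The right-continuity of the former makes the inequality on the
right non-strict. *)
Lemma quantile_le (u x : R) : 0 < u < 1 ->
  (quantile u <= x) = (u%:E <= Q `]-oo, x]%classic)%E.
Proof.
move=> u01; rewrite /quantile u01; have /andP[u0 u1] := u01.
set S := [set x | _].
have SS y z : S y -> (u%:E <= Q `]-oo, z]%classic)%E -> y <= z.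
  rewrite /S /= => Sy uz; rewrite leNgt; apply/negP => zy.
  by have := le_lt_trans (mono (ltW zy)) (lt_le_trans Sy uz); rewrite ltxx.
have nS : S !=set0.
  have c : cdf (idR : {RV Q >-> R}) y @[y --> -oo] --> 0%E by exact: cvg_cdfNy0.
  have : \forall y \near -oo, (cdf (idR : {RV Q >-> R}) y < u%:E)%E.
    exact: (c [set y | (y < u%:E)%E] (@nbhs_open_ereal_lt R 0 (fun=> u) u0)).
  move=> [r [_ h]]; exists (r - 1); rewrite /S/= -cdfE; apply: h.
  by rewrite gtrBl.
have [z uz] : exists z, (u%:E <= Q `]-oo, z]%classic)%E.
  have c : cdf (idR : {RV Q >-> R}) y @[y --> +oo] --> 1%E by exact: cvg_cdfy1.
  have : \forall y \near +oo, (u%:E < cdf (idR : {RV Q >-> R}) y)%E.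
    exact: (c [set y | (u%:E < y)%E] (@nbhs_open_ereal_gt R 1 (fun=> u) u1)).
  move=> [r [_ h]]; exists (r + 1); rewrite -cdfE ltW//; apply: h.
  by rewrite ltrDl.
have hS : has_sup S by split => //; exists z => y Sy; exact: SS uz.
apply/idP/idP => [supx|ux]; last first.
  by apply: ge_sup => // y Sy; exact: SS ux.
rewrite leNgt; apply/negP => Qx.
have c := @cdf_right_continuous _ _ _ Q (idR : {RV Q >-> R}) x.
have : \forall y \near x^'+, (cdf (idR : {RV Q >-> R}) y < u%:E)%E.
  apply: (c [set y | (y < u%:E)%E]); rewrite cdfE Qfin.
  by apply: (@nbhs_open_ereal_lt R _ (fun=> u)); rewrite -lte_fin -Qfin.
move=> [e /= e0 h].
have : S (x + e / 2).
  rewrite /S /= -cdfE; apply: h => /=; last by rewrite ltrDl divr_gt0.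
  by rewrite opprD addNKr normrN ger0_norm ?divr_ge0 ?ltW// ltr_pdivrMr// ltr_pMr// ltr1n.
move=> /(ub_le_sup hS.2) /le_trans /(_ supx).
by rewrite gerDl leNgt divr_gt0.
Qed.

Lemma measurable_quantile : measurable_fun setT quantile.
Proof.
apply: (measurability (@rays R)); first exact: measurable_rays.
move=> _ [_ [x ->] <-]; rewrite setTI.
rewrite (_ : _ @^-1` _ = (`]0, 1[%classic `&` `]-oo, fine (Q `]-oo, x]%classic)]%classic) `|`
  (if 0 <= x then ~` `]0, 1[%classic else set0)).
  apply: measurableU; first exact: measurableI.
  by case: ifP => // _; exact: measurableC.
apply/seteqP; split => u /=; rewrite !in_itv/=.
  have [u01|u01] := boolP (0 < u < 1).
    by rewrite quantile_le// Qfin lee_fin => h; left.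
  rewrite /quantile (negbTE u01) => ->; right => /=; rewrite in_itv/=; exact/negP.
move=> [[u01]|]; first by rewrite quantile_le// Qfin lee_fin.
case: ifP => // x0 /=; rewrite in_itv/= => /negP/negbTE u01.
by rewrite /quantile u01.
Qed.

Lemma quantile_law (A : set M) : measurable A -> unifP (quantile @^-1` A) = Q A.
Proof.
move=> mA.
rewrite -[LHS]/(image_measure unifP measurable_quantile A).
apply: measure_eq_cdf => // [|x].
  by rewrite /= /pushforward preimage_setT probability_setT ltry.
rewrite /= /pushforward -[LHS]/(unifP _) unifPE;
    last exact: measurable_preimage measurable_quantile _.
have mS : measurable (quantile @^-1` `]-oo, x]%classic `&` `[0, 1]%classic).
  by apply: measurableI => //; exact: measurable_preimage measurable_quantile _.
set q := fine (Q `]-oo, x]%classic).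
have q0 : 0 <= q by exact: fine_ge0.
have q1 : q <= 1 by rewrite -lee_fin -Qfin probability_le1.
rewrite Qfin -/q; apply/eqP; rewrite eq_le; apply/andP; split.
  apply: (@le_trans _ _ (lebesgue_measure (`[0, q]%classic `|` [set (1:R)] : set M))).
    apply: le_measure; rewrite ?inE//; first exact: measurableU.
    move=> u [/=]; rewrite !in_itv/= => ux /andP[]; rewrite le_eqVlt => /orP[/eqP <- _|u0].
      by left; rewrite eqxx q0.
    rewrite le_eqVlt => /orP[/eqP ->|u1]; [by right|left].
    rewrite u0 orbT/=; move: ux; rewrite quantile_le ?u0//.
    by rewrite Qfin lee_fin.
  apply: le_trans (measureU2 _ _ _) _ => //.
  rewrite [X in (_ + X)%E](_ : _ = 0%E) ?adde0; last exact: lebesgue_measure_set1.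
  rewrite [leLHS]lebesgue_measure_itv/= lte_fin sube0.
  by case: ifPn => // ?; rewrite lee_fin.
apply: (@le_trans _ _ (lebesgue_measure (`]0, q[%classic : set M))).
  rewrite lebesgue_measure_itv/= lte_fin sube0; case: ifPn => //; rewrite -leNgt => ?;
      by rewrite lee_fin.
apply: le_measure; rewrite ?inE// => u /=; rewrite !in_itv/= => /andP[u0 uq].
have u1 : u < 1 by exact: lt_le_trans uq q1.
by rewrite quantile_le ?u0// Qfin lee_fin (ltW uq) (ltW u0) (ltW u1).
Qed.
End quantile.

(** * The standard normal law *)

Section density.
Local Open Scope ereal_scope.
Context d (T : measurableType d) (R : realType).
Variables (mu nu : {measure set T -> \bar R}) (p : T -> R).
Hypotheses (mp : measurable_fun setT p) (p0 : forall x, (0 <= p x)%R).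
Hypothesis nuE : forall A, measurable A -> nu A = \int[mu]_(x in A) (p x)%:E.

Import HBNNSimple.

Let mp' : measurable_fun setT (EFin \o p).
Proof. exact/measurable_EFinP. Qed.

Let density_nnsfun (f : {nnsfun T >-> R}) :
  \int[nu]_x (f x)%:E = \int[mu]_x ((f x)%:E * (p x)%:E).
Proof.
have mi (r : R) : measurable_fun setT (fun x => (\1_(f @^-1` [set r]) x : R)%:E).
  by apply/measurable_EFinP; exact: measurable_indic.
under [LHS]eq_integral do rewrite fimfunE -fsumEFin//.
rewrite [LHS]ge0_integral_fsum//; last 2 first.
  - by move=> r; exact/measurable_EFinP/measurableT_comp.
  - by move=> n x _; rewrite EFinM nnfun_muleindic_ge0.
under [RHS]eq_integral.
  move=> x xD; rewrite fimfunE -fsumEFin// muleC ge0_mule_fsumr; last first.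
    by move=> r; rewrite EFinM nnfun_muleindic_ge0.
  over.
rewrite [RHS]ge0_integral_fsum//; last 2 first.
  - move=> r; apply: emeasurable_funM => //.
    by apply/measurable_EFinP; exact: measurableT_comp.
  - move=> n x _; rewrite EFinM mule_ge0// ?lee_fin//.
    by rewrite -lee_fin EFinM nnfun_muleindic_ge0.
apply: eq_fsbigr => r; rewrite inE => -[t _ ftr].
have r0 : (0 <= r)%R by rewrite -ftr.
under [RHS]eq_integral do rewrite EFinM muleCA.
under [LHS]eq_integral do rewrite EFinM.
rewrite ge0_integralZl//.
rewrite [RHS]ge0_integralZl//; last 2 first.
  - by apply: emeasurable_funM.
  - by move=> x _; rewrite mule_ge0 ?lee_fin.
rewrite integral_indic// setIT nuE//; congr (_ * _).
rewrite integral_mkcond; apply: eq_integral => x _.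
rewrite patchE indicE; case: (x \in _); by rewrite ?mule1 ?mule0.
Qed.

Lemma ge0_integral_density (f : T -> \bar R) :
  measurable_fun setT f -> (forall x, 0 <= f x) ->
  \int[nu]_x f x = \int[mu]_x (f x * (p x)%:E).
Proof.
move=> mf f0.
pose f_ := nnsfun_approx measurableT mf.
transitivity (lim (\int[nu]_x (f_ n x)%:E @[n --> \oo])).
  rewrite -monotone_convergence//=.
  - apply: eq_integral => ? /[!inE] xD; apply/esym/cvg_lim => //=.
    exact: cvg_nnsfun_approx.
  - by move=> n; exact/measurable_EFinP/measurable_funTS.
  - by move=> n ? _; rewrite lee_fin.
  - by move=> ? _ ? ? mn; rewrite lee_fin; exact/lefP/nd_nnsfun_approx.
rewrite (_ : \int[mu]_x _ = lim (\int[mu]_x ((f_ n x)%:E * (p x)%:E) @[n --> \oo])); last first.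
  rewrite -monotone_convergence//=.
  - apply: eq_integral => x /[!inE] xD; apply/esym/cvg_lim => //.
    apply: cvgeZr => //; exact: cvg_nnsfun_approx.
  - move=> n; apply: emeasurable_funM => //; exact/measurable_EFinP/measurable_funTS.
  - by move=> n ? _; rewrite mule_ge0 ?lee_fin.
  - move=> ? _ ? ? ?; rewrite lee_pmul ?lee_fin//; exact/lefP/nd_nnsfun_approx.
by apply: congr_lim; apply/funext => n /=; exact: density_nnsfun.
Qed.
End density.

Section normal_facts.
Context {R : realType}.
Notation M := (measurableTypeR R).
Notation leb := (@lebesgue_measure R).
Definition stdnormal : probability M R := normal_prob 0 1.

Lemma ge0_integral_normal (m s : R) (f : M -> \bar R) :
  measurable_fun setT f -> (forall x, (0 <= f x)%E) ->
  (\int[normal_prob m s]_x f x = \int[leb]_x (f x * (normal_pdf m s x)%:E))%E.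
Proof.
move=> mf f0; apply: ge0_integral_density => //.
- exact: measurable_normal_pdf.
- by move=> x; exact: normal_pdf_ge0.
Qed.

Lemma normal_pdf_affine (m b z : R) : b != 0 ->
  `|b| * normal_pdf m `|b| (b * z + m) = normal_pdf 0 1 z.
Proof.
move=> b0; have nb0 : `|b| != 0 by rewrite normr_eq0.
rewrite !normal_pdfE ?oner_eq0// /normal_peak /normal_fun.
rewrite subr0 expr1n mul1r addrK.
have bb : `|b| ^+ 2 = b ^+ 2 by rewrite real_normK// num_real.
rewrite mulrA; congr (_ * expR _).
  by rewrite -mulrnAr sqrtrM ?sqr_ge0// sqrtr_sqr normr_id invfM mulrA divff// mul1r.
by rewrite bb exprMn; field.
Qed.

Lemma lebesgue_affineN (c d : R) (A : set M) : c != 0 -> measurable A ->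
  (`|c|%:E * leb (affine c d @^-1` A))%E = leb A.
Proof.
move=> c0 mA; have [cn|cp|ce] := ltgtP c 0; last by rewrite ce eqxx in c0.
  rewrite ltr0_norm//.
  have mB : measurable ((affine (- c) d) @^-1` A).
    by apply: measurable_preimage => //; exact: measurable_affine.
  rewrite -(@lebesgue_affine R (- c) d A) ?oppr_gt0// -(lebesgue_measureN mB).
  congr (_ * leb _)%E; apply/seteqP; split => x; rewrite /= /affine; by rewrite mulrNN.
by rewrite gtr0_norm// lebesgue_affine.
Qed.

(** Change of variables in the density; the absolute value allows b < 0. *)
Lemma normal_prob_affine (m b : R) (E : set M) : b != 0 -> measurable E ->
  stdnormal [set z | E (b * z + m)] = normal_prob m `|b| E.
Proof.
move=> b0 mE; rewrite /stdnormal /= /normal_prob.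
have ma := measurable_affine b m.
transitivity (\int[leb]_(z in affine b m @^-1` E)
    (`|b|%:E * ((fun y => (normal_pdf m `|b| y)%:E) \o affine b m) z))%E.
  apply: eq_integral => z _; rewrite /= -EFinM /affine normal_pdf_affine//.
have mpdf : measurable_fun setT (fun y => (normal_pdf m `|b| y)%:E).
  by apply/measurable_EFinP; exact: measurable_normal_pdf.
rewrite ge0_integralZl//; last 3 first.
- exact: measurable_preimage.
- by apply: measurable_funTS; apply: measurableT_comp.
- by move=> x _; rewrite lee_fin normal_pdf_ge0.
rewrite -(@ge0_integral_pushforward _ _ M M R (affine b m) ma leb E (fun y => (normal_pdf m
    `|b| y)%:E))//; last 2 first.
- exact: measurable_funTS.
- by move=> x _; rewrite lee_fin normal_pdf_ge0.
rewrite -[LHS](@ge0_integral_mscale _ M R (image_measure leb ma) E mE (NngNum (normr_ge0 b))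
    (fun y => (normal_pdf m `|b| y)%:E))//; last 2 first.
- exact: measurable_funTS.
- by move=> x _; rewrite lee_fin normal_pdf_ge0.
apply: eq_measure_integral => A mA _.
by rewrite /= /mscale /= /pushforward lebesgue_affineN.
Qed.

Lemma normal_prob_scale (b : R) (E : set M) : b != 0 -> measurable E ->
  stdnormal [set z | E (b * z)] = normal_prob 0 `|b| E.
Proof.
move=> b0 mE; rewrite -(normal_prob_affine _ b0 mE); congr (stdnormal _).
by apply/seteqP; split => z /=; rewrite addr0.
Qed.

(** With y = a w + b z, the left-hand side is the density of the pair (w, y)
for independent standard normal w and z. Completing the square in w writes it
as the density of y times the conditional density of w given y. *)
Lemma normal_pdf_rotation (a b w y : R) : b != 0 ->
  let c := Num.sqrt (a ^+ 2 + b ^+ 2) in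
  normal_pdf 0 1 w * normal_pdf (a * w) `|b| y =
  normal_pdf 0 c y * normal_pdf (a * y / c ^+ 2) (`|b| / c) w.
Proof.
move=> b0 c; have nb0 : `|b| != 0 by rewrite normr_eq0.
have b20 : 0 < b ^+ 2 by rewrite exprn_even_gt0.
have c2 : c ^+ 2 = a ^+ 2 + b ^+ 2 by rewrite sqr_sqrtr// addr_ge0 ?sqr_ge0.
have c20 : 0 < c ^+ 2 by rewrite c2 ltr_wpDl ?sqr_ge0.
have c0 : 0 < c by rewrite sqrtr_gt0 -c2.
rewrite !normal_pdfE ?oner_eq0 ?(gt_eqF c0)//; last first.
  by rewrite mulf_neq0// invr_neq0// gt_eqF.
rewrite mulrACA [RHS]mulrACA; congr (_ * _).
  rewrite /normal_peak -!invfM; congr (_^-1).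
  have pos (x : R) : 0 <= x ^+ 2 * pi *+ 2 by rewrite mulrn_wge0// mulr_ge0 ?sqr_ge0 ?pi_ge0.
  rewrite -sqrtrM// -[RHS]sqrtrM//; congr (_ _).
  rewrite expr1n exprMn exprVn; field; by rewrite gt_eqF.
rewrite /normal_fun -!expRD; congr expR.
have bb : `|b| ^+ 2 = b ^+ 2 by rewrite real_normK// num_real.
rewrite exprMn exprVn bb c2 expr1n.
field; rewrite b0 ?oner_eq0 -c2 expf_eq0 gt_eqF//=.
Qed.

(** The stability of the normal law: a w + b z is normal when w and z are
independent and standard normal. Tonelli's theorem integrates out w in the
factorization of [normal_pdf_rotation]. *)
Lemma stdnormal_rotation (a b : R) (E : set M) : measurable E ->
  (\int[stdnormal]_w stdnormal [set z | E (a * w + b * z)%R] =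
   stdnormal [set z | E (Num.sqrt (a ^+ 2 + b ^+ 2) * z)%R])%E.
Proof.
move=> mE.
have mp m s : measurable_fun setT (fun y => (normal_pdf m s y)%:E : \bar R).
  by apply/measurable_EFinP; exact: measurable_normal_pdf.
(* for b = 0 the law of b z has no density *)
have [b0|b0] := eqVneq b 0.
  transitivity (stdnormal [set w | E (a * w)]).
    have mE' : measurable [set w : M | E (a * w)].
      have := measurable_preimage (measurable_affine a 0) mE.
      by congr measurable; apply/seteqP; split => w; rewrite /= /affine addr0.
    rewrite -[in RHS](setIT [set w | _]) -integral_indic//.
    apply: eq_integral => w _; rewrite b0 indicE.
    under eq_set do rewrite mul0r addr0.
    have [aw|aw] := boolP (w \in [set w : M | E (a * w)]).
      rewrite inE/= in aw; rewrite (_ : [set _ | _] = setT) ?probability_setT//.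
      by apply/seteqP; split.
    rewrite notin_setE/= in aw; rewrite (_ : [set _ | _] = set0) ?measure0//.
    by apply/seteqP; split.
  rewrite b0 expr0n/= addr0 sqrtr_sqr.
  have [->|a0] := eqVneq a 0; first by rewrite normr0.
  have na0 : `|a| != 0 by rewrite normr_eq0.
  by rewrite (normal_prob_scale a0 mE) (normal_prob_scale na0 mE) normr_id.
pose c := Num.sqrt (a ^+ 2 + b ^+ 2).
have c0 : c != 0.
  by rewrite gt_eqF// sqrtr_gt0 ltr_wpDl ?sqr_ge0// exprn_even_gt0.
rewrite (normal_prob_scale c0 mE) (ger0_norm (sqrtr_ge0 _)) /normal_prob -/c.
pose h (w y : M) : \bar R := ((normal_pdf 0 1 w)%:E * (normal_pdf (a * w) `|b| y)%:E)%E.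
pose g (p : M * M) : \bar R := if p.2 \in E then h p.1 p.2 else 0%E.
have mh : measurable_fun setT (fun p : M * M => h p.1 p.2).
  apply: (@eq_measurable_fun _ _ _ _ _ (fun p : M * M =>
    ((normal_pdf 0 1 p.1 * (`|b|^-1 * normal_pdf 0 1 ((p.2 - a * p.1) / b))))%:E)).
    move=> p _; rewrite /h -EFinM -(normal_pdf_affine (a * p.1) ((p.2 - a * p.1) / b) b0).
    by rewrite mulKf ?normr_eq0// (mulrC b) divfK// subrK.
  apply/measurable_EFinP; apply: measurable_funM.
    exact: (measurableT_comp (measurable_normal_pdf 0 1) measurable_fst).
  apply: measurable_funM => //.
  apply: (measurableT_comp (measurable_normal_pdf 0 1)).
  apply: measurable_funM => //; apply: measurable_funB => //.
  by apply: measurable_funM.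
have h0 w y : (0 <= h w y)%E by rewrite mule_ge0 ?lee_fin ?normal_pdf_ge0.
have mg : measurable_fun setT g.
  apply: measurable_fun_ifT => //.
  apply: (measurable_fun_bool true).
  rewrite setTI (_ : _ @^-1` _ = snd @^-1` E).
    by apply: measurable_preimage => //; exact: measurable_snd.
  by apply/seteqP; split => p /= => [/set_mem|/mem_set].
have g0 p : (0 <= g p)%E by rewrite /g; case: ifP.
transitivity (\int[leb]_w \int[leb]_y g (w, y))%E.
  rewrite ge0_integral_normal//; last first.
    have mX : measurable ((fun p : M * M => a * p.1 + b * p.2 : M) @^-1` E).
      apply: measurable_preimage => //; apply: measurable_funD => //; exact: measurable_funM.
    have := measurable_fun_xsection stdnormal mX; congr measurable_fun.
    by apply/funext => w /=; rewrite xsectionE.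
  apply: eq_integral => w _.
  under eq_set do rewrite addrC.
  rewrite normal_prob_affine// /normal_prob muleC -ge0_integralZl//.
    rewrite integral_mkcond; apply: eq_integral => y _.
    by rewrite patchE.
  - have mpw := mp (a * w) `|b|; exact: measurable_funTS.
  - by move=> y _; rewrite lee_fin normal_pdf_ge0.
  - by rewrite lee_fin normal_pdf_ge0.
rewrite (fubini_tonelli (fun p => g p))//.
rewrite [RHS]integral_mkcond; apply: eq_integral => y _; rewrite patchE.
rewrite /g /=; case: ifPn => yE; last by rewrite integral0.
under eq_integral do rewrite /h -EFinM normal_pdf_rotation// -/c EFinM.
rewrite ge0_integralZl ?integral_normal_pdf ?mule1//.
- exact: mp.
- by move=> x _; rewrite lee_fin normal_pdf_ge0.
- by rewrite lee_fin normal_pdf_ge0.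
Qed.
End normal_facts.

(** * A sequence of independent standard normal variables *)

Section gaussian_sequence.
Context {R : realType}.
Notation M := (measurableTypeR R).

(** X has the law of s times a standard normal variable. In contrast to
[normal_prob 0 s], this covers the degenerate case s = 0, which makes the
class stable under linear combinations and limits. *)
Definition centered_normal d (T : measurableType d) (P : probability T R)
    (X : T -> R) (s : R) :=
  measurable_fun setT X /\ forall A : set M, measurable A ->
    P ((X : T -> M) @^-1` A) = stdnormal [set z | A (s * z)].

Definition oddbits : M -> M := evenbits \o doubling.
(** The even digits of the successive odd halves are independent uniform
numbers; the quantile function makes them normal. *)
Definition gaussian_seq (k : nat) : M -> R :=
  quantile stdnormal \o evenbits \o iter k oddbits.

Let mev : measurable_fun setT (evenbits : M -> M).
Proof. exact: measurable_evenbits. Qed.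

Lemma measurable_oddbits : measurable_fun setT oddbits.
Proof. exact: measurableT_comp measurable_evenbits measurable_doubling. Qed.

Lemma measurable_gaussian_seq k : measurable_fun setT (gaussian_seq k).
Proof.
have mi : measurable_fun setT (iter k oddbits).
  elim: k => [|k IH]; first exact: measurable_id.
  exact: (measurableT_comp measurable_oddbits IH).
exact: (measurableT_comp (measurableT_comp (measurable_quantile stdnormal) mev) mi).
Qed.

Lemma gaussian_seqS k x : gaussian_seq k.+1 x = gaussian_seq k (oddbits x).
Proof. by rewrite /gaussian_seq /= -iterSr. Qed.

(** The joint normality of the sequence, with independence encoded in the
variance. Induction on n: the variable of index 0 depends on the even digits
only, and the others are the same sequence evaluated at the odd digits, so
that [evenbits_pair] and [stdnormal_rotation] apply. *)
Lemma gaussian_seq_sum n (c : nat -> R) :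
  centered_normal unifP (fun x => \sum_(k < n) c k * gaussian_seq k x)
    (Num.sqrt (\sum_(k < n) c k ^+ 2)).
Proof.
have msum m (e : nat -> R) : measurable_fun setT (fun x => \sum_(k < m) e k * gaussian_seq k x).
  apply: measurable_sum => k; apply: measurable_funM => //.
  exact: measurable_gaussian_seq.
split; first exact: msum.
elim: n c => [|n IH] c A mA.
  rewrite big_ord0 sqrtr0.
  have [A0|A0] := pselect (A 0).
    rewrite (_ : _ @^-1` _ = setT); last first.
      by apply/seteqP; split => // x _ /=; rewrite big_ord0.
    rewrite (_ : [set _ | _] = setT) ?probability_setT//.
    by apply/seteqP; split => // x _ /=; rewrite mul0r.
  rewrite (_ : _ @^-1` _ = set0); last first.
    by apply/seteqP; split => // x /=; rewrite big_ord0.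
  rewrite (_ : [set _ | _] = set0) ?measure0//.
  by apply/seteqP; split => // x /=; rewrite mul0r.
pose S y := \sum_(k < n) c k.+1 * gaussian_seq k y.
have mS : measurable_fun setT (S : M -> M) by exact: (msum n (fun k => c k.+1)).
have sumS x : \sum_(k < n.+1) c k * gaussian_seq k x =
    c 0%N * quantile stdnormal (evenbits x) + S (oddbits x).
  rewrite big_ord_recl; congr (_ + _).
  by apply: eq_bigr => k _; rewrite -gaussian_seqS.
pose f (p : M * M) : M := c 0%N * quantile stdnormal p.1 + S p.2.
have mf : measurable_fun setT f.
  apply: measurable_funD.
    apply: measurable_funM => //.
    exact: (measurableT_comp (measurable_quantile stdnormal) measurable_fst).
  exact: (measurableT_comp mS measurable_snd).
have mE : measurable (f @^-1` A) by exact: measurable_preimage.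
have := evenbits_pair mE.
rewrite (_ : [set x | _] = (fun x => \sum_(k < n.+1) c k * gaussian_seq k x) @^-1` A);
    last first.
  apply/seteqP; split => x /=; by rewrite sumS.
move=> ->.
pose h (w : M) := stdnormal [set z | A (c 0%N * w + Num.sqrt (\sum_(k < n) c k.+1 ^+ 2) * z)].
have mh : measurable_fun setT h.
  have mX : measurable ((fun p : M * M => c 0%N * p.1 + Num.sqrt (\sum_(k < n) c k.+1 ^+ 2) *
      p.2 : M) @^-1` A).
    apply: measurable_preimage => //; apply: measurable_funD => //; exact: measurable_funM.
  have := measurable_fun_xsection stdnormal mX; congr measurable_fun.
  by apply/funext => w /=; rewrite xsectionE.
transitivity (\int[unifP]_u h (quantile stdnormal u))%E.
  rewrite /product_measure1; apply: eq_integral => u _; rewrite /= xsectionE /h.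
  have mA' : measurable [set s : M | A (c 0%N * quantile stdnormal u + s)].
    have := measurable_preimage (measurable_affine 1 (c 0%N * quantile stdnormal u)) mA.
    by congr measurable; apply/seteqP; split => v; rewrite /= /affine mul1r addrC.
  exact: (IH (fun k => c k.+1) _ mA').
have mq := measurable_quantile (@stdnormal R).
transitivity (\int[image_measure unifP mq]_w h w)%E.
  by rewrite [RHS]ge0_integral_pushforward.
transitivity (\int[stdnormal]_w h w)%E.
  by apply: eq_measure_integral => B mB _; exact: quantile_law.
rewrite /h stdnormal_rotation//; congr (stdnormal _).
rewrite sqr_sqrtr ?sumr_ge0//; last by move=> k _; exact: sqr_ge0.
by rewrite big_ord_recl.
Qed.
End gaussian_sequence.

(** * Moments and limits of centred normal variables *)

Section normal_moments.
Context {R : realType}.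
Notation M := (measurableTypeR R).
Notation leb := (@lebesgue_measure R).
Notation phi := (@normal_pdf R 0 1).

Let phiE (z : R) : phi z = normal_peak 1 * expR (- z ^+ 2 / 2).
Proof. by rewrite normal_pdfE ?oner_eq0// /normal_fun subr0 expr1n. Qed.

Let phi_derive (z : R) : is_derive z 1 (fun z => - phi z) (z * phi z).
Proof.
have -> : (fun z => - phi z) = (fun z => - normal_peak 1 * expR (- z ^+ 2 / 2)).
  by apply/funext => y; rewrite phiE [RHS]mulNr.
apply: is_derive_eq; rewrite phiE.
by rewrite /GRing.scale/=; set e := expR _; field.
Qed.

Let phi_cvg : phi z @[z --> +oo%R] --> (0:R).
Proof.
rewrite (_ : phi = fun z => normal_peak 1 * gauss_fun (z / Num.sqrt 2)).
  rewrite -[X in _ --> X](mulr0 (normal_peak 1)); apply: cvgM; first exact: cvg_cst.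
  apply: (cvg_comp _ _ _ (@cvg_gauss_fun R)).
  by apply: gt0_cvgMly; rewrite ?invr_gt0 ?sqrtr_gt0//; exact: cvg_id.
apply/funext => z; rewrite phiE /gauss_fun; congr (_ * expR _).
by rewrite exprMn exprVn sqr_sqrtr// mulNr.
Qed.
Let cphi : continuous phi.
Proof. by apply: continuous_normal_pdf; rewrite oner_eq0. Qed.

Let tail (t : R) : 0 <= t ->
  (\int[leb]_(z in `[t, +oo[) (z * phi z)%:E)%E = (phi t)%:E.
Proof.
move=> t0; rewrite (@ge0_continuous_FTC2y R (fun z => z * phi z) (fun z => - phi z) t 0).
- by rewrite sub0e -EFinN opprK.
- by move=> x tx; rewrite mulr_ge0 ?normal_pdf_ge0// (le_trans t0).
- by apply: continuous_subspaceT => x; apply: cvgM; [exact: cvg_id|exact: cphi].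
- by have := cvgN phi_cvg; rewrite oppr0; apply.
- by move=> x _; have [] := phi_derive x.
- by apply: cvg_at_right_filter; apply: cvgN; exact: cphi.
- by move=> x _; rewrite derive1E; have [] := phi_derive x.
Qed.

Let mphi : measurable_fun setT phi.
Proof. exact: measurable_normal_pdf. Qed.

(** Integration by parts in the form of Tonelli's theorem: z^2 phi(z) is the
integral over 0 <= u <= z of z phi(z), and the integral of z phi(z) over
[u, +oo[ is phi(u). *)
Lemma second_moment_normal_pdf : (\int[leb]_z (z ^+ 2 * phi z)%:E = 1)%E.
Proof.
have even_phi x : phi (- x) = phi x by rewrite !phiE sqrrN.
have C : continuous (fun z : R => z ^+ 2 * phi z).
  by move=> x; apply: cvgM; [exact: exprn_continuous|exact: cphi].
rewrite ge0_symfun_integralT//; last 2 first.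
- by move=> x; rewrite mulr_ge0 ?sqr_ge0 ?normal_pdf_ge0.
- by move=> x; rewrite /= sqrrN even_phi.
have := integral_normal_pdf (0:R) 1.
rewrite ge0_symfun_integralT//; last 2 first.
- by move=> x; rewrite normal_pdf_ge0.
- by move=> x; rewrite /= even_phi.
move=> <-; congr (2%:E * _)%E.
pose k (p : M * M) : \bar R := if 0 <= p.2 <= p.1 then (p.1 * phi p.1)%:E else 0%E.
have mk : measurable_fun setT k.
  apply: measurable_fun_ifT => //.
    apply: measurable_and.
      by apply: measurable_fun_ler.
    by apply: measurable_fun_ler.
  apply/measurable_EFinP; apply: measurable_funM => //.
  exact: (measurableT_comp mphi measurable_fst).
have k0 p : (0 <= k p)%E.
  rewrite /k; case: ifP => // /andP[p0 p1].
  by rewrite lee_fin mulr_ge0 ?normal_pdf_ge0// (le_trans p0).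
transitivity (\int[leb]_z \int[leb]_t k (z, t))%E.
  rewrite integral_mkcond; apply: eq_integral => z _; rewrite patchE.
  case: ifPn => z0; last first.
    rewrite integral0_eq// => t _; rewrite /k/=; case: ifP => // /andP[t0 tz].
    by move: z0; rewrite notin_setE/= => /negP; rewrite -ltNge ltNge (le_trans t0 tz).
  rewrite inE/= in z0.
  transitivity (\int[leb]_(t in `[0%R, z]) (z * phi z)%:E)%E.
    rewrite integral_cst//= lebesgue_measure_itv/= lte_fin sube0.
    move: z0; rewrite le_eqVlt => /orP[/eqP <-|->]; first by rewrite ltxx mule0 expr0n mul0r.
    by rewrite -EFinM; congr EFin; ring.
  rewrite integral_mkcond; apply: eq_integral => t _; rewrite patchE /k/=.
  by rewrite mem_setE in_itv.
rewrite (fubini_tonelli k)//.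
rewrite [RHS]integral_mkcond; apply: eq_integral => t _; rewrite patchE.
case: ifPn => t0; last first.
  rewrite integral0_eq// => z _; rewrite /k/=; case: ifP => // /andP[t0' _].
  by move: t0; rewrite notin_setE/= t0'.
rewrite inE/= in t0.
rewrite -tail// [RHS]integral_mkcond; apply: eq_integral => z _; rewrite patchE /k/=.
by rewrite mem_setE in_itv/= andbT t0.
Qed.

Lemma stdnormal_sqr : (\int[@stdnormal R]_z (z ^+ 2)%:E = 1)%E.
Proof.
rewrite ge0_integral_normal//.
- by under eq_integral do rewrite -EFinM; exact: second_moment_normal_pdf.
- by apply/measurable_EFinP; exact: measurable_funX.
- by move=> x; rewrite lee_fin sqr_ge0.
Qed.
End normal_moments.

Section centered_normal_moments.
Context {R : realType} d (T : measurableType d) (P : probability T R).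
Notation M := (measurableTypeR R).

Lemma centered_normal_sqr (X : T -> R) (s : R) : centered_normal P X s ->
  (\int[P]_x (X x ^+ 2)%:E = (s ^+ 2)%:E)%E.
Proof.
move=> [mX lX].
have msq : measurable_fun setT (fun y : M => (y ^+ 2)%:E : \bar R).
  by apply/measurable_EFinP; exact: measurable_funX.
have sq0 : {in [set: M], forall y : M, (0 <= (y ^+ 2)%:E :> \bar R)%E}.
  by move=> y _; rewrite lee_fin sqr_ge0.
have ms : measurable_fun setT (fun z : M => s * z : M) by exact: measurable_funM.
transitivity (\int[image_measure P (mX : measurable_fun setT (X : T -> M))]_y (y ^+ 2)%:E)%E.
  by rewrite [RHS]ge0_integral_pushforward.
transitivity (\int[image_measure stdnormal ms]_y (y ^+ 2)%:E)%E.
  by apply: eq_measure_integral => B mB _; exact: lX.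
rewrite [LHS]ge0_integral_pushforward//=.
under eq_integral do rewrite exprMn EFinM.
rewrite preimage_setT ge0_integralZl// ?stdnormal_sqr ?mule1//.
- by move=> y _; rewrite lee_fin sqr_ge0.
- by rewrite lee_fin sqr_ge0.
Qed.

Lemma centered_normal_integrable (X : T -> R) (s : R) : centered_normal P X s ->
  P.-integrable setT (fun x => (X x ^+ 2)%:E) /\ P.-integrable setT (EFin \o X).
Proof.
move=> cX; have [mX lX] := cX.
have i2 : P.-integrable setT (fun x => (X x ^+ 2)%:E).
  apply/integrableP; split; first by apply/measurable_EFinP; exact: measurable_funX.
  under eq_integral do rewrite gee0_abs ?lee_fin ?sqr_ge0//.
  by rewrite (centered_normal_sqr cX) ltry.
split => //.
have i1 : P.-integrable setT (cst 1%E) by exact: finite_measure_integrable_cst.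
apply: (le_integrable _ _ _ (integrableD measurableT i1 i2)) => //.
  exact/measurable_EFinP.
move=> x _; rewrite /= lee_fin [leRHS]ger0_norm ?addr_ge0 ?sqr_ge0//.
have := sqr_ge0 (`|X x| - 1); rewrite -(real_normK (num_real (X x))) ; nra.
Qed.

(** The law of X is symmetric. *)
Lemma centered_normal_mean (X : T -> R) (s : R) : centered_normal P X s ->
  (\int[P]_x (X x)%:E = 0)%E.
Proof.
move=> cX; have [mX lX] := cX.
have [_ iX] := centered_normal_integrable cX.
have mN : measurable_fun setT (fun y : M => - y : M) by exact: measurable_funN.
have mX' : measurable_fun setT (X : T -> M) by [].
have sym A : measurable A -> image_measure P mX' A = image_measure (image_measure P mX') mN A.
  move=> mA; rewrite /= /pushforward lX// lX//; last exact: measurable_preimage.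
  have [->|s0] := eqVneq s 0.
    by congr (stdnormal _); apply/seteqP; split => z /=; rewrite !mul0r oppr0.
  rewrite (normal_prob_scale s0 mA).
  have s0' : - s != 0 by rewrite oppr_eq0.
  rewrite -(normrN s) -(normal_prob_scale s0' mA); congr (stdnormal _).
  by apply/seteqP; split => z /=; rewrite mulNr.
have mid : measurable_fun setT (EFin : M -> \bar R).
  exact/measurable_EFinP.
have iid : (image_measure P mX').-integrable setT (EFin : M -> \bar R).
  exact: (integrable_pushforward mX').
have E1 : (\int[image_measure P mX']_y y%:E = \int[P]_x (X x)%:E)%E.
  by rewrite [LHS]integral_pushforward.
have : (\int[image_measure P mX']_y y%:E = - \int[image_measure P mX']_y y%:E)%E.
  transitivity (\int[image_measure (image_measure P mX') mN]_y y%:E)%E.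
    by apply: eq_measure_integral => A mA _; exact: sym.
  have iN : (image_measure P mX').-integrable setT ((EFin : M -> \bar R) \o (fun y : M => - y
      : M)).
    exact: integrableN iid.
  rewrite [LHS]integral_pushforward//= -mulN1e -integralZl//.
  by apply: eq_integral => y _; rewrite /= mulN1e.
rewrite E1 => h; have fX : (\int[P]_x (X x)%:E)%E \is a fin_num by exact: integrable_fin_num.
move: h; rewrite -(fineK fX) -EFinN => -[h]; congr EFin; lra.
Qed.
End centered_normal_moments.

Section limits.
Context {R : realType} d (T : measurableType d) (P : probability T R).
Notation M := (measurableTypeR R).

(** Distribution functions need not converge at their discontinuities, and the
limit law may be a point mass. The laws are therefore compared on the bounded
continuous functions h m, whose integrals pass to the limit by dominated
convergence, and which decrease to the indicator function of a ray. *)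
Lemma centered_normal_lim (X_ : nat -> T -> R) (X : T -> R) (s_ : nat -> R) (s : R) :
  (forall n, centered_normal P (X_ n) (s_ n)) -> s_ n @[n --> \oo] --> s ->
  measurable_fun setT X ->
  {ae P, forall x, X_ n x @[n --> \oo] --> X x} -> centered_normal P X s.
Proof.
move=> nX ss mX XX; split => // A mA.
have mscl (r : R) : measurable_fun setT (fun z : M => r * z : M).
  exact: measurable_funM.
rewrite -[LHS]/(image_measure P (mX : measurable_fun setT (X : T -> M)) A)
    -[RHS]/(image_measure stdnormal (mscl s) A).
apply: measure_eq_cdf => // [|a].
  by rewrite /= /pushforward preimage_setT probability_setT ltry.
rewrite /= /pushforward.
(* u is the positive part of x - a *)
pose u (x : R) := (x - a + `|x - a|) / 2.
pose h (m : nat) (x : R) : R := expR (- u x) ^+ m.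
have u0 x : 0 <= u x.
  by rewrite divr_ge0// -lerBlDl sub0r -normrN ler_norm.
have q01 x : 0 <= expR (- u x) <= 1.
  by rewrite expR_ge0 -expR0 ler_expR oppr_le0 u0.
have h01 m x : 0 <= h m x <= 1.
  by have /andP[q0 q1] := q01 x; rewrite /h exprn_ge0//= exprn_ile1.
have ch m : continuous (h m).
  move=> x; apply: (@continuous_comp _ _ _ (fun x => expR (- u x)) (fun q => q ^+ m));
      last exact: exprn_continuous.
  apply: (@continuous_comp _ _ _ (fun x => - u x) expR); last exact: continuous_expR.
  apply: cvgN; apply: cvgM; last exact: cvg_cst.
  have cB : (y - a) @[y --> x] --> x - a by apply: cvgB; [exact: cvg_id|exact: cvg_cst].
  by apply: cvgD => //; exact: cvg_norm.
have mh m : measurable_fun setT (h m) by exact: continuous_measurable_fun.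
have mhE m : measurable_fun setT (fun y : M => (h m y)%:E).
  by apply/measurable_EFinP; exact: mh.
have hE0 m : {in [set: M], forall y, (0 <= (h m y)%:E)%E}.
  by move=> y _; rewrite lee_fin; case/andP: (h01 m y).
have key m : (\int[P]_x (h m (X x))%:E = \int[stdnormal]_z (h m (s * z))%:E)%E.
  have L n : (\int[P]_x (h m (X_ n x))%:E = \int[stdnormal]_z (h m (s_ n * z))%:E)%E.
    have [mXn lXn] := nX n.
    transitivity (\int[image_measure P (mXn : measurable_fun setT (X_ n : T -> M))]_y (h m
        y)%:E)%E.
      by rewrite [RHS]ge0_integral_pushforward.
    transitivity (\int[image_measure stdnormal (mscl (s_ n))]_y (h m y)%:E)%E.
      by apply: eq_measure_integral => B mB _; exact: lXn.
    by rewrite [LHS]ge0_integral_pushforward.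
  have D d' (U : measurableType d') (Q : probability U R) (Y_ : nat -> U -> R) (Y : U -> R) :
      (forall n, measurable_fun setT (Y_ n)) -> measurable_fun setT Y ->
      {ae Q, forall x, Y_ n x @[n --> \oo] --> Y x} ->
      (\int[Q]_x (h m (Y_ n x))%:E @[n --> \oo] --> \int[Q]_x (h m (Y x))%:E)%E.
    move=> mYn mY YY.
    have [] := @dominated_convergence _ _ _ Q setT measurableT
      (fun n x => (h m (Y_ n x))%:E) (fun x => (h m (Y x))%:E) (cst 1%E).
    - by move=> n; apply/measurable_EFinP; exact: measurableT_comp.
    - by apply/measurable_EFinP; exact: measurableT_comp.
    - apply: filterS YY => x Yx _; apply: cvg_EFin; first exact: nearW.
      exact: (cvg_comp _ _ Yx (@ch m (Y x))).
    - exact: finite_measure_integrable_cst.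
    - apply: aeW => x n _; rewrite /= lee_fin ger0_norm; by case/andP: (h01 m (Y_ n x)).
    by move=> _ _.
  have := D _ _ P X_ X (fun n => (nX n).1) mX XX.
  under eq_fun do rewrite L.
  move=> /cvg_unique; apply => //.
  apply: (D _ _ stdnormal (fun n z => s_ n * z) (fun z => s * z)) => //.
  - by move=> n; exact: mscl.
  - exact: mscl.
  - by apply: aeW => z; apply: cvgM => //; exact: cvg_cst.
have lim d' (U : measurableType d') (Q : probability U R) (Y : U -> R) : measurable_fun setT Y
    ->
    (\int[Q]_x (h m (Y x))%:E @[m --> \oo] --> Q (Y @^-1` `]-oo, a]%classic))%E.
  move=> mY.
  have mA' : measurable (Y @^-1` `]-oo, a]%classic).
    exact: (measurable_preimage (mY : measurable_fun setT (Y : U -> M))).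
  rewrite -[Y @^-1` _]setIT -integral_indic//.
  have [] := @dominated_convergence _ _ _ Q setT measurableT
      (fun m x => (h m (Y x))%:E) (fun x => (\1_(Y @^-1` `]-oo, a]%classic) x)%:E) (cst 1%E).
  - by move=> n; apply/measurable_EFinP; exact: measurableT_comp.
  - by apply/measurable_EFinP; exact: measurable_indic.
  - apply: aeW => x _; apply: cvg_EFin; first exact: nearW.
    rewrite indicE; case: (boolP (x \in _)) => [/set_mem/=|/negP xA].
      rewrite in_itv/= => ya; have -> : (fine \o (fun n => (h n (Y x))%:E)) = cst 1;
          last exact: cvg_cst.
      apply/funext => m; rewrite /h /= /u ler0_norm ?subr_le0// subrr mul0r oppr0 expR0.
      exact: expr1n.
    have ya : a < Y x by rewrite ltNge; apply/negP => h'; apply: xA; apply/mem_set;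
        rewrite /= in_itv.
    apply: cvg_expr; rewrite ger0_norm ?expR_ge0// -expR0 ltr_expR oppr_lt0.
    by rewrite /u gtr0_norm ?subr_gt0// divr_gt0// addr_gt0// subr_gt0.
  - exact: finite_measure_integrable_cst.
  - apply: aeW => x n _; rewrite /= lee_fin ger0_norm; by case/andP: (h01 n (Y x)).
  by move=> _ _.
have := lim _ _ P X mX.
under eq_fun do rewrite key.
move=> /cvg_unique; apply => //.
exact: (lim _ _ stdnormal (fun z : M => s * z) (mscl s)).
Qed.
End limits.

Section gaussian_bridge.
Context {R : realType} d (T : measurableType d) (P : probability T R).
Notation M := (measurableTypeR R).

Lemma centered_normal_gaussian (X : T -> R) (s : R) :
  centered_normal P X s -> gaussian P X.
Proof.
move=> [mX lX]; split => //; exists 0, `|s| => A mA.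
rewrite /pushforward lX// normr_eq0; case: eqVneq => [->|s0].
  rewrite diracE; have [A0|A0] := pselect (A 0).
    rewrite mem_set// (_ : [set _ | _] = setT) ?probability_setT//.
    by apply/seteqP; split => // z _ /=; rewrite mul0r.
  rewrite memNset// (_ : [set _ | _] = set0) ?measure0//.
  by apply/seteqP; split => // z /=; rewrite mul0r.
exact: normal_prob_scale.
Qed.

(** Equal variances of X and Y and the vanishing of E(X Y) give the
pseudo-variance 0; E(X Y) is obtained by polarization from the variances of X,
Y and X + Y. *)
Lemma circular_CN (X Y : T -> R) (v : R) : 0 <= v ->
  (forall a b : R, centered_normal P (fun x => a * X x + b * Y x)
     (Num.sqrt ((a ^+ 2 + b ^+ 2) * (v / 2)))) ->
  CN P 0 v 0 (fun x => (X x +i* Y x)%C).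
Proof.
move=> v0 H.
have cX : centered_normal P X (Num.sqrt (v / 2)).
  have := H 1 0; rewrite expr1n expr0n addr0 mul1r; congr centered_normal.
  by apply/funext => x; rewrite mul1r mul0r addr0.
have cY : centered_normal P Y (Num.sqrt (v / 2)).
  have := H 0 1; rewrite expr1n expr0n add0r mul1r; congr centered_normal.
  by apply/funext => x; rewrite mul1r mul0r add0r.
have cXY : centered_normal P (fun x => X x + Y x) (Num.sqrt v).
  have := H 1 1; rewrite expr1n; congr centered_normal.
    by apply/funext => x; rewrite !mul1r.
  by congr Num.sqrt; field.
have v20 : 0 <= v / 2 by rewrite divr_ge0.
have [iX2 iX] := centered_normal_integrable cX.
have [iY2 iY] := centered_normal_integrable cY.
have [iXY2 iXY] := centered_normal_integrable cXY.
have eX2 := centered_normal_sqr cX; have eY2 := centered_normal_sqr cY.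
have eXY2 := centered_normal_sqr cXY.
rewrite sqr_sqrtr// in eX2; rewrite sqr_sqrtr// in eY2; rewrite sqr_sqrtr// in eXY2.
split.
- by move=> a b /=; exact: centered_normal_gaussian (H a b).
- by rewrite /cexpectation unlock /= (centered_normal_mean cX) (centered_normal_mean cY).
- rewrite unlock.
  transitivity (\int[P]_x ((X x ^+ 2)%:E + (Y x ^+ 2)%:E))%E.
    apply: eq_integral => x _; rewrite subr0 -EFinD; congr EFin.
    by rewrite /= sqr_sqrtr// addr_ge0 ?sqr_ge0.
  by rewrite integralD//= eX2 eY2 -EFinD -splitr.
- rewrite /cexpectation unlock /=.
  congr (_ +i* _)%C.
    transitivity (fine (\int[P]_x ((X x ^+ 2)%:E - (Y x ^+ 2)%:E)))%E.
      by congr fine; apply: eq_integral => x _; rewrite !subr0 -EFinB -!expr2.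
    by rewrite integralB// eX2 eY2 subee.
  transitivity (fine (\int[P]_x (((X x + Y x) ^+ 2)%:E - ((X x ^+ 2)%:E + (Y x ^+ 2)%:E)))%E).
    by congr fine; apply: eq_integral => x _; rewrite !subr0 -!EFinD; congr EFin; ring.
  rewrite integralB//; last exact: integrableD.
  by rewrite integralD// eX2 eY2 eXY2 -!EFinD -splitr subrr.
Qed.
End gaussian_bridge.

(** * Lebesgue measure on R^d *)

Section tuple_lebesgue.
Context {R : realType}.
Notation M := (measurableTypeR R).
Notation leb := (@lebesgue_measure R).

Definition tuple_shift n (v u : n.-tuple M) : n.-tuple M := [tuple tnth u i + tnth v i | i < n].

Lemma measurable_tuple_shift2 n :
  measurable_fun setT (fun p : n.-tuple M * n.-tuple M => tuple_shift p.1 p.2).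
Proof.
apply/measurable_fun_tnthP => i.
apply: (@eq_measurable_fun _ _ _ _ setT (fun p : n.-tuple M * n.-tuple M => tnth p.2 i + tnth
    p.1 i : M)).
  by move=> p _; rewrite /= tnth_mktuple.
apply: measurable_funD.
  exact: (measurableT_comp (measurable_tnth i) measurable_snd).
exact: (measurableT_comp (measurable_tnth i) measurable_fst).
Qed.

Lemma measurable_tuple_shift n (v : n.-tuple M) : measurable_fun setT (tuple_shift v).
Proof.
apply/measurable_fun_tnthP => i.
apply: (@eq_measurable_fun _ _ _ _ setT (fun u : n.-tuple M => tnth u i + tnth v i : M)).
  by move=> p _; rewrite /= tnth_mktuple.
by apply: measurable_funD => //; exact: measurable_tnth.
Qed.

Lemma lebesgue_measure_shift (a : R) (A : set M) : measurable A ->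
  leb ((fun x => x + a) @^-1` A) = leb A.
Proof.
move=> mA; rewrite -(lebesgue_affine a ltr01 mA) mul1e; congr (leb _).
by apply/seteqP; split => x; rewrite /= /affine mul1r.
Qed.

(** By induction on the dimension: a translation acts on each factor, so the
translated product measure satisfies the characterization of the product. *)
Lemma lebesgue_tuple_shift n (v : n.-tuple M) (A : set (n.-tuple M)) :
  measurable A -> lebesgue_tuple n (tuple_shift v @^-1` A) = lebesgue_tuple n A.
Proof.
elim: n v A => [|n IH] v A mA.
  congr (lebesgue_tuple 0 _); apply/seteqP; split => u /=.
    by rewrite (tuple0 u) (tuple0 (tuple_shift v _)).
  by rewrite (tuple0 u) (tuple0 (tuple_shift v _)).
pose S (p : M * n.-tuple M) : M * n.-tuple M := (p.1 + thead v, tuple_shift [tuple of behead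
    v] p.2).
have mS : measurable_fun setT S.
  apply/measurable_fun_pair => /=.
    by apply: measurable_funD => //; exact: measurable_fst.
  exact: (measurableT_comp (measurable_tuple_shift _) measurable_snd).
have E p : tuple_shift v (tcons p) = tcons (S p).
  case: p => x u; apply: eq_from_tnth => i; rewrite tnth_mktuple.
  case: (unliftP ord0 i) => [j ->|->].
    rewrite !tnthS /= tnth_mktuple tnth_behead; congr (_ + tnth v _); apply/val_inj.
    by rewrite /= inordK// ltnS.
  by rewrite !tnth0.
have mtA : measurable (tcons (n := n) @^-1` A).
  by apply: measurable_preimage => //; exact: measurable_tcons.
rewrite /= /lebesgue_cons /pushforward.
transitivity (image_measure (leb \x lebesgue_tuple n)%E mS (tcons (n := n) @^-1` A)).
  congr ((leb \x lebesgue_tuple n)%E _).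
  by apply/seteqP; split => p /=; rewrite E.
apply/esym; apply: product_measure_unique => // A1 A2 mA1 mA2.
rewrite /= /pushforward.
rewrite (_ : S @^-1` _ = ((fun x : M => x + thead v : M) @^-1` A1) `*` (tuple_shift [tuple of
    behead v] @^-1` A2)); last first.
  by apply/seteqP; split => -[x u].
rewrite product_measure1E.
- by rewrite IH//; congr (_ * _)%E; exact: lebesgue_measure_shift.
- by apply: measurable_preimage => //; exact: measurable_funD.
- by apply: measurable_preimage => //; exact: measurable_tuple_shift.
Qed.

Lemma measurable_tbox n (B : set M) : measurable B ->
  measurable [set u : n.-tuple M | forall i, B (tnth u i)].
Proof.
move=> mB; rewrite (_ : [set _ | _] = \bigcap_(i in [set: 'I_n]) ((@tnth n M)^~ i) @^-1` B).
  apply: fin_bigcap_measurable => // i _.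
  by apply: measurable_preimage => //; exact: measurable_tnth.
by apply/seteqP; split => u /=; [move=> h i _|move=> h i; exact: h].
Qed.

Lemma lebesgue_tuple_box n (B : set M) (r : R) : measurable B -> leb B = r%:E ->
  lebesgue_tuple n [set u : n.-tuple M | forall i, B (tnth u i)] = (r ^+ n)%:E.
Proof.
move=> mB Br; elim: n => [|n IH].
  by rewrite /= diracE mem_set//= => -[].
rewrite /= /lebesgue_cons /pushforward.
rewrite (_ : tcons (n := n) @^-1` _ = B `*` [set u : n.-tuple M | forall i, B (tnth u i)]);
    last first.
  apply/seteqP; split => -[x u] /=.
    move=> h; split; first by have := h ord0; rewrite tnth0.
    by move=> i; have := h (lift ord0 i); rewrite tnthS.
  move=> [Bx Bu] i; case: (unliftP ord0 i) => [j ->|->]; first by rewrite tnthS.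
  by rewrite tnth0.
rewrite product_measure1E//; last exact: measurable_tbox.
by rewrite IH exprS EFinM -Br.
Qed.
End tuple_lebesgue.

Section vec_lebesgue.
Context {R : realType} {d : nat}.
Notation M := (measurableTypeR R).
Notation V := 'rV[R]_d.
Notation W := (borel V).
Notation leb := (@lebesgue_vec R d).

Lemma continuous_measurable_vec (f : V -> R) : continuous f ->
  measurable_fun setT (f : W -> M).
Proof.
move=> cf; apply: (measurability _ (RGenOpens.measurableE R)).
move=> _ [_ [a [b ->]] <-]; rewrite setTI; apply: sub_sigma_algebra.
by move/continuousP: cf; apply; exact: interval_open.
Qed.

Definition tuple_of_row (x : W) : d.-tuple M := [tuple x ord0 i | i < d].

Lemma lebesgue_vec_shift (v : V) (A : set W) : measurable A ->
  leb ((fun x => x + v) @^-1` A) = leb A.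
Proof.
move=> mA; rewrite /lebesgue_vec /pushforward.
rewrite -[RHS](lebesgue_tuple_shift (tuple_of_row v)); last first.
  by apply: measurable_preimage => //; exact: measurable_row_of_tuple.
have E u : row_of_tuple u + v = row_of_tuple (tuple_shift (tuple_of_row v) u).
  by apply/rowP => i; rewrite !mxE !tnth_mktuple.
by congr (lebesgue_tuple d _); apply/seteqP; split => u /=; rewrite E.
Qed.

Lemma lebesgue_vec_box (B : set M) (r : R) : measurable B -> lebesgue_measure B = r%:E ->
  leb [set x : W | forall i, B (x ord0 i)] = (r ^+ d)%:E.
Proof.
move=> mB Br; rewrite /lebesgue_vec /pushforward -(lebesgue_tuple_box d mB Br).
congr (lebesgue_tuple d _); apply/seteqP; split => u /= h i; have := h i; by rewrite mxE.
Qed.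

Lemma measurable_tuple_of_row : measurable_fun setT tuple_of_row.
Proof.
apply/measurable_fun_tnthP => i.
apply: (@eq_measurable_fun _ _ _ _ setT (fun x : W => x ord0 i : M)).
  by move=> x _; rewrite /= tnth_mktuple.
apply: continuous_measurable_vec => x; exact: coord_continuous.
Qed.

Lemma measurable_addv : measurable_fun setT (fun p : W * W => (p.1 + p.2 : V) : W).
Proof.
rewrite (_ : (fun p => _) = row_of_tuple \o
    (fun q : d.-tuple M * d.-tuple M => tuple_shift q.1 q.2) \o
    (fun p : W * W => (tuple_of_row p.2, tuple_of_row p.1))).
  apply: measurableT_comp.
    exact: (measurableT_comp measurable_row_of_tuple (@measurable_tuple_shift2 R d)).
  apply/measurable_fun_pair => /=.
    exact: (measurableT_comp measurable_tuple_of_row measurable_snd).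
  exact: (measurableT_comp measurable_tuple_of_row measurable_fst).
by apply/funext => p; apply/rowP => i /=; rewrite !mxE !tnth_mktuple.
Qed.

Lemma measurable_shiftv (v : V) : measurable_fun setT (fun x : W => (x + v : V) : W).
Proof.
have : measurable_fun setT (fun x : W => (x, v : W)).
  by apply/measurable_fun_pair.
exact: (measurableT_comp measurable_addv).
Qed.

Definition cube (a b : R) : set W := [set x | forall i, a <= x ord0 i <= b].

Lemma measurable_vbox (B : set M) : measurable B -> measurable [set x : W | forall i, B (x
    ord0 i)].
Proof.
move=> mB; have := measurable_preimage measurable_tuple_of_row (@measurable_tbox R d B mB).
congr measurable; apply/seteqP; split => x /= h i; have := h i; by rewrite tnth_mktuple.
Qed.

Lemma measurable_cube a b : measurable (cube a b).
Proof.
have := @measurable_vbox `[a, b]%classic (measurable_itv _).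
by congr measurable; apply/seteqP; split => x /= h i; have := h i; rewrite in_itv.
Qed.

Lemma lebesgue_cube (a b : R) : a <= b -> leb (cube a b) = ((b - a) ^+ d)%:E.
Proof.
move=> ab; have := @lebesgue_vec_box `[a, b]%classic (b - a) (measurable_itv _).
rewrite (_ : [set _ | _] = cube a b); last first.
  by apply/seteqP; split => x /= h i; have := h i; rewrite /= in_itv.
apply; rewrite lebesgue_measure_itv/= lte_fin; move: ab.
by rewrite le_eqVlt => /orP[/eqP ->|->]; rewrite ?ltxx ?subrr.
Qed.

Lemma norm_cube (x : V) : cube (- `|x|) `|x| x.
Proof.
move=> i; rewrite -ler_norml.
rewrite /Num.norm/= mx_normrE.
by apply: (le_trans _ (le_bigmax _ _ (ord0, i))).
Qed.

(** Makes Tonelli's theorem available for [lebesgue_vec]. *)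
Lemma lebesgue_vec_sigma_finite : sigma_finite setT leb.
Proof.
exists (fun n => cube (- n%:R) n%:R).
  apply/seteqP; split => // x _; exists (Num.truncn `|x|).+1 => // i.
  have /andP[h1 h2] := norm_cube x i; have := truncnS_gt `|x| => /ltW h3.
  by rewrite (le_trans _ h1) ?lerN2// (le_trans h2).
move=> n; split; first exact: measurable_cube.
by rewrite lebesgue_cube ?ltry// -subr_ge0 opprK addr_ge0.
Qed.

HB.instance Definition _ := Measure_isSigmaFinite.Build _ _ _ leb lebesgue_vec_sigma_finite.

Lemma bounded_lebesgue_fin (D : set V) : bounded_set D -> measurable (D : set W) ->
  (leb D < +oo)%E.
Proof.
move=> [r [_ Dr]] mD.
have Dc : D `<=` cube (- (r + 1)) (r + 1).
  move=> x Dx i; have /andP[h1 h2] := norm_cube x i.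
  have h3 : `|x| <= r + 1 by apply: Dr => //; rewrite ltrDl.
  by rewrite (le_trans _ h1) ?lerN2// (le_trans h2).
apply: (@le_lt_trans _ _ (leb (cube (- (r + 1)) (r + 1)))).
  by apply: le_measure => //; rewrite inE//; exact: measurable_cube.
(* if r + 1 < 0, the cube is contained in the one with exchanged bounds *)
have [r1|r1] := leP 0 (r + 1).
  by rewrite lebesgue_cube ?ltry// -subr_ge0 opprK addr_ge0.
apply: (@le_lt_trans _ _ (leb (cube (r + 1) (- (r + 1))))).
  apply: le_measure; rewrite ?inE; try exact: measurable_cube.
  move=> x h i; have /andP[h1 h2] := h i.
  apply/andP; split; [apply: le_trans h1|apply: (le_trans h2)]; lra.
by rewrite lebesgue_cube ?ltry//; lra.
Qed.

Lemma ge0_integral_shift (v : V) (f : W -> \bar R) : measurable_fun setT f ->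
  (forall x, (0 <= f x)%E) ->
  (\int[leb]_x f (x + v)%R = \int[leb]_x f x)%E.
Proof.
move=> mf f0; transitivity (\int[image_measure leb (measurable_shiftv v)]_x f x)%E.
  by rewrite [RHS]ge0_integral_pushforward//; exact: measurable_shiftv.
by apply: eq_measure_integral => A mA _; exact: lebesgue_vec_shift.
Qed.
End vec_lebesgue.

(** * Square-integrable functions *)

Section square_integrable.
Context d (T : measurableType d) (R : realType).
Variables (mu : {measure set T -> \bar R}) (D : set T).
Hypothesis mD : measurable D.
Implicit Types f g : T -> R.

(** For the Lebesgue measure this is [real_L2 D]; an arbitrary measure and set
are allowed, as the eigenfunctions are used both on D and, extended by 0, on
the whole space. *)
Definition sqint f := measurable_fun D f /\ mu.-integrable D (fun x => (f x ^+ 2)%:E).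
Definition ip f g : R := \int[mu]_(x in D) (f x * g x).

Lemma sqint_prod f g : sqint f -> sqint g -> mu.-integrable D (fun x => (f x * g x)%:E).
Proof.
move=> [mf f2] [mg g2].
apply: (le_integrable mD _ _ (integrableD mD f2 g2)).
  by apply/measurable_EFinP; exact: measurable_funM.
move=> x Dx; rewrite /= lee_fin [leRHS]ger0_norm ?addr_ge0 ?sqr_ge0//.
rewrite normrM -(real_normK (num_real (f x))) -(real_normK (num_real (g x))).
have := sqr_ge0 (`|f x| - `|g x|); have := normr_ge0 (f x); have := normr_ge0 (g x); nra.
Qed.

Lemma sqintD f g : sqint f -> sqint g -> sqint (fun x => f x + g x).
Proof.
move=> sf sg; have [mf f2] := sf; have [mg g2] := sg.
split; first exact: measurable_funD.
have i2 := integrableZl mD 2 (integrableD mD f2 g2).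
apply: (le_integrable mD _ _ i2).
  by apply/measurable_EFinP; apply: measurable_funX; exact: measurable_funD.
move=> x Dx; rewrite /= lee_fin ger0_norm ?sqr_ge0// ger0_norm ?mulr_ge0 ?addr_ge0 ?sqr_ge0//.
have := sqr_ge0 (f x - g x); nra.
Qed.

Lemma sqintZ (k : R) f : sqint f -> sqint (fun x => k * f x).
Proof.
move=> [mf f2]; split; first exact: measurable_funM.
have := integrableZl mD (k ^+ 2) f2; congr (mu.-integrable D _).
by apply/funext => x; rewrite exprMn EFinM.
Qed.

Lemma sqintN f : sqint f -> sqint (fun x => - f x).
Proof. by move=> /(sqintZ (-1)); congr sqint; apply/funext => x; rewrite mulN1r. Qed.

Lemma sqintB f g : sqint f -> sqint g -> sqint (fun x => f x - g x).
Proof. by move=> sf /sqintN; exact: sqintD. Qed.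

Lemma sqint0 : sqint (fun=> 0).
Proof. by split=> //; rewrite expr0n; exact: integrable0. Qed.

Lemma sqint_sum (I : Type) (r : seq I) (F : I -> T -> R) :
  (forall i, sqint (F i)) -> sqint (fun x => \sum_(i <- r) F i x).
Proof.
move=> sF; elim: r => [|i r IH].
  by have := sqint0; congr sqint; apply/funext => x; rewrite big_nil.
have := sqintD (sF i) IH; congr sqint; apply/funext => x; by rewrite big_cons.
Qed.

Lemma eq_ip f f' g g' : {in D, f =1 f'} -> {in D, g =1 g'} -> ip f g = ip f' g'.
Proof. by move=> ff gg; apply: eq_Rintegral => x xD; rewrite ff// gg. Qed.

Lemma ipC f g : ip f g = ip g f.
Proof. by apply: eq_Rintegral => x _; rewrite mulrC. Qed.

Lemma ipDl f g h : sqint f -> sqint g -> sqint h ->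
  ip (fun x => f x + g x) h = ip f h + ip g h.
Proof.
move=> sf sg sh; rewrite /ip -RintegralD//; try exact: sqint_prod.
by apply: eq_Rintegral => x _; rewrite mulrDl.
Qed.

Lemma ipZl k f h : sqint f -> sqint h -> ip (fun x => k * f x) h = k * ip f h.
Proof.
move=> sf sh; rewrite /ip -RintegralZl//; last exact: sqint_prod.
by apply: eq_Rintegral => x _; rewrite mulrA.
Qed.

Lemma ipZr k f h : sqint f -> sqint h -> ip f (fun x => k * h x) = k * ip f h.
Proof. by move=> sf sh; rewrite ipC ipZl// ipC. Qed.

Lemma ipNl f h : sqint f -> sqint h -> ip (fun x => - f x) h = - ip f h.
Proof.
move=> sf sh; rewrite -mulN1r -ipZl//; apply: eq_ip => x _ //.
by rewrite mulN1r.
Qed.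

Lemma ipBl f g h : sqint f -> sqint g -> sqint h ->
  ip (fun x => f x - g x) h = ip f h - ip g h.
Proof. by move=> sf sg sh; rewrite ipDl ?ipNl//; exact: sqintN. Qed.

Lemma ip0l h : ip (fun=> 0) h = 0.
Proof.
rewrite /ip; under eq_Rintegral do rewrite mul0r.
by rewrite Rintegral_cst// mul0r.
Qed.

Lemma ip_suml (I : Type) (r : seq I) (F : I -> T -> R) h :
  (forall i, sqint (F i)) -> sqint h ->
  ip (fun x => \sum_(i <- r) F i x) h = \sum_(i <- r) ip (F i) h.
Proof.
move=> sF sh; elim: r => [|i r IH].
  rewrite big_nil -[RHS](ip0l h); apply: eq_ip => x _ //; by rewrite big_nil.
rewrite big_cons -IH -ipDl//; last exact: sqint_sum.
by apply: eq_ip => x _ //; rewrite big_cons.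
Qed.

Lemma ip_ge0 f : 0 <= ip f f.
Proof. by apply: Rintegral_ge0 => x _; rewrite -expr2 sqr_ge0. Qed.

Lemma ipD f g : sqint f -> sqint g ->
  ip (fun x => f x + g x) (fun x => f x + g x) = ip f f + 2 * ip f g + ip g g.
Proof.
move=> sf sg; have sfg := sqintD sf sg.
rewrite ipDl// ipC [X in _ + X]ipC !ipDl// (ipC g f); ring.
Qed.

Lemma ipB f g : sqint f -> sqint g ->
  ip (fun x => f x - g x) (fun x => f x - g x) = ip f f - 2 * ip f g + ip g g.
Proof.
move=> sf sg; have sNg := sqintN sg.
rewrite (ipD sf sNg) (ipC f) !ipNl// (ipC _ (fun x => - g x)) ipNl// opprK (ipC g f); ring.
Qed.

Lemma ip_CS f g : sqint f -> sqint g -> ip f g ^+ 2 <= ip f f * ip g g.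
Proof.
move=> sf sg.
have Q k : 0 <= ip f f - 2 * (k * ip f g) + k ^+ 2 * ip g g.
  have sk := sqintZ k sg; have := ip_ge0 (fun x => f x - k * g x).
  by rewrite (ipB sf sk) ipZr// ipZl// ipZr// [k * (k * _)]mulrA -expr2.
have [g0|g0] := eqVneq (ip g g) 0.
  have [->|fg0] := eqVneq (ip f g) 0; first by rewrite expr0n g0 mulr0.
  have := Q ((ip f f + 1) / (2 * ip f g)).
  have -> : 2 * ((ip f f + 1) / (2 * ip f g) * ip f g) = ip f f + 1 by field.
  rewrite g0 mulr0 addr0; lra.
have gp : 0 < ip g g by rewrite lt_neqAle eq_sym g0 ip_ge0.
have := Q (ip f g / ip g g).
have -> : ip f f - 2 * (ip f g / ip g g * ip f g) + (ip f g / ip g g) ^+ 2 * ip g g =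
   (ip f f * ip g g - ip f g ^+ 2) / ip g g by field.
by rewrite pmulr_lge0 ?invr_gt0// subr_ge0.
Qed.

Lemma ip_integral f : sqint f ->
  (\int[mu]_(x in D) (f x ^+ 2)%:E = (ip f f)%:E)%E.
Proof. by move=> [mf f2]; rewrite /ip /Rintegral fineK//; exact: integrable_fin_num. Qed.

Lemma bessel (w : nat -> T -> R) f N : (forall n, sqint (w n)) ->
  (forall n m, ip (w n) (w m) = (n == m)%:R) -> sqint f ->
  \sum_(n < N) ip f (w n) ^+ 2 <= ip f f.
Proof.
move=> sw ow sf.
pose g x := \sum_(n < N) ip f (w n) * w n x.
have sc n : sqint (fun x => ip f (w n) * w n x) by exact: sqintZ.
have sg : sqint g by exact: (sqint_sum _ (fun n : 'I_N => sc n)).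
have fg : ip f g = \sum_(n < N) ip f (w n) ^+ 2.
  rewrite ipC (ip_suml _ (fun n : 'I_N => sc n))//; apply: eq_bigr => n _.
  by rewrite ipZl// ipC.
have wg n : (n < N)%N -> ip g (w n) = ip f (w n).
  move=> nN; rewrite (ip_suml _ (fun n : 'I_N => sc n))//.
  rewrite (bigD1 (Ordinal nN))//= ipZl// ow eqxx mulr1 big1 ?addr0// => i /negbTE iN.
  by rewrite ipZl// ow -[n]/(val (Ordinal nN)) (inj_eq val_inj) iN mulr0.
have gg : ip g g = \sum_(n < N) ip f (w n) ^+ 2.
  rewrite (ip_suml _ (fun n : 'I_N => sc n))//; apply: eq_bigr => n _.
  by rewrite ipZl// (ipC _ g) wg// expr2.
have := ip_ge0 (fun x => f x - g x); rewrite (ipB sf sg) fg gg; lra.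
Qed.

Lemma ip_cvg (F : nat -> T -> R) f g : (forall n, sqint (F n)) -> sqint f -> sqint g ->
  ip (fun x => F n x - f x) (fun x => F n x - f x) @[n --> \oo] --> 0 ->
  ip (F n) g @[n --> \oo] --> ip f g.
Proof.
move=> sF sf sg c0; apply/cvgrPdist_le => e e0.
have k0 : 0 < ip g g + 1 by rewrite ltr_wpDl// ip_ge0.
have ek0 : 0 < e ^+ 2 / (ip g g + 1) by rewrite divr_gt0// exprn_gt0.
move/cvgrPdist_le : c0 => /(_ _ ek0); apply: filterS => n.
rewrite sub0r normrN ger0_norm ?ip_ge0// => h.
rewrite distrC -ipBl// -(@ler_pXn2r _ 2)// ?nnegrE// ?(ltW e0)// real_normK ?num_real//.
apply: le_trans (ip_CS (sqintB (sF n) sf) sg) _.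
apply: (@le_trans _ _ (e ^+ 2 / (ip g g + 1) * ip g g)).
  by rewrite ler_wpM2r// ip_ge0.
rewrite mulrAC ler_pdivrMr// ler_wpM2l ?sqr_ge0// lerDl//.
Qed.

Lemma ip_cvg_norm (F : nat -> T -> R) f : (forall n, sqint (F n)) -> sqint f ->
  ip (fun x => F n x - f x) (fun x => F n x - f x) @[n --> \oo] --> 0 ->
  ip (F n) (F n) @[n --> \oo] --> ip f f.
Proof.
move=> sF sf c0; have c1 := ip_cvg sF sf sf c0.
have -> : (fun n => ip (F n) (F n)) =
    (fun n => ip (fun x => F n x - f x) (fun x => F n x - f x) + 2 * ip (F n) f - ip f f).
  by apply/funext => n; rewrite (ipB (sF n) sf); ring.
rewrite [X in _ --> X](_ : _ = 0 + 2 * ip f f - ip f f); last by ring.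
apply: cvgB; last exact: cvg_cst.
by apply: cvgD => //; apply: cvgM => //; exact: cvg_cst.
Qed.
End square_integrable.

(** * Translations of functions in H^1_0 *)

Section squares.
Context {R : realType} {d : nat}.
Notation M := (measurableTypeR R).
Notation V := 'rV[R]_d.
Notation W := (borel V).
Notation leb := (@lebesgue_vec R d).
Implicit Types f g : W -> R.

(** The squared L^2 norm on the whole space, as an extended real number: its
finiteness is part of the conclusions of the translation estimates. *)
Definition sqnorm f : \bar R := (\int[leb]_x ((f x) ^+ 2)%:E)%E.

Let msq f : measurable_fun setT f -> measurable_fun setT (fun x => ((f x) ^+ 2)%:E).
Proof. by move=> mf; apply/measurable_EFinP; exact: measurable_funX. Qed.

Let sq0 f x : (0 <= ((f x) ^+ 2)%:E)%E.
Proof. by rewrite lee_fin sqr_ge0. Qed.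

Lemma sqnorm_ge0 f : (0 <= sqnorm f)%E.
Proof. by apply: integral_ge0 => x _. Qed.

Lemma measurable_comp_shiftv f (v : V) : measurable_fun setT f -> measurable_fun setT (fun x :
    W => f (x + v : V)).
Proof. by move=> mf; exact: (measurableT_comp mf (measurable_shiftv v)). Qed.

Lemma sqnorm_shift f (v : V) : measurable_fun setT f ->
  sqnorm (fun x => f (x + v)) = sqnorm f.
Proof. by move=> mf; exact: (ge0_integral_shift v (msq mf) (sq0 f)). Qed.

Lemma sqnormZ (k : R) f : measurable_fun setT f ->
  sqnorm (fun x => k * f x) = ((k ^+ 2)%:E * sqnorm f)%E.
Proof.
move=> mf; rewrite /sqnorm -ge0_integralZl//.
- by apply: eq_integral => x _; rewrite exprMn EFinM.
- exact: msq.
- by rewrite lee_fin sqr_ge0.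
Qed.

Lemma sqnorm_sum m (F : nat -> W -> R) : (forall i, measurable_fun setT (F i)) ->
  (sqnorm (fun x => \sum_(i < m) F i x)%R <= m%:R%:E * \sum_(i < m) sqnorm (F i))%E.
Proof.
move=> mF.
have mS : measurable_fun setT (fun x => (\sum_(i < m) (F i x) ^+ 2)%:E).
  by apply/measurable_EFinP; apply: measurable_sum => i; exact: measurable_funX.
have S0 x : 0 <= \sum_(i < m) (F i x) ^+ 2 by apply: sumr_ge0 => i _; exact: sqr_ge0.
have -> : (\sum_(i < m) sqnorm (F i))%E = (\int[leb]_x (\sum_(i < m) (F i x) ^+ 2)%:E)%E.
  under eq_integral do rewrite -sumEFin.
  by rewrite ge0_integral_sum// => i; exact: msq.
rewrite -ge0_integralZl//; last by move=> x _; rewrite lee_fin.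
apply: ge0_le_integral => //.
- by move=> x _; rewrite lee_fin sqr_ge0.
- apply: (msq (f := fun x => \sum_(i < m) F i x)); exact: measurable_sum.
- exact: emeasurable_funM.
- move=> x _; rewrite -EFinM lee_fin.
  have cs (G : nat -> R) : \sum_(i < m) G i <= Num.sqrt (\sum_(i < m) G i ^+ 2) * Num.sqrt m%:R.
    have := cauchy_schwarz_sum G (fun=> 1) m; rewrite !big_mkord.
    rewrite [X in X <= _ -> _](_ : _ = \sum_(i < m) G i); last first.
      by apply: eq_bigr => i _; rewrite mulr1.
    rewrite [X in _ * Num.sqrt X](_ : _ = m%:R)//.
    by under eq_bigr do rewrite expr1n; rewrite sumr_const card_ord.
  have h2 := cs (fun i => F i x); have := cs (fun i => - F i x).
  rewrite sumrN; under [X in _ <= Num.sqrt X * _]eq_bigr do rewrite sqrrN.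
  move=> h1.
  set S := \sum_(i < m) F i x; set Q := \sum_(i < m) _ ^+ 2.
  have Q0 : 0 <= Q by apply: sumr_ge0 => i _; exact: sqr_ge0.
  rewrite -(real_normK (num_real S)) -[m%:R * Q]sqr_sqrtr ?mulr_ge0// lerXn2r ?nnegrE
      ?sqrtr_ge0//.
  by rewrite sqrtrM// mulrC ler_norml h2 lerNl h1.
Qed.

Lemma sqnormD f g : measurable_fun setT f -> measurable_fun setT g ->
  (sqnorm (fun x => f x + g x)%R <= 2%:E * (sqnorm f + sqnorm g))%E.
Proof.
move=> mf mg.
have := @sqnorm_sum 2 (fun i => if i == 0%N then f else g).
under [X in sqnorm X]eq_fun do rewrite !big_ord_recl big_ord0 addr0/=.
by rewrite !big_ord_recl big_ord0 adde0/=; apply => -[|i].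
Qed.

(** A translation by a sum is performed in m steps; by translation invariance
the position from which a step is made does not matter. *)
Lemma sqnorm_shift_sum f (u : nat -> V) m : measurable_fun setT f ->
  (sqnorm (fun x => f (x + \sum_(j < m) u j) - f x)%R <=
   m%:R%:E * \sum_(j < m) sqnorm (fun x => f (x + u j) - f x)%R)%E.
Proof.
move=> mf; pose p j : V := \sum_(i < j) u i.
pose F j (x : W) : R := f (x + p j + u j) - f (x + p j).
have mF j : measurable_fun setT (F j).
  apply: measurable_funB; last exact: measurable_comp_shiftv.
  have := measurable_comp_shiftv (p j + u j) mf; congr (measurable_fun _).
  by apply/funext => x; rewrite addrA.
have -> : (fun x => f (x + \sum_(j < m) u j) - f x) = (fun x => \sum_(j < m) F j x).
  apply/funext => x; rewrite /F; elim: m => [|m IH].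
    by rewrite !big_ord0 addr0 subrr.
  by rewrite !big_ord_recr/= -IH /p; rewrite addrA [RHS]addrC addrA subrK.
apply: le_trans (sqnorm_sum _ mF) _; apply: lee_wpmul2l; first by rewrite lee_fin.
apply: lee_sum => j _; rewrite /F (@sqnorm_shift (fun y => f (y + u j) - f y))//.
by apply: measurable_funB => //; exact: measurable_comp_shiftv.
Qed.
End squares.

Lemma sume_cst (R : realType) m (x : \bar R) : (0 <= x)%E ->
  (\sum_(i < m) x = m%:R%:E * x)%E.
Proof.
move=> x0; elim: m => [|m IH]; first by rewrite big_ord0 mul0e.
by rewrite big_ord_recr/= IH -natr1 EFinD ge0_muleDl ?lee_fin// mul1e.
Qed.

Section test_functions.
Context {R : realType} {d : nat}.
Notation M := (measurableTypeR R).
Notation V := 'rV[R]_d.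
Notation W := (borel V).
Notation leb := (@lebesgue_vec R d).
Implicit Types (D : set V) (phi : V -> R).
Local Notation e_ i := (delta_mx ord0 i : V).

Lemma smooth_continuous phi : smooth phi -> continuous phi.
Proof. by move=> /(_ [::]) []. Qed.

Lemma smooth_derivable phi i x : smooth phi -> derivable phi x (e_ i).
Proof. by move=> /(_ [::]) [_]; exact. Qed.

Lemma partial_cvg phi i (x : V) : smooth phi ->
  (fun t : R => t^-1 *: ((phi \o shift x) (t *: e_ i) - phi x)) t @[t --> 0^'] --> partial i
      phi x.
Proof. by move=> sphi; exact: (@smooth_derivable phi i x sphi). Qed.

Lemma smooth_partial phi i : smooth phi -> smooth (partial i phi).
Proof.
move=> sphi s; have := sphi (rcons s i).
by rewrite (_ : iter_partial (rcons s i) phi = iter_partial s (partial i phi))// /iter_partial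
    foldr_rcons.
Qed.

Lemma partial_outside phi i x : ~ closure [set x | phi x != 0] x -> partial i phi x = 0.
Proof.
move=> nx; rewrite /partial (@near_eq_derive _ _ _ phi (cst 0)) ?derive_cst//.
have oC : open (~` closure [set x | phi x != 0]) by rewrite openC; exact: closed_closure.
have := open_nbhs_nbhs (conj oC nx); apply: filterS => y ny /=.
apply/eqP/negPn/negP => py; apply: ny; exact: subset_closure.
Qed.

Lemma test_partial D phi i : real_test_function D phi -> real_test_function D (partial i phi).
Proof.
move=> [sphi cphi Dphi].
have S : closure [set x | partial i phi x != 0] `<=` closure [set x | phi x != 0].
  have [E _] := closure_id (closure [set x | phi x != 0]).
  rewrite [X in _ `<=` X]E; last exact: closed_closure.
  apply: closureS => x /= /eqP px; apply: contrapT => nx; apply: px.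
  exact: partial_outside.
split; first exact: smooth_partial.
- by apply: subclosed_compact cphi S; exact: closed_closure.
- exact: subset_trans S Dphi.
Qed.

Lemma test_outside D phi x : real_test_function D phi -> ~ D x -> phi x = 0.
Proof.
move=> [_ _ Dphi] nDx; apply/eqP/negPn/negP => px; apply: nDx; apply: Dphi.
exact: subset_closure.
Qed.

Lemma test_bounded D phi : real_test_function D phi -> exists2 C, 0 <= C & forall x, `|phi x|
    <= C.
Proof.
move=> [sphi cphi Dphi].
have := continuous_compact (continuous_subspaceT (smooth_continuous sphi)) cphi.
move=> /compact_bounded [r [_ hr]]; exists (`|r| + 1); first by rewrite addr_ge0.
move=> x; have [xS|xS] := pselect (closure [set x | phi x != 0] x).
  by apply: hr; [rewrite ltr_pwDr// ler_norm|exists x].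
rewrite (_ : phi x = 0) ?normr0 ?addr_ge0//.
by apply/eqP/negPn/negP => px; apply: xS; exact: subset_closure.
Qed.

Lemma test_support D phi : real_test_function D phi ->
  exists2 r, 0 <= r & forall x, ~ cube (- r) r x -> phi x = 0.
Proof.
move=> [sphi /compact_bounded[r [_ hr]] Dphi]; exists (`|r| + 1); first by rewrite addr_ge0.
move=> x nx; apply/eqP/negPn/negP => px; apply: nx => i.
have /andP[h1 h2] := norm_cube x i.
have h3 : `|x| <= `|r| + 1.
  by apply: hr; [rewrite ltr_pwDr// ler_norm|exact: subset_closure].
by rewrite (le_trans _ h1) ?lerN2// (le_trans h2).
Qed.

Lemma test_measurable D phi : real_test_function D phi -> measurable_fun setT (phi : W -> R).
Proof. by move=> [sphi _ _]; apply: continuous_measurable_vec; exact: smooth_continuous. Qed.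

Lemma test_mvt phi i (C : R) (x : V) (t : R) : smooth phi -> (forall y, `|partial i phi y| <=
    C) ->
  `|phi (x + t *: e_ i) - phi x| <= C * `|t|.
Proof.
move=> sphi HC.
have der (y : V) (tau : R) : is_derive tau 1 (fun tau : R => phi (y + tau *: e_ i)) (partial i
    phi (y + tau *: e_ i)).
  have E : (fun h : R => h^-1 *: (((fun tau => phi (y + tau *: e_ i)) \o shift tau) (h *: 1) -
      phi (y + tau *: e_ i))) =
      (fun h : R => h^-1 *: ((phi \o shift (y + tau *: e_ i)) (h *: e_ i) - phi (y + tau *: e_
          i))).
    apply/funext => h /=; congr (_ *: (phi _ - _)).
    by rewrite [h *: 1]mulr1 scalerDl addrCA.
  apply: DeriveDef.
    by rewrite /derivable E; exact: smooth_derivable.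
  by rewrite /partial /derive E.
have pos (y : V) (u : R) : 0 <= u -> `|phi (y + u *: e_ i) - phi y| <= C * u.
  move=> u0.
  have cy : {within `[0, u], continuous (fun tau : R => phi (y + tau *: e_ i))}.
    by apply: derivable_within_continuous => z _; have [] := der y z.
  have dy z : z \in `]0, u[ -> is_derive z 1 (fun tau : R => phi (y + tau *: e_ i)) (partial i
      phi (y + z *: e_ i)).
    by move=> _; exact: der.
  have [c _ E] := MVT_segment u0 dy cy.
  by move: E; rewrite scale0r addr0 subr0 => ->; rewrite normrM (ger0_norm u0) ler_wpM2r.
have [t0|t0] := leP 0 t; first by rewrite (ger0_norm t0) pos.
have := pos (x + t *: e_ i) (- t); rewrite oppr_ge0 => /(_ (ltW t0)).
by rewrite -addrA -scalerDl subrr scale0r addr0 distrC (ltr0_norm t0).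
Qed.

(** The bound |phi(x + h e) - phi(x)|_2 <= |h| |d_i phi|_2. Cutting h into m
steps bounds the left-hand side by the norm of h times the difference quotient
of step h/m, for every m, and dominated convergence replaces this quotient by
the partial derivative as m tends to infinity. *)
Lemma test_shift D phi i (h : R) : real_test_function D phi ->
  (sqnorm (fun x => phi (x + h *: e_ i) - phi x)%R <= (h ^+ 2)%:E * sqnorm (partial i phi))%E.
Proof.
move=> tphi; have [sphi _ _] := tphi.
have mphi := test_measurable tphi.
have tp := test_partial i tphi; have mp := test_measurable tp.
have [C C0 HC] := test_bounded tp.
have [r r0 Hr] := test_support tphi.
have [->|h0] := eqVneq h 0.
  rewrite expr0n mul0e /sqnorm integral0_eq// => x _.
  by rewrite scale0r addr0 subrr expr0n.
(* h times the difference quotient of step h / (m + 1) *)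
pose q (m : nat) (x : W) : R := m.+1%:R * (phi (x + (h / m.+1%:R) *: e_ i) - phi x).
have mq m : measurable_fun setT (q m).
  by apply: measurable_funM => //; apply: measurable_funB => //; exact: measurable_comp_shiftv.
have qle m : (sqnorm (fun x => phi (x + h *: e_ i) - phi x)%R <= sqnorm (q m))%E.
  have := sqnorm_shift_sum (fun=> (h / m.+1%:R) *: e_ i) m.+1 mphi.
  rewrite sumr_const card_ord -scaler_nat scalerA (mulrC _ (h / _)) divfK ?pnatr_eq0//.
  move=> /le_trans; apply.
  rewrite /q sqnormZ; last by apply: measurable_funB => //; exact: measurable_comp_shiftv.
  by rewrite sume_cst ?sqnorm_ge0// expr2 EFinM -muleA.
have lim : (sqnorm (q m) @[m --> \oo] --> sqnorm (fun x => h * partial i phi x)%R)%E.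
  (* all the translated supports lie in the cube of half-side r + |h| *)
  have mK := @measurable_cube R d (- (r + `|h|)) (r + `|h|).
  pose K := @cube R d (- (r + `|h|)) (r + `|h|).
  have [] := @dominated_convergence _ _ _ leb setT measurableT
    (fun m x => ((q m x) ^+ 2)%:E) (fun x => ((h * partial i phi x) ^+ 2)%:E)
    (fun x => (((C * `|h|) ^+ 2) * \1_K x)%:E).
  - by move=> m; apply/measurable_EFinP; exact: measurable_funX.
  - by apply/measurable_EFinP; apply: measurable_funX; exact: measurable_funM.
  - apply: aeW => x _; apply: cvg_EFin; first exact: nearW.
    have D0 := @partial_cvg phi i x sphi.
    pose u (m : nat) : R := h / m.+1%:R.
    have u0 : u m @[m --> \oo] --> (0 : R).
      rewrite -[X in _ --> X](mulr0 h); apply: cvgM; first exact: cvg_cst.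
      exact: cvg_harmonic.
    have qE m : q m x = h * ((fun t : R => t^-1 *: ((phi \o shift x) (t *: e_ i) - phi x)) (u
        m)).
      rewrite /q /u /GRing.scale /= invf_div mulrA mulrCA divff// mulr1.
      by rewrite [in RHS](addrC _ x).
    have u0' : u m @[m --> \oo] --> (0 : R)^'.
      move=> A [e /= e0 eA]; move/cvgrPdist_lt: u0 => /(_ e e0); apply: filterS => m um.
      apply: eA => //=.
      by rewrite /u mulf_neq0// invr_neq0.
    have cq : q m x @[m --> \oo] --> h * partial i phi x.
      under eq_cvg do rewrite qE.
      apply: cvgM; first exact: cvg_cst.
      exact: (cvg_comp _ _ u0' D0).
    exact: (cvg_comp _ _ cq (@exprn_continuous _ 2 _)).
  - have mI : measurable_fun setT (fun x : W => (\1_K x)%:E : \bar R).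
      by apply/measurable_EFinP; exact: measurable_indic.
    apply/integrableP; split.
      by apply/measurable_EFinP; apply: measurable_funM => //; exact: measurable_indic.
    under eq_integral do rewrite gee0_abs ?lee_fin ?mulr_ge0 ?sqr_ge0// EFinM.
    rewrite ge0_integralZl//; last by rewrite lee_fin sqr_ge0.
    have fK : (leb K < +oo)%E.
      by rewrite lebesgue_cube ?ltry// -subr_ge0 opprK !addr_ge0.
    by rewrite integral_indic// setIT lte_mul_pinfty// lee_fin sqr_ge0.
  - apply: aeW => x m _; rewrite /= lee_fin ger0_norm ?sqr_ge0//.
    have [xK|xK] := pselect (K x).
      rewrite indicE mem_set// mulr1 -(real_normK (num_real (q m x))).
      rewrite lerXn2r ?nnegrE// ?mulr_ge0// /q normrM ger0_norm//.
      apply: (@le_trans _ _ (m.+1%:R * (C * `|h / m.+1%:R|))).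
        by rewrite ler_wpM2l//; apply: test_mvt.
      by rewrite normrM normfV (ger0_norm (ler0n _ _)) mulrC -!mulrA mulVf ?pnatr_eq0// mulr1.
    rewrite indicE memNset// mulr0.
    have -> : q m x = 0; last by rewrite expr0n.
    rewrite /q !Hr ?subrr ?mulr0// => xr; apply: xK => j.
      by have /andP[h1 h2] := xr j; apply/andP; split; [apply: le_trans h1;
          rewrite lerN2 lerDl|apply: (le_trans h2); rewrite lerDl].
    have /andP[] := xr j; rewrite !mxE.
    have hj : `|h / m.+1%:R * ((ord0 == ord0 :> 'I_1) && (j == i))%:R| <= `|h|.
      rewrite !normrM normfV -mulrA ler_piMr// mulr_ile1 ?invr_ge0//.
        by rewrite invf_le1 ?normr_gt0// ger0_norm// ler1n.
      by case: (_ && _); rewrite ?normr0 ?normr1.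
    move: hj; move: (_ * _) (x ord0 j) `|h| => b a c; rewrite ler_norml => /andP[h1 h2] h3 h4.
    by apply/andP; split; lra.
  by move=> _ _.
rewrite -sqnormZ//.
rewrite -(cvg_lim _ lim)//; apply: lime_ge; last exact: nearW.
by apply/cvg_ex; eexists; exact: lim.
Qed.
End test_functions.

Lemma cvg_sumr (R : realType) (I : Type) (r : seq I) (F : nat -> I -> R) (l : I -> R) :
  (forall i, F n i @[n --> \oo] --> l i) ->
  \sum_(i <- r) F n i @[n --> \oo] --> \sum_(i <- r) l i.
Proof.
move=> Fl; elim: r => [|i r IH].
  by rewrite big_nil; under eq_cvg do rewrite big_nil; exact: cvg_cst.
by rewrite big_cons; under eq_cvg do rewrite big_cons; exact: cvgD.
Qed.

Section H10_shift.
Context {R : realType} {d : nat}.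
Notation M := (measurableTypeR R).
Notation V := 'rV[R]_d.
Notation W := (borel V).
Notation leb := (@lebesgue_vec R d).
Implicit Types (phi : V -> R).
Local Notation e_ i := (delta_mx ord0 i : V).

(** One coordinate direction after the other. *)
Lemma test_shift_vec (D : set V) phi (v : V) (h : R) : real_test_function D phi ->
  (forall i, `|v ord0 i| <= h) ->
  (sqnorm (fun x => phi (x + v) - phi x)%R <=
   (d%:R * h ^+ 2)%:E * \sum_i sqnorm (partial i phi))%E.
Proof.
move=> tphi vh.
pose u (j : nat) : V := if insub j is Some i then v ord0 i *: e_ i else 0.
have uE (i : 'I_d) : u i = v ord0 i *: e_ i by rewrite /u valK.
have vE : v = \sum_(j < d) u j.
  by rewrite [LHS]row_sum_delta; apply: eq_bigr => i _; rewrite uE.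
rewrite {1}vE; apply: (le_trans (sqnorm_shift_sum u d (test_measurable tphi))).
rewrite EFinM -muleA; apply: lee_wpmul2l; first by rewrite lee_fin.
rewrite ge0_sume_distrr; last by move=> i _; exact: sqnorm_ge0.
apply: lee_sum => i _; rewrite uE.
apply: (le_trans (test_shift i _ tphi)); apply: lee_wpmul2r; first exact: sqnorm_ge0.
rewrite lee_fin -(real_normK (num_real _)) lerXn2r ?nnegrE//.
exact: le_trans (vh i).
Qed.

Variable D : set V.
Hypothesis mD : measurable (D : set W).
Local Notation ipD := (ip leb D).

Lemma test_sqint phi : (leb D < +oo)%E -> real_test_function D phi -> sqint leb D phi.
Proof.
move=> fD tphi; split; first exact: measurable_funTS (test_measurable tphi).
have [C C0 HC] := test_bounded tphi.
have iC : leb.-integrable D (cst (C ^+ 2)%:E).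
  apply/integrableP; split => //.
  rewrite /= integral_cst//= lte_mul_pinfty//.
apply: (le_integrable mD _ _ iC).
  by apply/measurable_EFinP; apply: measurable_funX;
      exact: measurable_funTS (test_measurable tphi).
move=> x Dx /=; rewrite lee_fin !ger0_norm ?sqr_ge0// -(real_normK (num_real (phi x))).
by rewrite lerXn2r ?nnegrE.
Qed.

Definition ext0 (f : V -> R) : W -> R := fun x => if x \in D then f x else 0.

Lemma measurable_ext0 f : measurable_fun (D : set W) f -> measurable_fun setT (ext0 f).
Proof.
move=> mf; apply: measurable_fun_if => //.
- apply: (measurable_fun_bool true).
  rewrite setTI (_ : _ @^-1` _ = D) //.
  by apply/seteqP; split => x /= => [/set_mem|/mem_set].
- rewrite setTI (_ : _ @^-1` _ = D) //.
  by apply/seteqP; split => x /= => [/set_mem|/mem_set].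
Qed.

Lemma sqnorm_ext0 f : sqint leb D f -> sqnorm (ext0 f) = (ipD f f)%:E.
Proof.
move=> sf; rewrite -(ip_integral mD sf) /sqnorm [RHS]integral_mkcond; apply: eq_integral => x _.
by rewrite patchE /ext0; case: ifP => //; rewrite expr0n.
Qed.

Lemma ext0_test phi : real_test_function D phi -> ext0 phi = phi.
Proof.
move=> tphi; apply/funext => x; rewrite /ext0; case: ifPn => //.
by rewrite notin_setE => nDx; rewrite (test_outside tphi nDx).
Qed.

Lemma real_L2norm_cvg (F : nat -> V -> R) (f : V -> R) :
  real_L2norm D (fun x => F n x - f x) @[n --> \oo] --> 0 ->
  ipD (fun x => F n x - f x) (fun x => F n x - f x) @[n --> \oo] --> 0.
Proof.
move=> c.
have E n : ipD (fun x => F n x - f x) (fun x => F n x - f x) = real_L2norm D (fun x => F n x -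
    f x) ^+ 2.
  rewrite /real_L2norm sqr_sqrtr.
    by apply: eq_Rintegral => x _; rewrite expr2.
  by apply: Rintegral_ge0 => x _; exact: sqr_ge0.
have c2 := cvg_comp _ _ c (@exprn_continuous R 2 0).
rewrite expr0n /= in c2.
by under eq_cvg do rewrite E.
Qed.

(** The estimate for test functions passes to the limit along an approximating
sequence phi n. The translates of f - phi n contribute an error that vanishes
in the limit. *)
Lemma H10_shift (f : V -> R) G (v : V) (h : R) : (leb D < +oo)%E -> H10 D f G ->
  (forall i, `|v ord0 i| <= h) ->
  (sqnorm (fun x => ext0 f (x + v) - ext0 f x)%R <=
   (2 * d%:R * h ^+ 2 * \sum_i ipD (G i) (G i))%:E)%E.
Proof.
move=> fD [L2f wG [phi [tphi cphi cpartial]]] vh.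
have sf : sqint leb D f by [].
have sG i : sqint leb D (G i) by exact: (wG i).1.
have sp n : sqint leb D (phi n) by exact: test_sqint.
have spa n i : sqint leb D (partial i (phi n)) by apply: test_sqint => //; exact: test_partial.
have c0 := real_L2norm_cvg cphi.
have ci i := ip_cvg_norm mD (spa ^~ i) (sG i) (real_L2norm_cvg (cpartial i)).
pose r n := 2 * (d%:R * h ^+ 2 * \sum_i ipD (partial i (phi n)) (partial i (phi n))) +
  8 * ipD (fun x => phi n x - f x) (fun x => phi n x - f x).
have cr : r n @[n --> \oo] --> 2 * d%:R * h ^+ 2 * \sum_i ipD (G i) (G i).
  have -> : 2 * d%:R * h ^+ 2 * \sum_i ipD (G i) (G i) =
      2 * (d%:R * h ^+ 2 * \sum_i ipD (G i) (G i)) + 8 * 0 by ring.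
  apply: cvgD.
    apply: cvgM; first exact: cvg_cst.
    apply: cvgM; first exact: cvg_cst.
    apply: cvg_sumr => i; exact: ci.
  by apply: cvgM => //; exact: cvg_cst.
have mf : measurable_fun setT (ext0 f) by apply: measurable_ext0; exact: sf.1.
have le_r n : (sqnorm (fun x => ext0 f (x + v) - ext0 f x)%R <= (r n)%:E)%E.
  have mp := test_measurable (tphi n).
  pose g x : R := ext0 f x - phi n x.
  have mg : measurable_fun setT g by exact: measurable_funB.
  have m1 : measurable_fun setT (fun x : W => phi n (x + v) - phi n x).
    by apply: measurable_funB => //; exact: measurable_comp_shiftv.
  have m2 : measurable_fun setT (fun x : W => g (x + v)).
    exact: measurable_comp_shiftv.
  have m3 : measurable_fun setT (fun x : W => - g x) by exact: measurable_funN.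
  have m4 : measurable_fun setT (fun x : W => g (x + v) + - g x) by exact: measurable_funD.
  have -> : (fun x => ext0 f (x + v) - ext0 f x) =
      (fun x => (phi n (x + v) - phi n x) + (g (x + v) + - g x)).
    by apply/funext => x; rewrite /g; ring.
  apply: (le_trans (sqnormD m1 m4)).
  have gE : sqnorm g = (ipD (fun x => phi n x - f x) (fun x => phi n x - f x))%:E.
    rewrite -sqnorm_ext0; last exact: sqintB.
    apply: eq_integral => x _; rewrite /g /ext0; case: ifPn => [_|].
      by rewrite -sqrrN opprB.
    by rewrite notin_setE => nDx; rewrite (test_outside (tphi n) nDx) subrr.
  have pE i : sqnorm (partial i (phi n)) = (ipD (partial i (phi n)) (partial i (phi n)))%:E.
    by rewrite -sqnorm_ext0// ext0_test//; exact: test_partial.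
  have le1 := test_shift_vec (tphi n) vh.
  have le2 := sqnormD m2 m3.
  have g2 : sqnorm (fun x : W => g (x + v)) = sqnorm g by exact: sqnorm_shift.
  have g3 : sqnorm (fun x : W => - g x) = sqnorm g.
    by apply: eq_integral => x _; rewrite sqrrN.
  rewrite g2 g3 gE -EFinD -EFinM in le2.
  have sE : (\sum_i sqnorm (partial i (phi n)) =
      (\sum_i ipD (partial i (phi n)) (partial i (phi n)))%:E)%E.
    by rewrite -sumEFin; apply: eq_bigr => i _; exact: pE.
  rewrite sE -EFinM in le1.
  apply: (le_trans (lee_wpmul2l _ (leeD le1 le2))); first by rewrite lee_fin.
  rewrite -EFinD -EFinM lee_fin /r.
  by rewrite le_eqVlt; apply/orP; left; apply/eqP; ring.
rewrite -(cvg_lim _ cr)//.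
have cE : (EFin \o r) n @[n --> \oo] --> (limn r)%:E.
  apply: cvg_EFin; first exact: nearW.
  by apply/cvg_ex; eexists; exact: cr.
rewrite -(cvg_lim _ cE)//; apply: lime_ge; last exact: nearW.
by apply/cvg_ex; eexists; exact: cE.
Qed.

(** The Dirichlet energy of a weak eigenfunction, found by letting the test
function in the weak equation tend to f. *)
Lemma eigenfunction_energy (f : V -> R) G (l : R) : (leb D < +oo)%E -> H10 D f G ->
  (forall phi, real_test_function D phi ->
    \sum_i \int[leb]_(x in D) (G i x * partial i phi x) = l * \int[leb]_(x in D) (f x * phi
        x)) ->
  \sum_i ipD (G i) (G i) = l * ipD f f.
Proof.
move=> fD [L2f wG [phi [tphi cphi cpartial]]] weak.
have sG i : sqint leb D (G i) by exact: (wG i).1.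
have sp n : sqint leb D (phi n) by exact: test_sqint.
have spa n i : sqint leb D (partial i (phi n)) by apply: test_sqint => //; exact: test_partial.
have c1 : \sum_i ipD (partial i (phi n)) (G i) @[n --> \oo] --> \sum_i ipD (G i) (G i).
  apply: cvg_sumr => i.
  exact: (ip_cvg mD (spa ^~ i) (sG i) (sG i) (real_L2norm_cvg (cpartial i))).
have c2 : l * ipD (phi n) f @[n --> \oo] --> l * ipD f f.
  by apply: cvgM; [exact: cvg_cst|exact: (ip_cvg mD sp L2f L2f (real_L2norm_cvg cphi))].
have E n : \sum_i ipD (partial i (phi n)) (G i) = l * ipD (phi n) f.
  rewrite ipC -(weak _ (tphi n)); apply: eq_bigr => i _; exact: ipC.
move: c2; under eq_cvg do rewrite -E; move=> c2; exact: (cvg_unique _ c1 c2).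
Qed.
End H10_shift.

(** * A bound on the number of eigenvalues *)

Section counting.
Context {R : realType} {d : nat} {D : set 'rV[R]_d} (B : dirichlet_eigenbasis D).
Notation M := (measurableTypeR R).
Notation V := 'rV[R]_d.
Notation W := (borel V).
Notation leb := (@lebesgue_vec R d).
Hypothesis mD : measurable (D : set W).
Hypothesis fD : (leb D < +oo)%E.
Local Notation w := (eigfun B).
Local Notation lambda := (eigval B).
Local Notation ipV := (ip leb setT).

Lemma eigfun_sqint n : sqint leb D (w n).
Proof. by have [h _ _] := eigfun_basis B; exact: h. Qed.

Lemma eigfun_ortho n m : ip leb D (w n) (w m) = (n == m)%:R.
Proof. by have [_ h _] := eigfun_basis B; exact: h. Qed.

Let we n := ext0 D (w n).

Let mwe n : measurable_fun setT (we n).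
Proof. by apply: measurable_ext0 => //; exact: (eigfun_sqint n).1. Qed.

Let swe n : sqint leb setT (we n).
Proof.
split => //; have [_ h] := eigfun_sqint n.
have := (integrable_mkcond (fun x : W => (w n x ^+ 2)%:E) mD).1 h.
congr (leb.-integrable _ _); apply/funext => x; rewrite patchE /we /ext0.
by case: ifP => //; rewrite expr0n.
Qed.

Let owe n m : ipV (we n) (we m) = (n == m)%:R.
Proof.
rewrite -eigfun_ortho /ip [RHS]Rintegral_mkcond; apply: eq_Rintegral => x _.
by rewrite patchE /we /ext0; case: ifP => //; rewrite mul0r.
Qed.

Lemma eigfun_shift n (v : V) (h : R) : (forall i, `|v ord0 i| <= h) ->
  (sqnorm (fun x => ext0 D (w n) (x + v) - ext0 D (w n) x)%R <= (2 * d%:R * h ^+ 2 * lambda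
      n)%:E)%E.
Proof.
move=> vh; have [G [HG weak]] := eigfun_weak B n.
have := H10_shift mD fD HG vh.
by rewrite (eigenfunction_energy mD fD HG weak) eigfun_ortho eqxx mulr1.
Qed.

Variable h : R.
Hypothesis h0 : 0 < h.
Let Q : set W := @cube R d 0 h.
Let q : R := h ^+ d.
Let q0 : 0 < q. Proof. exact: exprn_gt0. Qed.
Let mQ : measurable Q. Proof. exact: measurable_cube. Qed.
Let Qq : leb Q = q%:E.
Proof. by rewrite lebesgue_cube ?subr0// ltW. Qed.

(** The indicator function of the translated cube x + Q. *)
Let k (x : V) : W -> R := fun y => \1_Q (y - x : V).

Let mk x : measurable_fun setT (k x).
Proof.
have : measurable_fun setT (\1_Q : W -> R) by exact: measurable_indic.
exact: measurable_comp_shiftv.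
Qed.

Let k2 x y : k x y * k x y = k x y.
Proof. by rewrite /k indicE; case: (_ \in _); rewrite ?mulr1 ?mulr0. Qed.

Let intk x : (\int[leb]_y (k x y)%:E = q%:E)%E.
Proof.
have mI : measurable_fun setT (fun y : W => (\1_Q y)%:E : \bar R).
  by apply/measurable_EFinP; exact: measurable_indic.
have I0 (y : W) : (0 <= (\1_Q y)%:E :> \bar R)%E by rewrite lee_fin.
rewrite -Qq -[Q in RHS]setIT -integral_indic//.
exact: (ge0_integral_shift (- x) mI I0).
Qed.

Let sk x : sqint leb setT (k x).
Proof.
split => //; apply/integrableP; split.
  by apply/measurable_EFinP; exact: measurable_funX.
under eq_integral do rewrite gee0_abs ?lee_fin ?sqr_ge0// expr2 k2.
by rewrite intk ltry.
Qed.

Let ipk x : ipV (k x) (k x) = q.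
Proof. by rewrite /ip /Rintegral; under eq_integral do rewrite k2; rewrite intk. Qed.

(** The mean square oscillation of w_n on x + Q around its value at x, times
|Q|. *)
Let F n (x : W) : \bar R := (\int[leb]_(v in Q) ((we n (x + v)%R - we n x) ^+ 2)%:E)%E.

(** A value is controlled by the oscillation and the average: with
a = w_n(x) and I the integral of w_n on x + Q, the integral of (w_n - a)^2 on
x + Q is at least q a^2 - 2 a I, and (q a - 2 I)^2 >= 0. *)
Let F_ge n x :
  ((q * we n x ^+ 2)%:E <= 2%:E * F n x + (4 / q * ipV (k x) (we n) ^+ 2)%:E)%E.
Proof.
pose a := we n x; pose I := ipV (k x) (we n).
pose g y := k x y * we n y.
have sg : sqint leb setT g.
  split; first exact: measurable_funM.
  have [_ i2] := swe n; apply: (le_integrable _ _ _ i2) => //.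
    by apply/measurable_EFinP; apply: measurable_funX; exact: measurable_funM.
  move=> y _ /=; rewrite lee_fin !ger0_norm ?sqr_ge0// /g exprMn ler_piMl ?sqr_ge0//.
  by rewrite expr2 k2 /k indicE; case: (_ \in _).
have sak := sqintZ (measurableT : measurable (setT : set W)) a (sk x).
have mT : measurable (setT : set W) by [].
have FE : F n x = (ipV (fun y => g y - a * k x y) (fun y => g y - a * k x y))%:E.
  rewrite -(ip_integral mT); last exact: sqintB.
  have mint : measurable_fun setT (fun y : W => ((g y - a * k x y) ^+ 2)%:E : \bar R).
    by apply/measurable_EFinP; apply: measurable_funX; apply: measurable_funB;
        apply: measurable_funM.
  have int0 (y : W) : (0 <= ((g y - a * k x y) ^+ 2)%:E :> \bar R)%E by rewrite lee_fin sqr_ge0.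
  rewrite -(ge0_integral_shift x mint int0) /F integral_mkcond.
  apply: eq_integral => v _; rewrite patchE /g /k addrK indicE (addrC v).
  case: ifPn => vQ; rewrite ?mul0r ?mulr0 ?subr0 ?expr0n//.
  by rewrite mul1r mulr1.
have gk : ipV g (k x) = I.
  by apply: eq_Rintegral => y _; rewrite /g mulrAC k2.
rewrite FE (ipB mT sg sak) ipZr// gk ipZl// ipZr// ipk -EFinM -EFinD lee_fin -/a -/I.
have g0 := ip_ge0 leb setT g.
have qn0 : q != 0 by rewrite gt_eqF.
have : 0 <= (q * a - 2 * I) ^+ 2 / q by rewrite divr_ge0 ?sqr_ge0// ltW.
have -> : (q * a - 2 * I) ^+ 2 / q = q * a ^+ 2 - 4 * a * I + 4 / q * I ^+ 2 by field.
rewrite -/a; move: (ip _ _ g g) g0 => gg gg0.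
set c := 4 / q * I ^+ 2; have -> : q * a ^+ 2 = a * (a * q) by ring.
have -> : 4 * a * I = 4 * (a * I) by ring.
set b := a * (a * q); set e := a * I; lra.
Qed.

Let bess N x : \sum_(n < N) ipV (k x) (we n) ^+ 2 <= q.
Proof.
rewrite -(ipk x); apply: (@bessel _ _ _ leb setT _ we (k x) N) => //.
Qed.

Let mFint n : measurable_fun setT (fun p : W * W =>
  if p.2 \in Q then ((we n (p.1 + p.2)%R - we n p.1) ^+ 2)%:E else 0%E : \bar R).
Proof.
apply: measurable_fun_ifT => //.
  apply: (measurable_fun_bool true).
  rewrite setTI (_ : _ @^-1` _ = snd @^-1` Q).
    by apply: measurable_preimage => //; exact: measurable_snd.
  by apply/seteqP; split => p /= => [/set_mem|/mem_set].
apply/measurable_EFinP; apply: measurable_funX; apply: measurable_funB.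
  exact: (measurableT_comp (mwe n) measurable_addv).
exact: (measurableT_comp (mwe n) measurable_fst).
Qed.

Let FE n x : F n x = (\int[leb]_v (if v \in Q then ((we n (x + v)%R - we n x) ^+ 2)%:E else
    0%E))%E.
Proof. by rewrite /F integral_mkcond; apply: eq_integral => v _; rewrite patchE. Qed.

Let F0 n x : (0 <= F n x)%E.
Proof. by apply: integral_ge0 => v _; rewrite lee_fin sqr_ge0. Qed.

Let mF n : measurable_fun setT (F n).
Proof.
have -> : F n = fun x => (\int[leb]_v (if v \in Q then ((we n (x + v)%R - we n x) ^+ 2)%:E
    else 0%E))%E.
  by apply/funext => x; exact: FE.
apply: (measurable_fun_fubini_tonelli_F (fun p : W * W =>
  if p.2 \in Q then ((we n (p.1 + p.2)%R - we n p.1) ^+ 2)%:E else 0%E)) => //.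
by move=> p; case: ifP => // _; rewrite lee_fin sqr_ge0.
Qed.

Let intF n : (\int[leb]_x F n x <= (q * (2 * d%:R * h ^+ 2 * lambda n))%:E)%E.
Proof.
under eq_integral do rewrite FE.
rewrite (fubini_tonelli (fun p : W * W =>
  if p.2 \in Q then ((we n (p.1 + p.2)%R - we n p.1) ^+ 2)%:E else 0%E))//; last first.
  by move=> p; case: ifP => // _; rewrite lee_fin sqr_ge0.
apply: (@le_trans _ _ (\int[leb]_(v in Q) (2 * d%:R * h ^+ 2 * lambda n)%:E)%E); last first.
  by rewrite integral_cst// (EFinM q) muleC; rewrite le_eqVlt; apply/orP; left; apply/eqP;
      congr (_ * _)%E; exact: Qq.
have l0 : (0 <= (2 * d%:R * h ^+ 2 * lambda n)%:E)%E.
  by rewrite lee_fin !mulr_ge0// ltW// ?exprn_gt0// eigval_gt0.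
rewrite [leRHS]integral_mkcond; apply: ge0_le_integral => //.
- move=> v _; apply: integral_ge0 => x _ /=; case: ifP => // _; by rewrite lee_fin sqr_ge0.
- apply: (measurable_fun_fubini_tonelli_G (fun p : W * W =>
    if p.2 \in Q then ((we n (p.1 + p.2)%R - we n p.1) ^+ 2)%:E else 0%E)) => //.
  by move=> p; case: ifP => // _; rewrite lee_fin sqr_ge0.
- by apply/(measurable_restrictT _ mQ); exact: measurable_cst.
- move=> v _; rewrite patchE /=; case: ifPn => [vQ|_]; last by rewrite integral0.
  rewrite inE in vQ; apply: eigfun_shift => i.
  by have /andP[v0 vh] := vQ i; rewrite ger0_norm.
Qed.

(** Sum [F_ge] over n < N and integrate over D. The left-hand side becomes
N |Q|. The sum of the oscillations is at most N |Q| / 4, by the smallness of h,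
and the averages contribute at most 4 |D|, by Bessel's inequality. *)
Lemma eigenvalue_count_cube N : 8 * d%:R * h ^+ 2 * lambda N <= 1 ->
  N%:R * h ^+ d <= 8 * fine (leb D).
Proof.
move=> hl; rewrite -/q.
have sF x : (0 <= \sum_(n < N) F n x)%E by apply: sume_ge0.
have mqw n : measurable_fun (D : set W) (fun x : W => (q * we n x ^+ 2)%:E : \bar R).
  by apply: measurable_funTS; apply/measurable_EFinP; apply: measurable_funM => //;
      exact: measurable_funX.
have msF : measurable_fun setT (fun x : W => \sum_(n < N) F n x)%E.
  by apply: emeasurable_sum.
have cD : (\int[leb]_(x in D) 4%:E = (4 * fine (leb D))%:E)%E.
  rewrite integral_cst// EFinM; congr (_ * _)%E.
  by rewrite fineK// ge0_fin_numE.
have main : ((q * N%:R)%:E <= 2%:E * \sum_(n < N) \int[leb]_x F n x + (4 * fine (leb D))%:E)%E.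
  have -> : ((q * N%:R)%:E = \int[leb]_(x in D) \sum_(n < N) (q * we n x ^+ 2)%:E)%E.
    rewrite ge0_integral_sum//; last by move=> n x _; rewrite lee_fin mulr_ge0 ?sqr_ge0// ltW.
    rewrite (eq_bigr (fun=> q%:E)) ?sume_cst//; last first.
      move=> n _; under eq_integral do rewrite EFinM.
      rewrite ge0_integralZl//; last 3 first.
      - by apply: measurable_funTS; apply/measurable_EFinP; exact: measurable_funX.
      - by move=> x _; rewrite lee_fin sqr_ge0.
      - by rewrite lee_fin ltW.
      have -> : (\int[leb]_(x in D) (we n x ^+ 2)%:E = 1%:E)%E.
        transitivity (\int[leb]_(x in D) (w n x ^+ 2)%:E)%E.
          by apply: eq_integral => x xD; rewrite /we /ext0 xD.
        by rewrite (ip_integral mD (eigfun_sqint n)) eigfun_ortho eqxx.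
      by rewrite mule1.
      by rewrite lee_fin ltW.
    by rewrite -EFinM mulrC.
  apply: (@le_trans _ _ (\int[leb]_(x in D) (2%:E * \sum_(n < N) F n x + 4%:E))%E).
    apply: ge0_le_integral => //.
    - by move=> x _; apply: sume_ge0 => n _; rewrite lee_fin mulr_ge0 ?sqr_ge0// ltW.
    - by apply: emeasurable_sum => n.
    - apply: emeasurable_funD => //; apply: measurable_funTS; exact: measurable_funeM.
    - move=> x _.
      apply: (@le_trans _ _ (\sum_(n < N) (2%:E * F n x + (4 / q * ipV (k x) (we n) ^+
          2)%:E))%E).
        by apply: lee_sum => n _; exact: F_ge.
      rewrite big_split/= -ge0_sume_distrr//; apply: leeD2l.
      rewrite sumEFin lee_fin -mulr_sumr.
      apply: (@le_trans _ _ (4 / q * q)); last by rewrite divfK ?gt_eqF.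
      by apply: ler_wpM2l; [rewrite divr_ge0// ltW|exact: bess].
  rewrite ge0_integralD//; last 2 first.
  - by move=> x _; rewrite mule_ge0.
  - by apply: measurable_funTS; exact: measurable_funeM.
  rewrite cD; apply: leeD2r.
  rewrite -ge0_integral_sum// -ge0_integralZl//.
  apply: ge0_subset_integral => //; first exact: measurable_funeM.
  by move=> x _; rewrite mule_ge0.
have S : (\sum_(n < N) \int[leb]_x F n x <= (N%:R * (q * (2 * d%:R * h ^+ 2 * lambda N)))%:E)%E.
  apply: (@le_trans _ _ (\sum_(n < N) (q * (2 * d%:R * h ^+ 2 * lambda N))%:E)%E).
    apply: lee_sum => n _; apply: (le_trans (intF n)); rewrite lee_fin.
    apply: ler_wpM2l; first exact: ltW.
    apply: ler_wpM2l; first by rewrite !mulr_ge0// ?exprn_ge0// ltW.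
    by apply: eigval_nondecreasing; exact: ltnW.
  by rewrite sumEFin lee_fin; set c := q * _; rewrite sumr_const card_ord (mulr_natl c N).
have := le_trans main (leeD (lee_wpmul2l _ S) (lexx _)).
rewrite -!EFinM -EFinD !lee_fin => /(_ (ler0n _ 2)).
set a := d%:R in hl *; set e := h ^+ 2 in hl *; set l := lambda N in hl *; set v := fine _.
have -> : 2 * (N%:R * (q * (2 * a * e * l))) = 2^-1 * ((q * N%:R) * (8 * a * e * l)) by field.
have qN : 0 <= q * N%:R by rewrite mulr_ge0// ltW.
have := ler_wpM2l qN hl; rewrite mulr1 (mulrC _ q).
set p := q * N%:R; set r := _ * (8 * _ * _ * _).
lra.
Qed.

End counting.

(** A weak form of Weyl's law. A side h proportional to 1 / (1 + lambda_N) is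
admissible for every N, and its power h^d yields the exponent d. *)
Lemma eigenvalue_count {R : realType} {d : nat} {D : set 'rV[R]_d}
    (B : dirichlet_eigenbasis D) :
  (0 < d)%N -> measurable (D : set (borel 'rV[R]_d)) -> (@lebesgue_vec R d D < +oo)%E ->
  exists C : R, forall N, N%:R <= C * (1 + eigval B N) ^+ d.
Proof.
move=> d0 mD fD; exists (8 * fine (@lebesgue_vec R d D) * (8 * d%:R) ^+ d) => N.
have l0 := eigval_gt0 B N; set l := eigval B N in l0 *.
have l1 : 1 <= 1 + l by rewrite lerDl ltW.
have c1 : 1 <= 8 * d%:R * (1 + l).
  by rewrite -natrM -[leLHS]mulr1 ler_pM// ler1n muln_gt0.
have c0 : 0 < 8 * d%:R * (1 + l) by exact: lt_le_trans c1.
pose h := (8 * d%:R * (1 + l))^-1.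
have h0 : 0 < h by rewrite invr_gt0.
have := @eigenvalue_count_cube R d D B mD fD h h0 N.
rewrite -/l => step.
have : 8 * d%:R * h ^+ 2 * l <= 1.
  have -> : 8 * d%:R * h ^+ 2 * l = (8 * d%:R * l * h) * h by ring.
  apply: mulr_ile1; rewrite ?ltW//.
  - by rewrite !mulr_gt0// ltr0n.
  - rewrite /h ltr_pdivrMr// mul1r mulrDr mulr1 -[ltLHS]add0r ltrD2r.
    by rewrite mulr_gt0// ltr0n.
  - rewrite /h invf_lt1//; apply: (@lt_le_trans _ _ (1 + l)); first by rewrite ltrDl.
    by rewrite -natrM -[leLHS]mul1r ler_pM2r ?ltr_wpDl// ler1n muln_gt0.
move=> /step; rewrite /h exprVn ler_pdivrMr ?exprn_gt0//.
by rewrite exprMn mulrA.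
Qed.

(** The terms are dominated by 2 / (k+1) - 2 / (k+2), which telescope. *)
Lemma sum_inv_square_le (R : realType) N :
  \sum_(0 <= k < N) (k.+1%:R ^+ 2)^-1 <= 2 - 2 * N.+1%:R^-1 :> R.
Proof.
elim: N => [|N IH]; first by rewrite big_geq// invr1; lra.
rewrite big_nat_recr//=; apply: (le_trans (lerD IH (lexx _))).
rewrite -subr_ge0.
have n1 : N.+1%:R != 0 :> R by rewrite pnatr_eq0.
have n2 : N.+2%:R != 0 :> R by rewrite pnatr_eq0.
have -> : 2 - 2 / N.+2%:R - (2 - 2 / N.+1%:R + (N.+1%:R ^+ 2)^-1) =
   N%:R / (N.+1%:R ^+ 2 * N.+2%:R) :> R.
  rewrite -!natr1 in n1 n2 *; field.
  by rewrite n1 /= n2.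
by rewrite divr_ge0// mulr_ge0// exprn_ge0.
Qed.

(** [eigenvalue_count] with the additive constants absorbed, which is possible
since the eigenvalues are bounded below by the first one. *)
Lemma eigval_growth {R : realType} {d : nat} {D : set 'rV[R]_d}
    (B : dirichlet_eigenbasis D) :
  (0 < d)%N -> measurable (D : set (borel 'rV[R]_d)) -> (@lebesgue_vec R d D < +oo)%E ->
  exists2 K : R, 0 < K & forall n, n.+1%:R <= K * eigval B n ^+ d.
Proof.
move=> d0 mD fD; have [C HC] := eigenvalue_count B d0 mD fD.
have l0 := eigval_gt0 B 0%N; set l := eigval B 0%N in l0 *.
have C'0 : 0 <= Num.max C 0 by rewrite le_max lexx orbT.
exists (Num.max C 0 * (l^-1 + 1) ^+ d + l^-1 ^+ d).
  by rewrite ltr_wpDl// ?mulr_ge0// ?exprn_ge0 ?exprn_gt0 ?invr_gt0// addr_ge0// invr_ge0 ltW.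
move=> n; have ln0 := eigval_gt0 B n.
have lln : 1 <= l^-1 * eigval B n.
  by rewrite mulrC ler_pdivlMr// mul1r eigval_nondecreasing.
rewrite -natr1 mulrDl; apply: lerD; last by rewrite -exprMn exprn_ege1.
apply: (le_trans (HC n)); rewrite -mulrA -exprMn.
apply: (@le_trans _ _ (Num.max C 0 * (1 + eigval B n) ^+ d)).
  apply: ler_wpM2r; first by rewrite exprn_ge0// addr_ge0// ltW.
  by rewrite le_max lexx.
apply: ler_wpM2l => //; rewrite lerXn2r ?nnegrE ?mulr_ge0 ?addr_ge0 ?invr_ge0 ?(ltW ln0) ?(ltW
    l0)//.
by rewrite mulrDl mul1r lerD2r.
Qed.

Lemma sum_eigval_le {R : realType} {d : nat} {D : set 'rV[R]_d}
    (B : dirichlet_eigenbasis D) :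
  (0 < d)%N -> measurable (D : set (borel 'rV[R]_d)) -> (@lebesgue_vec R d D < +oo)%E ->
  exists2 M : R, 0 < M & forall N, \sum_(0 <= n < N) (eigval B n ^+ d)^-1 ^+ 2 <= M.
Proof.
move=> d0 mD fD; have [K K0 HK] := eigval_growth B d0 mD fD.
exists (K ^+ 2 * 2); first by rewrite mulr_gt0// exprn_gt0.
move=> N; apply: (@le_trans _ _ (K ^+ 2 * \sum_(0 <= k < N) (k.+1%:R ^+ 2)^-1)).
  rewrite mulr_sumr; apply: ler_sum => n _.
  have ln0 : 0 < eigval B n ^+ d by rewrite exprn_gt0// eigval_gt0.
  have e0 : 0 < (eigval B n ^+ d) ^+ 2 := exprn_gt0 2 ln0.
  rewrite exprVn ler_pdivlMr// mulrC ler_pdivrMr//.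
  by rewrite -exprMn lerXn2r ?nnegrE ?mulr_ge0 ?(ltW K0) ?(ltW ln0).
apply: ler_wpM2l; first by rewrite exprn_ge0// (ltW K0).
by apply: (le_trans (sum_inv_square_le R N)); rewrite gerBl mulr_ge0// invr_ge0.
Qed.

(** * Orthonormal series *)

Lemma limn_einf_le (R : realType) (u : (\bar R)^nat) (c : \bar R) :
  (forall n, u n <= c)%E -> (limn_einf u <= c)%E.
Proof.
move=> uc; rewrite limn_einf_lim; apply: lime_le; first exact: is_cvg_einfs.
apply: nearW => n; apply: le_trans (uc n); apply: ereal_inf_lbound.
by exists n => /=.
Qed.

Section orthonormal_series.
Context d (T : measurableType d) (R : realType).
Variables (mu : {measure set T -> \bar R}) (D : set T).
Hypothesis mD : measurable D.
Hypothesis fD : (mu D < +oo)%E.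
Variable w : nat -> T -> R.
Hypothesis sw : forall n, sqint mu D (w n).
Hypothesis ow : forall n m, ip mu D (w n) (w m) = (n == m)%:R.

Lemma sqint_partial_sum (b : nat -> R) n : sqint mu D (fun x => \sum_(k < n) b k * w k x).
Proof. by apply: sqint_sum => // k; exact: sqintZ. Qed.

Lemma ip_partial_sum (b : nat -> R) n :
  ip mu D (fun x => \sum_(k < n) b k * w k x) (fun x => \sum_(k < n) b k * w k x) =
  \sum_(k < n) b k ^+ 2.
Proof.
have sb k : sqint mu D (fun x => b k * w k x) by exact: sqintZ.
rewrite (ip_suml mD _ (fun k : 'I_n => sb k)); last exact: sqint_partial_sum.
apply: eq_bigr => k _; rewrite ipC (ip_suml mD _ (fun k : 'I_n => sb k))//.
rewrite (bigD1 k)//= big1 ?addr0; last first.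
  move=> i ik; rewrite ipZl// ipZr// ow -(inj_eq val_inj) in ik *.
  by rewrite (negbTE ik) !mulr0.
by rewrite ipZl// ipZr// ow eqxx mulr1 expr2.
Qed.

(** Since |y| <= 1 + y^2 and D has finite measure, an orthonormal family is
bounded in L^1. *)
Lemma integral_abs_le n : (\int[mu]_(x in D) `|w n x|%:E <= 1 + mu D)%E.
Proof.
have [mw _] := sw n.
have m2 : measurable_fun D (fun x => (w n x ^+ 2)%:E : \bar R).
  by apply/measurable_EFinP; exact: measurable_funX.
apply: (@le_trans _ _ (\int[mu]_(x in D) ((w n x ^+ 2)%:E + 1%:E))%E).
  apply: ge0_le_integral => //.
  - by apply/measurable_EFinP; exact: measurableT_comp.
  - exact: emeasurable_funD.
  - move=> x _; rewrite lee_fin -real_normK ?num_real//.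
    have := normr_ge0 (w n x); set y := `|_| => y0; have := sqr_ge0 (y - 2^-1).
    have -> : (y - 2^-1) ^+ 2 = y ^+ 2 - y + 4^-1 by field.
    move: (y ^+ 2) => z; lra.
rewrite ge0_integralD//; last by move=> x _; rewrite lee_fin sqr_ge0.
by rewrite ip_integral// ow eqxx integral_cst// mul1e.
Qed.

(** Absolutely summable coefficients make the series of absolute values
integrable, because the family is bounded in L^1, and hence finite almost
everywhere. The sum f is thus defined pointwise, and Fatou's lemma bounds the
distance from f to a partial sum by the tail of the squares of the
coefficients. *)
Lemma orthonormal_series (b : nat -> R) :
  cvgn (series (fun k => `|b k|)) -> cvgn (series (fun k => b k ^+ 2)) ->
  exists2 f, sqint mu D f &
    ip mu D (fun x => \sum_(k < n) b k * w k x - f x)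
            (fun x => \sum_(k < n) b k * w k x - f x) @[n --> \oo] --> 0.
Proof.
move=> b1 b2.
pose S n x := \sum_(k < n) b k * w k x.
have sS n : sqint mu D (S n) by exact: sqint_partial_sum.
pose W x := (\sum_(k <oo) `|b k * w k x|%:E)%E.
have mbw k : measurable_fun D (fun x => `|b k * w k x|%:E).
  apply/measurable_EFinP; apply: measurableT_comp => //.
  by apply: measurable_funM => //; exact: (sw k).1.
have mW : measurable_fun D W.
  rewrite (_ : W = fun x => (\sum_(k <oo | k \in predT) `|b k * w k x|%:E)%E)//.
  by apply: ge0_emeasurable_sum => //; move=> k x _ _; rewrite lee_fin.
have W0 x : (0 <= W x)%E by apply: nneseries_ge0 => k _ _; rewrite lee_fin.
have iW : mu.-integrable D W.
  apply/integrableP; split => //.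
  under eq_integral do rewrite gee0_abs//.
  rewrite integral_nneseries//.
  have fM : (1 + mu D)%E \is a fin_num by rewrite ge0_fin_numE ?adde_ge0// lte_add_pinfty//
      ltry.
  apply: (@le_lt_trans _ _ (limn (series (fun k => `|b k|)) * fine (1 + mu D))%:E);
      last exact: ltry.
  apply: lime_le; first by apply: is_cvg_nneseries => k _ _; apply: integral_ge0.
  apply: nearW => n; apply: (@le_trans _ _ (\sum_(0 <= k < n) (`|b k| * fine (1 + mu D))%:E)%E).
    apply: lee_sum => k _; rewrite EFinM fineK//.
    under eq_integral do rewrite normrM EFinM.
    rewrite ge0_integralZl//.
      by apply: lee_wpmul2l => //; exact: integral_abs_le.
    by apply/measurable_EFinP; apply: measurableT_comp => //; exact: (sw k).1.
  rewrite sumEFin lee_fin -mulr_suml ler_wpM2r ?fine_ge0 ?adde_ge0//.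
  by apply: nondecreasing_cvgn_le => //; apply: nondecreasing_series.
have aeW := integrable_ae mD iW.
(* the partial sums, modified on a null set so as to converge everywhere *)
pose g n x := if W x \is a fin_num then S n x else 0.
have mg n : measurable_fun D (g n).
  have mWf : measurable (D `&` [set x | W x \is a fin_num]) by exact: emeasurable_fin_num.
  apply: measurable_fun_if => //.
    by apply: (measurable_fun_bool true); move: mWf; congr measurable; congr (_ `&` _).
  apply: (measurable_funS mD) (sS n).1; exact: subIsetl.
have cg x : cvgn (g ^~ x).
  have [Wx|Wx] := boolP (W x \is a fin_num); last first.
    rewrite (_ : g ^~ x = cst 0); first exact: is_cvg_cst.
    by apply/funext => n; rewrite /g (negbTE Wx).
  rewrite (_ : g ^~ x = series (fun k => b k * w k x)); last first.
    by apply/funext => n; rewrite /g Wx /series/= big_mkord.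
  apply: normed_cvg; apply: nondecreasing_is_cvgn;
      first by apply: nondecreasing_series => k _ _; exact: normr_ge0.
  exists (fine (W x)) => _ [n _ <-]; rewrite -lee_fin fineK// -sumEFin.
  by apply: (@nneseries_lim_ge _ (fun k => `|b k * w k x|%:E) xpredT 0%N n) => k _ _;
      rewrite lee_fin; exact: normr_ge0.
pose f x := limn (g ^~ x).
have mf : measurable_fun D f by apply: (measurable_fun_cvg mg) => x _; exact: cg.
pose tau := limn (series (fun k => b k ^+ 2)).
have fS m : (\int[mu]_(x in D) ((S m x - f x) ^+ 2)%:E <= (tau - series (fun k => b k ^+ 2)
    m)%:E)%E.
  have -> : (\int[mu]_(x in D) ((S m x - f x) ^+ 2)%:E = \int[mu]_(x in D) ((g m x - f x) ^+
      2)%:E)%E.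
    apply: ge0_ae_eq_integral => //.
    - by apply/measurable_EFinP; apply: measurable_funX; apply: measurable_funB => //;
        exact: (sS m).1.
    - by apply/measurable_EFinP; apply: measurable_funX; exact: measurable_funB.
    - by move=> x _; rewrite lee_fin sqr_ge0.
    - by move=> x _; rewrite lee_fin sqr_ge0.
    by apply: filterS aeW => x /= h Dx; rewrite /g h.
  pose h n x := ((g m x - g (n + m)%N x) ^+ 2)%:E.
  have -> : (\int[mu]_(x in D) ((g m x - f x) ^+ 2)%:E = \int[mu]_(x in D) limn_einf (h ^~
      x))%E.
    apply: eq_integral => x _.
    have cgx : g (n + m)%N x @[n --> \oo] --> f x.
      by have := cg x; rewrite -(cvg_shiftn m).
    have ch : h ^~ x @ \oo --> ((g m x - f x) ^+ 2)%:E.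
      apply: cvg_EFin; first exact: nearW.
      rewrite /h /comp /=.
      have c : g m x - g (n + m)%N x @[n --> \oo] --> g m x - f x.
        by apply: cvgB => //; exact: cvg_cst.
      under eq_cvg do rewrite expr2.
      by rewrite expr2; exact: cvgM.
    by rewrite (is_cvg_limn_einfE (cvgP _ ch)); rewrite (cvg_lim _ ch).
  apply: (le_trans (fatou _ mD _ _)).
  - by move=> n; apply/measurable_EFinP; apply: measurable_funX; exact: measurable_funB.
  - by move=> n x _; rewrite lee_fin sqr_ge0.
  apply: limn_einf_le => n.
  (* the coefficients of the difference of two partial sums *)
  pose b' k := if (m <= k)%N then b k else 0.
  apply: (@le_trans _ _ (\int[mu]_(x in D) ((\sum_(k < n + m) b' k * w k x) ^+ 2)%:E)%E).
    apply: ge0_le_integral => //.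
    - by move=> x _; rewrite lee_fin sqr_ge0.
    - by apply/measurable_EFinP; apply: measurable_funX; exact: measurable_funB.
    - by apply/measurable_EFinP; apply: measurable_funX;
        exact: (sqint_partial_sum b' (n + m)).1.
    move=> x _; rewrite /h lee_fin /g; case: ifP => _; last by rewrite subrr expr0n sqr_ge0.
    rewrite /S -!(big_mkord xpredT (fun k => _ k * w k x)).
    rewrite -sqrrN opprB (big_cat_nat (leq0n m) (leq_addl n m))//= addrAC subrr add0r.
    rewrite [in leRHS](big_cat_nat (leq0n m) (leq_addl n m))//=.
    have -> : \sum_(0 <= i < m) b' i * w i x = 0.
      by rewrite big_nat big1// => k /andP[_ km]; rewrite /b' leqNgt km mul0r.
    rewrite add0r.
    rewrite le_eqVlt; apply/orP; left; apply/eqP; congr (_ ^+ 2).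
    by apply: eq_big_nat => k /andP[mk _]; rewrite /b' mk.
  rewrite (ip_integral mD (sqint_partial_sum b' (n + m))).
  rewrite ip_partial_sum lee_fin lerBrDl.
  apply: (@le_trans _ _ (series (fun k => b k ^+ 2) (n + m)%N)); last first.
    by apply: nondecreasing_cvgn_le => //; apply: nondecreasing_series => k _ _; exact: sqr_ge0.
  rewrite /series/= -(big_mkord xpredT (fun k => b' k ^+ 2)).
  rewrite !(big_cat_nat (leq0n m) (leq_addl n m))//=.
  have -> : \sum_(0 <= i < m) b' i ^+ 2 = 0.
    by rewrite big_nat big1// => k /andP[_ km]; rewrite /b' leqNgt km expr0n.
  rewrite add0r lerD2l le_eqVlt; apply/orP; left; apply/eqP.
  by apply: eq_big_nat => k /andP[mk _]; rewrite /b' mk.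
have sSf m : sqint mu D (fun x => S m x - f x).
  have mSf : measurable_fun D (fun x => S m x - f x) by apply: measurable_funB => //;
      exact: (sS m).1.
  split => //; apply/integrableP; split.
    by apply/measurable_EFinP; exact: measurable_funX.
  under eq_integral do rewrite gee0_abs ?lee_fin ?sqr_ge0//.
  by apply: (le_lt_trans (fS m)); exact: ltry.
exists f.
  have := sqintB mD (sS 0%N) (sSf 0%N); congr (sqint _ _ _).
  by apply/funext => x; rewrite opprB addrC subrK.
apply: (@squeeze_cvgr _ _ _ _ (cst 0) (fun m => tau - series (fun k => b k ^+ 2) m)).
- apply: nearW => m; rewrite ip_ge0 /=.
  by rewrite -lee_fin -(ip_integral mD (sSf m)).
- exact: cvg_cst.
- rewrite -(subrr tau); apply: cvgB; first exact: cvg_cst.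
  exact: b2.
Qed.

End orthonormal_series.

(** * The fractional Laplacian of a test function *)

Section coefficients.
Context {R : realType} {d : nat} {D : set 'rV[R]_d} (B : dirichlet_eigenbasis D).
Notation V := 'rV[R]_d.
Notation W := (borel V).
Notation leb := (@lebesgue_vec R d).
Hypothesis d0 : (0 < d)%N.
Hypothesis mD : measurable (D : set W).
Hypothesis fD : (leb D < +oo)%E.
Local Notation w := (eigfun B).
Local Notation lambda := (eigval B).
Local Notation ipD := (ip leb D).

(** Two integrations by parts: the weak equation tested against phi and the
weak gradient tested against the partial derivatives of phi. *)
Lemma eigen_laplacian n phi : real_test_function D phi ->
  lambda n * ipD (w n) phi = - \sum_i ipD (w n) (partial i (partial i phi)).
Proof.
move=> tphi; have [G [[_ wG _] weak]] := eigfun_weak B n.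
rewrite -(weak _ tphi) -sumrN; apply: eq_bigr => i _.
by have [_ /(_ _ (test_partial i tphi)) h] := wG i; rewrite /ip h opprK.
Qed.

(** Each application of [eigen_laplacian] trades a factor lambda_n for two
derivatives of phi. *)
Lemma coef_decay m phi : real_test_function D phi ->
  exists2 C, 0 <= C & forall n, lambda n ^+ m * `|ipD (w n) phi| <= C.
Proof.
elim: m phi => [|m IH] phi tphi.
  exists (Num.sqrt (ipD phi phi)); first exact: sqrtr_ge0.
  move=> n; rewrite expr0 mul1r -sqrtr_sqr ler_wsqrtr//.
  have sw := eigfun_sqint B n; have sphi := test_sqint mD fD tphi.
  by apply: (le_trans (ip_CS mD sw sphi)); rewrite eigfun_ortho eqxx mul1r.
have /choice[C HC] i : exists C, 0 <= C /\
    forall n, lambda n ^+ m * `|ipD (w n) (partial i (partial i phi))| <= C.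
  by have [C C0 HC] := IH _ (test_partial i (test_partial i tphi)); exists C.
exists (\sum_i C i); first by apply: sumr_ge0 => i _; exact: (HC i).1.
move=> n; rewrite exprSr -mulrA.
have l0 := eigval_gt0 B n.
rewrite -[X in _ * (X * _)](gtr0_norm l0) -normrM eigen_laplacian// normrN.
apply: (@le_trans _ _ (lambda n ^+ m * \sum_i `|ipD (w n) (partial i (partial i phi))|)).
  by rewrite ler_wpM2l ?exprn_ge0 ?(ltW l0)// ler_norm_sum.
by rewrite mulr_sumr; apply: ler_sum => i _; exact: (HC i).2.
Qed.

(** A decay of order m + 2 d with m >= s leaves the summable factor
lambda_n^(- 2 d). *)
Lemma coef_summable s phi : real_test_function D phi ->
  cvgn (series (fun n => lambda n `^ s * `|ipD (w n) phi|)).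
Proof.
move=> tphi.
have [m sm] : exists m : nat, s <= m%:R.
  exists (Num.bound `|s|); apply: (le_trans (ler_norm s)).
  exact: ltW (archi_boundP (normr_ge0 s)).
have [C C0 HC] := coef_decay (m + d * 2) tphi.
have [M M0 HM] := sum_eigval_le B d0 mD fD.
(* lambda_n^(m - s) is bounded below by its value at the least eigenvalue *)
pose a := lambda 0%N `^ (m%:R - s).
have a0 : 0 < a by rewrite powR_gt0// eigval_gt0.
have le n : lambda n `^ s * `|ipD (w n) phi| <= C / a * (lambda n ^+ d)^-1 ^+ 2.
  have l0 := eigval_gt0 B n.
  have e0 : 0 < (lambda n ^+ d) ^+ 2 by rewrite !exprn_gt0.
  rewrite exprVn ler_pdivlMr// mulrAC ler_pdivlMr//.
  apply: le_trans (HC n); rewrite exprD exprM.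
  have -> : lambda n ^+ m = lambda n `^ s * lambda n `^ (m%:R - s).
    by rewrite -powRD ?subrKC ?powR_mulrn ?(ltW l0)// (gt_eqF l0) implybT.
  have : a <= lambda n `^ (m%:R - s).
    rewrite ge0_ler_powR ?nnegrE ?subr_ge0 ?(ltW l0)// ?(ltW (eigval_gt0 B 0%N))//.
    exact: eigval_nondecreasing.
  set c := `|_|; set b := _ `^ (_ - _); set e := lambda n `^ s; set f := _ ^+ 2 => ab.
  have -> : e * b * f * c = (e * f * c) * b by ring.
  apply: ler_wpM2l => //; rewrite mulr_ge0 ?normr_ge0// mulr_ge0 ?powR_ge0//.
  exact: ltW.
apply: nondecreasing_is_cvgn.
  by apply: nondecreasing_series => n _ _; rewrite mulr_ge0// powR_ge0.
exists (C / a * M) => _ [N _ <-]; rewrite /series/=.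
apply: (@le_trans _ _ (C / a * \sum_(0 <= n < N) (lambda n ^+ d)^-1 ^+ 2)).
  by rewrite mulr_sumr; apply: ler_sum => n _.
by apply: ler_wpM2l => //; rewrite divr_ge0// ltW.
Qed.

End coefficients.

Lemma cvg_series_sqr (R : realType) (u : R^nat) : (forall n, 0 <= u n) ->
  cvgn (series u) -> cvgn (series (fun n => u n ^+ 2)).
Proof.
move=> u0 cu; have nd := nondecreasing_series (fun n _ _ => u0 n : 0 <= u n).
have le N : series u N <= limn (series u).
  by apply: nondecreasing_cvgn_le => //; apply: nondecreasing_series => n _ _; exact: u0.
have L0 : 0 <= limn (series u) by apply: le_trans (le 0%N); rewrite /series/= big_geq.
apply: nondecreasing_is_cvgn.
  by apply: nondecreasing_series => n _ _; exact: sqr_ge0.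
exists (limn (series u) * limn (series u)) => _ [N _ <-].
apply: (@le_trans _ _ (limn (series u) * series u N)); last exact: ler_wpM2l.
rewrite /series/= mulr_sumr; apply: ler_sum => n _; rewrite expr2 ler_wpM2r//.
apply: le_trans (le n.+1); rewrite /series/= big_nat_recr//= lerDr.
by apply: sumr_ge0.
Qed.

Lemma Re_sum (R : realType) (I : Type) (r : seq I) (F : I -> R[i]) :
  complex.Re (\sum_(i <- r) F i) = \sum_(i <- r) complex.Re (F i).
Proof.
elim: r => [|i r IH]; first by rewrite !big_nil.
by rewrite !big_cons -IH; case: (F i) => ? ?; case: (\sum_(_ <- _) _).
Qed.

Lemma Im_sum (R : realType) (I : Type) (r : seq I) (F : I -> R[i]) :
  complex.Im (\sum_(i <- r) F i) = \sum_(i <- r) complex.Im (F i).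
Proof.
elim: r => [|i r IH]; first by rewrite !big_nil.
by rewrite !big_cons -IH; case: (F i) => ? ?; case: (\sum_(_ <- _) _).
Qed.

Lemma normc_sqr (R : realType) (z : R[i]) :
  normc z ^+ 2 = complex.Re z ^+ 2 + complex.Im z ^+ 2.
Proof. by case: z => x y /=; rewrite sqr_sqrtr// addr_ge0// sqr_ge0. Qed.

Section fractional.
Context {R : realType} {d : nat} {D : set 'rV[R]_d} (B : dirichlet_eigenbasis D).
Notation V := 'rV[R]_d.
Notation W := (borel V).
Notation leb := (@lebesgue_vec R d).
Hypothesis d0 : (0 < d)%N.
Hypothesis mD : measurable (D : set W).
Hypothesis fD : (leb D < +oo)%E.
Local Notation w := (eigfun B).
Local Notation lambda := (eigval B).
Local Notation ipD := (ip leb D).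
Local Notation Ref u := (fun x => complex.Re (u x)).
Local Notation Imf u := (fun x => complex.Im (u x)).

Lemma L2norm_ip (u : V -> R[i]) : L2 D u ->
  L2norm D u = Num.sqrt (ipD (Ref u) (Ref u) + ipD (Imf u) (Imf u)).
Proof.
move=> [sr si]; rewrite /L2norm; congr Num.sqrt.
rewrite /ip -RintegralD//; try exact: sqint_prod.
by apply: eq_Rintegral => x _; rewrite normc_sqr !expr2.
Qed.

Lemma coef_ip u n : coef B u n = (ipD (w n) (Ref u) +i* ipD (w n) (Imf u))%C.
Proof.
by rewrite /coef /cintegral; congr (_ +i* _)%C; apply: eq_Rintegral => x _;
  case: (u x) => a b /=; rewrite mulr0 ?subr0 ?add0r mulrC.
Qed.

Lemma Re_partial_sum s u v n x :
  complex.Re (v x - \sum_(k < n) (lambda k `^ s)%:C%C * coef B u k * (w k x)%:C%C) =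
  complex.Re (v x) - \sum_(k < n) (lambda k `^ s * ipD (w k) (Ref u)) * w k x.
Proof.
set z := \sum_(k < n) _.
have -> : complex.Re (v x - z) = complex.Re (v x) - complex.Re z by case: (v x) => ? ?; case: z.
congr (_ - _); rewrite Re_sum; apply: eq_bigr => k _; rewrite coef_ip /=; ring.
Qed.

Lemma Im_partial_sum s u v n x :
  complex.Im (v x - \sum_(k < n) (lambda k `^ s)%:C%C * coef B u k * (w k x)%:C%C) =
  complex.Im (v x) - \sum_(k < n) (lambda k `^ s * ipD (w k) (Imf u)) * w k x.
Proof.
set z := \sum_(k < n) _.
have -> : complex.Im (v x - z) = complex.Im (v x) - complex.Im z by case: (v x) => ? ?; case: z.
congr (_ - _); rewrite Im_sum; apply: eq_bigr => k _; rewrite coef_ip /=; ring.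
Qed.

Let sw n := eigfun_sqint B n.
Let ow n m := eigfun_ortho B n m.

Let S (b : nat -> R) n (x : W) := \sum_(k < n) b k * w k x.
Let sS b n : sqint leb D (S b n).
Proof. exact: sqint_partial_sum. Qed.

Let ip_opp (f g : W -> R) :
  ipD (fun x => f x - g x) (fun x => f x - g x) = ipD (fun x => g x - f x) (fun x => g x - f x).
Proof.
by apply: eq_Rintegral => x _; rewrite -[in LHS]opprB mulNr mulrN opprK.
Qed.

(** Reduces complex series to pairs of real ones. *)
Lemma L2norm_partial_sum s u v n : L2 D v ->
  L2norm D (fun x => v x - \sum_(k < n) (lambda k `^ s)%:C%C * coef B u k * (w k x)%:C%C) =
  Num.sqrt (
    ipD (fun x => S (fun k => lambda k `^ s * ipD (w k) (Ref u)) n x - complex.Re (v x))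
        (fun x => S (fun k => lambda k `^ s * ipD (w k) (Ref u)) n x - complex.Re (v x)) +
    ipD (fun x => S (fun k => lambda k `^ s * ipD (w k) (Imf u)) n x - complex.Im (v x))
        (fun x => S (fun k => lambda k `^ s * ipD (w k) (Imf u)) n x - complex.Im (v x))).
Proof.
move=> [sr si]; set br := (fun k => _ * ipD _ (Ref u)); set bi := (fun k => _ * ipD _ (Imf u)).
have Er : Ref (fun x => v x - \sum_(k < n) (lambda k `^ s)%:C%C * coef B u k * (w k x)%:C%C) =
    (fun x => complex.Re (v x) - S br n x) by apply/funext => x; exact: Re_partial_sum.
have Ei : Imf (fun x => v x - \sum_(k < n) (lambda k `^ s)%:C%C * coef B u k * (w k x)%:C%C) =
    (fun x => complex.Im (v x) - S bi n x) by apply/funext => x; exact: Im_partial_sum.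
rewrite L2norm_ip; last by split; rewrite ?Er ?Ei; apply: sqintB.
by rewrite Er Ei ip_opp (ip_opp (Imf v)).
Qed.

Lemma test_fracLaplacian s phi : test_function D phi ->
  exists v, is_fracLaplacian B s phi v.
Proof.
move=> [tr ti].
have E (f : V -> R) : real_test_function D f -> exists2 g : V -> R, sqint leb D g &
    ipD (fun x => S (fun k => lambda k `^ s * ipD (w k) f) n x - g x)
        (fun x => S (fun k => lambda k `^ s * ipD (w k) f) n x - g x) @[n --> \oo] --> 0.
  move=> tf; have c1 := @coef_summable _ _ _ B d0 mD fD s f tf.
  have nb : (fun k => `|lambda k `^ s * ipD (w k) f|) = (fun k => lambda k `^ s * `|ipD (w k)
      f|).
    by apply/funext => k; rewrite normrM ger0_norm// powR_ge0.
  apply: (orthonormal_series mD fD sw ow (b := fun k => lambda k `^ s * ipD (w k) f)).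
    by rewrite nb.
  have := @cvg_series_sqr _ (fun k => `|lambda k `^ s * ipD (w k) f|) (fun k => normr_ge0 _).
  have c1' : cvgn (series (fun k => `|lambda k `^ s * ipD (w k) f|)) by rewrite nb.
  move=> /(_ c1').
  by under eq_fun do rewrite real_normK ?num_real//.
have [fr sr cr] := E _ tr; have [fi si ci] := E _ ti.
exists (fun x => (fr x +i* fi x)%C).
have L2v : L2 D (fun x => (fr x +i* fi x)%C) by [].
split=> //.
under eq_cvg do rewrite (L2norm_partial_sum s phi _ L2v).
have c := cvgD cr ci; rewrite addr0 in c.
have h := cvg_comp _ _ (c _) (@sqrt_continuous R 0); rewrite sqrtr0 in h.
exact: h.
Qed.

(** Parseval's identity. It holds for every sum v of the series, whichever
representative is chosen in the definition of [fracLaplacian]. *)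
Lemma fracLaplacian_norm s u v : is_fracLaplacian B s u v ->
  series (fun n => (lambda n `^ s) ^+ 2 * normc (coef B u n) ^+ 2) @ \oo --> L2norm D v ^+ 2.
Proof.
move=> [L2v]; have [sr si] := L2v.
under eq_cvg do rewrite (L2norm_partial_sum s u _ L2v).
set br := (fun k => _ * ipD _ (Ref u)); set bi := (fun k => _ * ipD _ (Imf u)) => c0.
pose er n := ipD (fun x => S br n x - complex.Re (v x)) (fun x => S br n x - complex.Re (v x)).
pose ei n := ipD (fun x => S bi n x - complex.Im (v x)) (fun x => S bi n x - complex.Im (v x)).
have er0 n : 0 <= er n by exact: ip_ge0.
have ei0 n : 0 <= ei n by exact: ip_ge0.
have c2 : er n + ei n @[n --> \oo] --> 0.
  rewrite -[X in _ --> X](mulr0 0) (_ : (fun n => er n + ei n) =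
    (fun n => Num.sqrt (er n + ei n) * Num.sqrt (er n + ei n))); first by apply: cvgM;
        exact: c0.
  by apply/funext => n; rewrite -expr2 sqr_sqrtr// addr_ge0.
have H (b : nat -> R) (f : V -> R) : sqint leb D f ->
    ipD (fun x => S b n x - f x) (fun x => S b n x - f x) @[n --> \oo] --> 0 ->
    \sum_(k < n) b k ^+ 2 @[n --> \oo] --> ipD f f.
  move=> sf c; have := ip_cvg_norm mD (sS b) sf c.
  by under eq_cvg do rewrite (ip_partial_sum mD sw ow).
rewrite (L2norm_ip L2v) sqr_sqrtr ?addr_ge0 ?ip_ge0//.
have -> : series (fun n => (lambda n `^ s) ^+ 2 * normc (coef B u n) ^+ 2) =
    (fun n => \sum_(k < n) br k ^+ 2 + \sum_(k < n) bi k ^+ 2).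
  apply/funext => n; rewrite -big_split /series [LHS]big_mkord; apply: eq_bigr => k _.
  by rewrite [normc _ ^+ 2]normc_sqr coef_ip /= /br /bi !exprMn mulrDr.
apply: cvgD; apply: H => //.
  apply: (@squeeze_cvgr _ _ _ _ (cst 0) (fun n => er n + ei n)) => //; last exact: cvg_cst.
  by apply: nearW => n; rewrite er0 lerDl ei0.
apply: (@squeeze_cvgr _ _ _ _ (cst 0) (fun n => er n + ei n)) => //; last exact: cvg_cst.
by apply: nearW => n; rewrite ei0 lerDr er0.
Qed.

Lemma test_Ls s phi : test_function D phi -> Ls B s phi.
Proof.
move=> tphi; split; last exact: test_fracLaplacian.
by case: tphi => tr ti; split; apply: test_sqint.
Qed.

Lemma test_Ls_norm s phi : test_function D phi ->
  series (fun n => (lambda n `^ s) ^+ 2 * normc (coef B phi n) ^+ 2) @ \oo -->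
  Ls_norm B s phi ^+ 2.
Proof.
move=> tphi; apply: fracLaplacian_norm.
have [v Hv] := test_fracLaplacian s tphi.
exact: (xgetPex _ (ex_intro _ v Hv)).
Qed.

End fractional.

(** * The spaces L_(-t) *)

Lemma normc_le (R : realType) (z : R[i]) :
  normc z <= `|complex.Re z| + `|complex.Im z|.
Proof.
have h0 : 0 <= `|complex.Re z| + `|complex.Im z| by exact: addr_ge0.
rewrite -(@ler_pXn2r _ 2)// ?nnegrE//; last by case: z {h0} => x y; exact: sqrtr_ge0.
rewrite normc_sqr sqrrD !real_normK ?num_real//.
by rewrite addrAC lerDl mulrn_wge0// mulr_ge0.
Qed.

Lemma Re_le_normc (R : realType) (z : R[i]) : `|complex.Re z| <= normc z.
Proof.
case: z => x y /=; rewrite -sqrtr_sqr ler_wsqrtr//.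
by rewrite lerDl sqr_ge0.
Qed.

Lemma Im_le_normc (R : realType) (z : R[i]) : `|complex.Im z| <= normc z.
Proof.
case: z => x y /=; rewrite -sqrtr_sqr ler_wsqrtr//.
by rewrite lerDr sqr_ge0.
Qed.

Lemma gt0_complex (R : realType) (e : R[i]) : 0 < e ->
  0 < complex.Re e /\ e = (complex.Re e)%:C%C.
Proof. by rewrite ltcE /= => /andP[/eqP i0 r0]; split => //; case: e i0 {r0} => a b /= ->. Qed.

Lemma cvg_Re_Im (R : realType) (u : nat -> R[i]^o) (l : R[i]^o) :
  u n @[n --> \oo] --> l ->
  complex.Re (u n) @[n --> \oo] --> complex.Re l /\
  complex.Im (u n) @[n --> \oo] --> complex.Im l.
Proof.
move=> /cvgrPdist_le ul; split; apply/cvgrPdist_le => e e0;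
  have := ul e%:C%C; rewrite ltcR => /(_ e0); apply: filterS => n h.
- have : normc (l - u n) <= e by rewrite -lecR.
  apply: le_trans; apply: le_trans (Re_le_normc _).
  by case: (l) (u n) => ? ? [].
- have : normc (l - u n) <= e by rewrite -lecR.
  apply: le_trans; apply: le_trans (Im_le_normc _).
  by case: (l) (u n) => ? ? [].
Qed.

Lemma cvg_complex (R : realType) (u : nat -> R[i]^o) (l : R[i]^o) :
  complex.Re (u n) @[n --> \oo] --> complex.Re l ->
  complex.Im (u n) @[n --> \oo] --> complex.Im l ->
  u n @[n --> \oo] --> l.
Proof.
move=> /cvgrPdist_le ur /cvgrPdist_le ui; apply/cvgrPdist_le => e /gt0_complex[e0 ->].
have e2 : 0 < complex.Re e / 2 by rewrite divr_gt0.
apply: filterS2 (ur _ e2) (ui _ e2) => n hr hi.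
have : normc (l - u n) <= complex.Re e.
  apply: (le_trans (normc_le _)); rewrite [leRHS](splitr _); apply: lerD.
    by apply: le_trans hr; case: (l) (u n) => ? ? [].
  by apply: le_trans hi; case: (l) (u n) => ? ? [].
by rewrite -lecR.
Qed.

Section Lneg_theory.
Context {R : realType} {d : nat} {D : set 'rV[R]_d} (B : dirichlet_eigenbasis D) (t : R).
Local Notation L := (Lneg B t).
Local Notation lambda := (eigval B).
Local Notation rho n := (lambda n `^ (- t)).
Implicit Types x y : L.

Lemma Lneg_l2 x : l2 (fracLaplacian_series B (- t) x).
Proof. by have := valP x; rewrite inE. Qed.

Lemma normc_fracLaplacian_series (a : nat -> R[i]) n :
  normc (fracLaplacian_series B (- t) a n) = rho n * normc (a n).
Proof.
rewrite /fracLaplacian_series ComplexField.Normc.normcM; congr (_ * _).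
by rewrite /= expr0n addr0 sqrtr_sqr ger0_norm// powR_ge0.
Qed.

Lemma Lneg_normE x : `|x| = (l2norm (fracLaplacian_series B (- t) x))%:C%C.
Proof. by []. Qed.

Lemma lneg_coefD x y n : (x + y) n = x n + y n. Proof. by []. Qed.
Lemma lneg_coefB x y n : (x - y) n = x n - y n. Proof. by []. Qed.
Lemma lneg_coef_sum (I : Type) (r : seq I) (F : I -> L) n :
  (\sum_(i <- r) F i) n = \sum_(i <- r) F i n.
Proof.
by elim: r => [|i r IH]; rewrite ?big_nil// !big_cons lneg_coefD IH.
Qed.

(** The element w_n of L_(-t) has norm at most lambda_n^(-t). *)
Lemma l2_delta n :
  l2 (fracLaplacian_series B (- t) (fun k => (k == n)%:R)) /\
  l2norm (fracLaplacian_series B (- t) (fun k => (k == n)%:R)) <= rho n.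
Proof.
have r0 : 0 <= rho n by exact: powR_ge0.
rewrite -[X in _ /\ _ <= X](ger0_norm r0) -sqrtr_sqr.
apply: l2_le; last exact: sqr_ge0.
move=> N; rewrite /series/=.
apply: (@le_trans _ _ (\sum_(0 <= k < N) (if k == n then rho n ^+ 2 else 0))).
  apply: ler_sum => k _; rewrite normc_fracLaplacian_series.
  case: eqP => [->|_]; first by rewrite ComplexField.Normc.normc1 mulr1.
  by rewrite ComplexField.Normc.normc0 mulr0 expr0n.
rewrite -big_mkcond/= (big_nat1_eq _ (fun=> rho n ^+ 2)).
by case: ifP => // _; exact: sqr_ge0.
Qed.

Lemma delta_Lneg_pred n : (fun k => (k == n)%:R : R[i]) \in Lneg_pred B t.
Proof. by rewrite inE; exact: (l2_delta n).1. Qed.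

Definition Lneg_delta n : L := LnegSub (delta_Lneg_pred n).

Definition Lneg_trunc (a : nat -> R[i]) N : L := \sum_(n < N) a n *: Lneg_delta n.

Lemma lneg_coef_trunc a N k : Lneg_trunc a N k = if (k < N)%N then a k else 0.
Proof.
rewrite lneg_coef_sum (eq_bigr (fun i : 'I_N => a i * (k == i)%:R))//.
case: ltnP => [kN|Nk].
  rewrite (bigD1 (Ordinal kN))//= eqxx mulr1 big1 ?addr0// => i.
  by rewrite -(inj_eq val_inj)/= => /negbTE ik; rewrite eq_sym ik mulr0.
rewrite big1// => i _; rewrite gtn_eqF ?mulr0//.
exact: leq_trans (ltn_ord i) Nk.
Qed.

(** The square of the distance to a partial sum is the tail of the convergent
series that defines the norm. *)
Lemma Lneg_trunc_cvg x : Lneg_trunc x N @[N --> \oo] --> x.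
Proof.
pose u n := normc (fracLaplacian_series B (- t) x n) ^+ 2.
have cu : cvgn (series u) by exact: Lneg_l2.
have ndu : nondecreasing_seq (series u).
  by apply: nondecreasing_series => n _ _; exact: sqr_ge0.
have tail N : l2norm (fracLaplacian_series B (- t) (x - Lneg_trunc x N)) <=
    Num.sqrt (limn (series u) - series u N).
  have [||//] := @l2_le R (fracLaplacian_series B (- t) (x - Lneg_trunc x N)) (limn (series u)
      - series u N); last first.
    by rewrite subr_ge0; exact: nondecreasing_cvgn_le.
  move=> M; rewrite lerBrDl; apply: (@le_trans _ _ (series u (maxn N M)));
      last exact: nondecreasing_cvgn_le.
  have E n : normc (fracLaplacian_series B (- t) (x - Lneg_trunc x N) n) ^+ 2 =
      if (n < N)%N then 0 else u n.
    rewrite normc_fracLaplacian_series lneg_coefB lneg_coef_trunc /u normc_fracLaplacian_series.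
    by case: ifP => _; rewrite ?subrr ?ComplexField.Normc.normc0 ?mulr0 ?expr0n// subr0.
  rewrite /series/= (eq_bigr _ (fun n _ => E n)).
  apply: (@le_trans _ _ (\sum_(0 <= k < N) u k + \sum_(N <= k < maxn N M) u k)); last first.
    by rewrite -(big_cat_nat (leq0n N) (leq_maxl N M)).
  rewrite lerD2l; apply: (@le_trans _ _ (\sum_(0 <= i < maxn N M) (if (i < N)%N then 0 else u
      i))).
    rewrite (big_cat_nat (leq0n M) (leq_maxr N M))/= lerDl sumr_ge0// => i _.
    by case: ifP => // _; exact: sqr_ge0.
  rewrite (big_cat_nat (leq0n N) (leq_maxl N M))/= big_nat big1 ?add0r; last by move=> i /= ->.
  by apply: ler_sum => i _; case: ifP => // _; exact: sqr_ge0.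
have c0 : Num.sqrt (limn (series u) - series u N) @[N --> \oo] --> 0.
  have c : limn (series u) - series u N @[N --> \oo] --> 0.
    by rewrite -(subrr (limn (series u))); apply: cvgB => //; exact: cvg_cst.
  have := cvg_comp _ _ c (@sqrt_continuous R 0); rewrite sqrtr0; exact.
apply/cvgrPdist_le => e /gt0_complex[e0 ->].
move/cvgrPdist_le : c0 => /(_ _ e0); apply: filterS => N.
rewrite sub0r normrN ger0_norm ?sqrtr_ge0// => h.
by rewrite Lneg_normE lecR; exact: le_trans (tail N) h.
Qed.

Definition Lneg_rat (q : seq (rat * rat)) : L :=
  Lneg_trunc (fun n => (ratr (nth (0, 0) q n).1 +i* ratr (nth (0, 0) q n).2)%C) (size q).

(** Truncate, and approximate each of the remaining coefficients by a rational
one. *)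
Lemma Lneg_rat_dense x (e : R) : 0 < e -> exists q, `|x - Lneg_rat q| < e%:C%C.
Proof.
move=> e0; have e2 : 0 < e / 2 by rewrite divr_gt0.
have := @Lneg_trunc_cvg x => /cvgrPdist_lt/(_ (e / 2)%:C%C);
    rewrite ltcR => /(_ e2)[N _ /(_ N (leqnn N))] xN.
have NE : 0 < N.+1%:R :> R by [].
(* an error del n in both parts of the coefficient n costs at most
   (e / 2) / (N + 1) in norm *)
pose del n := e / 2 / N.+1%:R / (2 * (complex.Re `|Lneg_delta n| + 1)).
have nd n : 0 <= complex.Re `|Lneg_delta n| by rewrite Lneg_normE /= l2norm_ge0.
have del0 n : 0 < del n by rewrite !divr_gt0// mulr_gt0// ltr_wpDl.
have hq (r : R) n : exists q : rat, `|r - ratr q| < del n.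
  have /rat_in_itvoo[q] : r - del n < r + del n by rewrite ltrD2l (lt_trans _ (del0 n))//
      oppr_lt0.
  by rewrite in_itv/= => qx; exists q; rewrite ltr_distlC.
pose q := mkseq (fun n => (xchoose (hq (complex.Re (x n)) n), xchoose (hq (complex.Im (x n))
    n))) N.
exists q; rewrite -(subrK (Lneg_trunc x N) x) -addrA.
have -> : e%:C%C = (e / 2)%:C%C + (e / 2)%:C%C by rewrite -rmorphD/= -splitr.
apply: (le_lt_trans (ler_normD _ _)); rewrite ltrD//.
rewrite /Lneg_rat size_mkseq /Lneg_trunc -sumrB; apply: (le_lt_trans (ler_norm_sum _ _ _)).
apply: (@le_lt_trans _ _ (\sum_(i < N) (e / 2 / N.+1%:R)%:C%C)).
  apply: ler_sum => i _; rewrite -scalerBl normrZ nth_mkseq//=.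
  rewrite Lneg_normE -[X in _ * X]/((complex.Re `|Lneg_delta i|)%:C%C).
  set z := x i - _; have zi : normc z <= del i + del i.
    apply: (le_trans (normc_le _)); apply: lerD.
      apply: le_trans (ltW (xchooseP (hq (complex.Re (x i)) i))).
      by rewrite /z; case: (x i).
    apply: le_trans (ltW (xchooseP (hq (complex.Im (x i)) i))).
    by rewrite /z; case: (x i).
  rewrite -[X in X * _]/((normc z)%:C%C) -rmorphM lecR.
  apply: (@le_trans _ _ ((del i + del i) * (complex.Re `|Lneg_delta i| + 1))).
    by apply: ler_pM => //; [case: (z) => ? ?; exact: sqrtr_ge0|rewrite lerDl].
  have y0 : complex.Re `|Lneg_delta i| + 1 != 0 by rewrite gt_eqF// ltr_wpDl.
  rewrite /del le_eqVlt; apply/orP; left; apply/eqP.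
  move: (e / 2 / N.+1%:R) (complex.Re _ + 1) y0 => c y y0; by field.
rewrite sumr_const card_ord -rmorphMn/= ltcR -mulr_natr mulrAC ltr_pdivrMr//.
by rewrite ltr_pM2l// ltr_nat.
Qed.

End Lneg_theory.

Section measurable_Lneg.
Context {R : realType} {d : nat} {D : set 'rV[R]_d} (B : dirichlet_eigenbasis D) (t : R).
Context {dT : measure_display} {T : measurableType dT}.
Local Notation L := (Lneg B t).
Variable Z : T -> L.
Hypothesis mRe : forall n, measurable_fun setT (fun x => complex.Re (Z x n)).
Hypothesis mIm : forall n, measurable_fun setT (fun x => complex.Im (Z x n)).

Let mnorm (y : L) :
  measurable_fun setT (fun x => l2norm (fracLaplacian_series B (- t) (y - Z x))).
Proof.
have E x n : normc (fracLaplacian_series B (- t) (y - Z x) n) ^+ 2 =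
    (eigval B n `^ (- t)) ^+ 2 * ((complex.Re (y n) - complex.Re (Z x n)) ^+ 2 +
                           (complex.Im (y n) - complex.Im (Z x n)) ^+ 2).
  rewrite normc_fracLaplacian_series exprMn normc_sqr lneg_coefB.
  by case: (y n) (Z x n) => ? ? [].
apply: (measurableT_comp (continuous_measurable_fun (@sqrt_continuous R))).
apply: (measurable_fun_cvg (h := fun n x => series (fun n => normc (fracLaplacian_series B (-
    t) (y - Z x) n) ^+ 2) n)).
  move=> m; rewrite /series/=; apply: measurable_sum => n.
  under eq_fun do rewrite E.
  apply: measurable_funM => //; apply: measurable_funD; apply: measurable_funX;
      exact: measurable_funB.
by move=> x _; exact: Lneg_l2.
Qed.

(** A map into L_(-t) with measurable coefficients is measurable: every open
set is a countable union of balls with centres in the dense set [Lneg_rat] and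
radii 1 / (n + 1). *)
Lemma measurable_Lneg : measurable_fun setT (Z : T -> borel L).
Proof.
apply: (@measurability _ _ _ (borel L) setT Z (@open L)) => // _ [U oU <-]; rewrite setTI.
pose I := (seq (rat * rat) * nat)%type.
pose b (i : I) : set L := ball (Lneg_rat B t i.1) (i.2.+1%:R^-1 : R)%:C%C.
have -> : U = \bigcup_(i : I) (if `[< b i `<=` U >] then b i else set0).
  apply/seteqP; split=> [x Ux|x [i _]]; last by case: asboolP => // bU /bU.
  have := open_nbhs_nbhs (conj oU Ux); rewrite -nbhs_ballE => -[e /= /gt0_complex[e0 ->] eU].
  have [n ne] : exists n : nat, n.+1%:R^-1 < complex.Re e / 2.
    have e20 : 0 < complex.Re e / 2 by rewrite divr_gt0.
    by have [n _ /(_ n (leqnn n))] := near_infty_natSinv_lt (PosNum e20); exists n.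
  have n0 : 0 < n.+1%:R^-1 :> R by [].
  have [q xq] := @Lneg_rat_dense R d D B t x _ n0.
  exists (q, n) => //; case: asboolP => [_|].
    by rewrite /b -ball_normE /= distrC.
  case => y; rewrite /b -ball_normE /= => qy; apply: eU; rewrite -ball_normE /=.
  rewrite -(subrK (Lneg_rat B t q) x) -addrA; apply: (le_lt_trans (ler_normD _ _)).
  have := ltrD xq qy; move=> /lt_trans; apply.
  by rewrite -rmorphD ltcR (splitr (complex.Re e)) ltrD.
rewrite preimage_bigcup; apply: countable_bigcupT_measurable => [|i].
  exact: (@countableP (seq (rat * rat) * nat)%type).
case: asboolP => _; last by rewrite preimage_set0.
rewrite (_ : _ @^-1` _ =
   (fun x => l2norm (fracLaplacian_series B (- t) (Lneg_rat B t i.1 - Z x))) @^-1` `]-oo,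
       (i.2.+1%:R^-1 : R)[%classic).
  by apply: measurable_preimage; [exact: mnorm|exact: measurable_itv].
by apply/seteqP; split => x; rewrite /b -ball_normE /= in_itv /= Lneg_normE ltcR.
Qed.

End measurable_Lneg.

Lemma sum_even_odd (V : zmodType) (F : nat -> V) n :
  \sum_(k < n.*2) F k = \sum_(k < n) (F k.*2 + F k.*2.+1).
Proof.
elim: n => [|n IH]; first by rewrite !big_ord0.
by rewrite doubleS !big_ord_recr/= IH addrA.
Qed.

(** Absolute convergence of complex series, from that of the real and
imaginary parts. *)
Lemma cvg_series_complex (R : realType) (u : nat -> R[i]^o) (v : nat -> R) :
  (forall n, normc (u n) <= v n) -> cvgn (series v) -> cvgn (series u).
Proof.
move=> uv cv.
have H (r : nat -> R) : (forall n, `|r n| <= normc (u n)) -> cvgn (series r).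
  move=> ru; apply: normed_cvg; apply: (series_le_cvg _ _ _ cv) => n.
  - exact: normr_ge0.
  - exact: le_trans (normr_ge0 _) (le_trans (ru n) (uv n)).
  - exact: le_trans (ru n) (uv n).
have cr := H (fun n => complex.Re (u n)) (fun n => Re_le_normc (u n)).
have ci := H (fun n => complex.Im (u n)) (fun n => Im_le_normc (u n)).
apply/cvg_ex; exists ((limn (series (fun n => complex.Re (u n))) +i* limn (series (fun n =>
    complex.Im (u n))))%C : R[i]^o).
apply: cvg_complex => /=.
  by rewrite (_ : (fun n => _) = series (fun n => complex.Re (u n)))//; apply/funext => n;
      rewrite /series/= Re_sum.
by rewrite (_ : (fun n => _) = series (fun n => complex.Im (u n)))//; apply/funext => n;
    rewrite /series/= Im_sum.
Qed.

(** The choice t = s + d turns lambda_n^s into the square-summable sequence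
lambda_n^(-d). *)
Lemma eigval_powM (R : realType) d (D : set 'rV[R]_d)
    (B : dirichlet_eigenbasis D) (s : R) n :
  eigval B n `^ s * eigval B n `^ (- (s + d%:R)) = (eigval B n ^+ d)^-1.
Proof.
have l0 := eigval_gt0 B n.
rewrite -powRD; last by rewrite (gt_eqF l0) implybT.
by rewrite opprD addrA subrr add0r powRN powR_mulrn// ltW.
Qed.

(** * The fractional Gaussian field *)

Section gaussian_field.
Context {R : realType} {d : nat} {D : set 'rV[R]_d} (B : dirichlet_eigenbasis D) (s : R).
Notation M := (measurableTypeR R).
Notation leb := (@lebesgue_vec R d).
Hypothesis d0 : (0 < d)%N.
Hypothesis mD : measurable (D : set (borel 'rV[R]_d)).
Hypothesis fD : (leb D < +oo)%E.
Local Notation lambda := (eigval B).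
Notation P := (@unifP R).
Notation g := (@gaussian_seq R).
Local Notation t := (s + d%:R).
Local Notation L := (Lneg B t).

(** The standard deviation of each of the two parts of the coefficient of w_n;
the division by the square root of 2 gives the whole coefficient the variance
lambda_n^(2 s). *)
Definition field_std n : R := lambda n `^ s / Num.sqrt 2.
Local Notation sigma := field_std.

Definition field_coef n (x : M) : R[i] :=
  ((sigma n * g n.*2 x) +i* (sigma n * g n.*2.+1 x))%C.
Local Notation xi := field_coef.

(** The series of coefficients, replaced by 0 on the null set where it is not
in L_(-t). *)
Definition gaussian_field (x : M) : L := insubd (0 : L) (xi ^~ x).
Local Notation Z := gaussian_field.

Let sigma2 n : sigma n ^+ 2 = (lambda n `^ s) ^+ 2 / 2.
Proof. by rewrite /field_std exprMn exprVn sqr_sqrtr. Qed.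

(** The terms of the squared norm of the field in L_(-t), and their sum W; the
sum is integrable, so it is finite almost everywhere. *)
Let h n x := normc (fracLaplacian_series B (- t) (xi ^~ x) n) ^+ 2.

Let hE n x : h n x = (lambda n ^+ d)^-1 ^+ 2 / 2 * (g n.*2 x ^+ 2 + g n.*2.+1 x ^+ 2).
Proof.
rewrite /h normc_fracLaplacian_series exprMn normc_sqr /= -(eigval_powM B s).
set a := g _ x; set b := g _ x.
have -> : (sigma n * a) ^+ 2 + (sigma n * b) ^+ 2 = sigma n ^+ 2 * (a ^+ 2 + b ^+ 2) by ring.
rewrite sigma2; ring.
Qed.

Let mh n : measurable_fun setT (h n).
Proof.
have -> : h n = fun x => (lambda n ^+ d)^-1 ^+ 2 / 2 * (g n.*2 x ^+ 2 + g n.*2.+1 x ^+ 2).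
  by apply/funext => x; exact: hE.
by apply: measurable_funM => //; apply: measurable_funD; apply: measurable_funX;
  exact: measurable_gaussian_seq.
Qed.

Let g2 k : (\int[P]_x (g k x ^+ 2)%:E = 1%:E)%E.
Proof.
have := centered_normal_sqr (@gaussian_seq_sum R k.+1 (fun j => (j == k)%:R)).
under eq_integral do rewrite big_ord_recr/= eqxx mul1r.
have E x : \sum_(i < k) (i == k :> nat)%:R * g i x = 0.
  by rewrite big1// => i _; rewrite ltn_eqF ?mul0r.
under eq_integral do rewrite E add0r.
rewrite big_ord_recr/= eqxx expr1n big1 ?add0r ?sqrtr1 ?expr1n//.
by move=> i _; rewrite ltn_eqF ?expr0n.
Qed.

Let inth n : (\int[P]_x (h n x)%:E = ((lambda n ^+ d)^-1 ^+ 2)%:E)%E.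
Proof.
have mg k : measurable_fun setT (fun x => (g k x ^+ 2)%:E : \bar R).
  by apply/measurable_EFinP; apply: measurable_funX; exact: measurable_gaussian_seq.
have g0 k x : (0 <= (g k x ^+ 2)%:E :> \bar R)%E by rewrite lee_fin sqr_ge0.
under eq_integral do rewrite hE EFinM EFinD.
rewrite ge0_integralZl//; last 3 first.
- exact: emeasurable_funD.
- by move=> x _; rewrite adde_ge0.
- by rewrite lee_fin divr_ge0// sqr_ge0.
rewrite ge0_integralD// !g2 -EFinD -EFinM; congr EFin; field.
by rewrite expf_neq0// gt_eqF// eigval_gt0.
Qed.

Let W x := (\sum_(n <oo) (h n x)%:E)%E.

Let mW : measurable_fun setT W.
Proof.
rewrite (_ : W = fun x => (\sum_(n <oo | n \in predT) (h n x)%:E)%E)//.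
apply: ge0_emeasurable_sum => [k x _ _|k _]; first by rewrite lee_fin sqr_ge0.
exact/measurable_EFinP.
Qed.

Let W_l2 x : (W x \is a fin_num) = ((xi ^~ x) \in Lneg_pred B t).
Proof.
have nd : nondecreasing_seq (series (h ^~ x)).
  by apply: nondecreasing_series => n _ _; exact: sqr_ge0.
have W0 : (0 <= W x)%E by apply: nneseries_ge0 => n _ _; rewrite lee_fin sqr_ge0.
apply/idP/idP => [Wx|].
  rewrite inE; apply: nondecreasing_is_cvgn => //.
  exists (fine (W x)) => _ [n _ <-]; rewrite -lee_fin fineK// -sumEFin.
  by apply: (@nneseries_lim_ge _ (fun n => (h n x)%:E) xpredT 0%N n) => k _ _;
      rewrite lee_fin sqr_ge0.
rewrite inE => c; rewrite ge0_fin_numE//.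
apply: (@le_lt_trans _ _ (limn (series (h ^~ x)))%:E); last exact: ltry.
apply: lime_le; first by apply: is_cvg_nneseries => k _ _; rewrite lee_fin sqr_ge0.
by apply: nearW => n; rewrite sumEFin lee_fin; exact: nondecreasing_cvgn_le.
Qed.

Let ae_l2 : {ae P, forall x, (xi ^~ x) \in Lneg_pred B t}.
Proof.
have [K K0 HK] := sum_eigval_le B d0 mD fD.
have iW : P.-integrable setT W.
  apply/integrableP; split => //.
  have W0 x : (0 <= W x)%E by apply: nneseries_ge0 => n _ _; rewrite lee_fin sqr_ge0.
  under eq_integral do rewrite gee0_abs//.
  rewrite integral_nneseries//; last 2 first.
  - by move=> n; exact/measurable_EFinP.
  - by move=> n x _; rewrite lee_fin sqr_ge0.
  apply: (@le_lt_trans _ _ K%:E); last exact: ltry.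
  under eq_eseriesr do rewrite inth.
  apply: lime_le; first by apply: is_cvg_nneseries => k _ _; rewrite lee_fin sqr_ge0.
  by apply: nearW => n; rewrite sumEFin lee_fin.
by apply: filterS (integrable_ae measurableT iW) => x /(_ I); rewrite W_l2.
Qed.

Let ZE x n : Z x n = if (xi ^~ x) \in Lneg_pred B t then xi n x else 0.
Proof.
rewrite /gaussian_field -[LHS]/((val (insubd (0 : L) (xi ^~ x))) n) val_insubd.
by case: ifP.
Qed.

Let mif (f : M -> R) : measurable_fun setT f ->
  measurable_fun setT (fun x => if (xi ^~ x) \in Lneg_pred B t then f x else 0).
Proof.
move=> mf; apply: measurable_fun_ifT => //; apply: (measurable_fun_bool true).
rewrite setTI (_ : _ @^-1` _ = [set x | W x \is a fin_num]).
  by have := emeasurable_fin_num measurableT mW; rewrite setTI.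
by apply/seteqP; split => x /=; rewrite W_l2.
Qed.

Lemma measurable_gaussian_field_Re n : measurable_fun setT (fun x => complex.Re (Z x n)).
Proof.
have -> : (fun x => complex.Re (Z x n)) =
    (fun x => if (xi ^~ x) \in Lneg_pred B t then sigma n * g n.*2 x else 0).
  by apply/funext => x; rewrite ZE; case: ifP.
by apply: mif; apply: measurable_funM => //; exact: measurable_gaussian_seq.
Qed.

Lemma measurable_gaussian_field_Im n : measurable_fun setT (fun x => complex.Im (Z x n)).
Proof.
have -> : (fun x => complex.Im (Z x n)) =
    (fun x => if (xi ^~ x) \in Lneg_pred B t then sigma n * g n.*2.+1 x else 0).
  by apply/funext => x; rewrite ZE; case: ifP.
by apply: mif; apply: measurable_funM => //; exact: measurable_gaussian_seq.
Qed.

(** The common part of the laws of f(Z) and of <Z, phi>: on the event where the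
coefficients of Z are those of the random series, a real linear combination of
the two parts of F is the limit of linear combinations of the Gaussian
sequence. The factor a^2 + b^2 in the variance expresses circularity. *)
Lemma gaussian_field_series (f : nat -> R[i]) (F : M -> R[i]) (v : R) :
  (forall x, (\sum_(n < N) Z x n * f n : R[i]^o) @[N --> \oo] --> (F x : R[i]^o)) ->
  \sum_(n < N) (lambda n `^ s) ^+ 2 * normc (f n) ^+ 2 @[N --> \oo] --> v ->
  forall a b, centered_normal P (fun x => a * complex.Re (F x) + b * complex.Im (F x))
    (Num.sqrt ((a ^+ 2 + b ^+ 2) * (v / 2))).
Proof.
move=> ZF cv a b.
(* the coefficients of the two standard normal variables of rank n in
   a Re (Z_n f_n) + b Im (Z_n f_n) *)
pose al n := sigma n * (a * complex.Re (f n) + b * complex.Im (f n)).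
pose be n := sigma n * (b * complex.Re (f n) - a * complex.Im (f n)).
pose c k := if odd k then be k./2 else al k./2.
have c2 N : \sum_(k < N.*2) c k ^+ 2 =
    (a ^+ 2 + b ^+ 2) / 2 * \sum_(n < N) (lambda n `^ s) ^+ 2 * normc (f n) ^+ 2.
  rewrite (sum_even_odd (fun k => c k ^+ 2)) mulr_sumr; apply: eq_bigr => n _.
  rewrite /c /= odd_double/= doubleK uphalf_double /al /be normc_sqr.
  set p := complex.Re _; set q := complex.Im _.
  have -> : (sigma n * (a * p + b * q)) ^+ 2 + (sigma n * (b * p - a * q)) ^+ 2 =
    sigma n ^+ 2 * ((a ^+ 2 + b ^+ 2) * (p ^+ 2 + q ^+ 2)) by ring.
  by rewrite sigma2; field.
pose X N x := \sum_(k < N.*2) c k * g k x.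
have cF x : complex.Re (\sum_(n < N) Z x n * f n) @[N --> \oo] --> complex.Re (F x) /\
     complex.Im (\sum_(n < N) Z x n * f n) @[N --> \oo] --> complex.Im (F x).
  exact: cvg_Re_Im (ZF x).
have mS N : measurable_fun setT (fun x => complex.Re (\sum_(n < N) Z x n * f n)) /\
            measurable_fun setT (fun x => complex.Im (\sum_(n < N) Z x n * f n)).
  split.
    under eq_fun do rewrite Re_sum; apply: measurable_sum => n.
    rewrite (_ : (fun x => _) = (fun x => complex.Re (Z x n) * complex.Re (f n) - complex.Im
        (Z x n) * complex.Im (f n))).
      apply: measurable_funB; apply: measurable_funM => //.
        exact: measurable_gaussian_field_Re.
      exact: measurable_gaussian_field_Im.
    by apply/funext => x; case: (Z x n) (f n) => ? ? [].
  under eq_fun do rewrite Im_sum; apply: measurable_sum => n.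
  rewrite (_ : (fun x => _) = (fun x => complex.Re (Z x n) * complex.Im (f n) + complex.Im (Z
      x n) * complex.Re (f n))).
    apply: measurable_funD; apply: measurable_funM => //.
      exact: measurable_gaussian_field_Re.
    exact: measurable_gaussian_field_Im.
  by apply/funext => x; case: (Z x n) (f n) => ? ? [].
apply: (@centered_normal_lim R _ _ P X _ (fun N => Num.sqrt (\sum_(k < N.*2) c k ^+ 2))).
- by move=> N; exact: gaussian_seq_sum.
- have -> : (a ^+ 2 + b ^+ 2) * (v / 2) = (a ^+ 2 + b ^+ 2) / 2 * v by ring.
  under eq_cvg do rewrite c2.
  have cc : (a ^+ 2 + b ^+ 2) / 2 * \sum_(n < N) (lambda n `^ s) ^+ 2 * normc (f n) ^+ 2 @[N
      --> \oo] -->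
     (a ^+ 2 + b ^+ 2) / 2 * v by apply: cvgM => //; exact: cvg_cst.
  exact: (cvg_comp _ _ cc (@sqrt_continuous R _)).
- apply: measurable_funD; apply: measurable_funM => //.
    apply: (measurable_fun_cvg (h := fun N x => complex.Re (\sum_(n < N) Z x n * f n))).
      by move=> N; exact: (mS N).1.
    by move=> x _; exact: (cF x).1.
  apply: (measurable_fun_cvg (h := fun N x => complex.Im (\sum_(n < N) Z x n * f n))).
    by move=> N; exact: (mS N).2.
  by move=> x _; exact: (cF x).2.
apply: filterS ae_l2 => x lx.
have -> : X ^~ x = fun N => a * complex.Re (\sum_(n < N) Z x n * f n) + b * complex.Im
    (\sum_(n < N) Z x n * f n).
  apply/funext => N; rewrite Re_sum Im_sum !mulr_sumr -big_split/= /X (sum_even_odd (fun k =>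
      c k * g k x)).
  apply: eq_bigr => n _; rewrite /c /= odd_double/= doubleK uphalf_double ZE lx /field_coef
      /al /be.
  case: (f n) => p q /=; ring.
have [cr ci] := cF x.
by apply: cvgD; apply: cvgM => //; exact: cvg_cst.
Qed.

End gaussian_field.

Section field_laws.
Context {R : realType} {d : nat} {D : set 'rV[R]_d} (B : dirichlet_eigenbasis D) (s : R).
Notation leb := (@lebesgue_vec R d).
Hypothesis d0 : (0 < d)%N.
Hypothesis mD : measurable (D : set (borel 'rV[R]_d)).
Hypothesis fD : (leb D < +oo)%E.
Local Notation lambda := (eigval B).
Notation P := (@unifP R).
Local Notation t := (s + d%:R).
Local Notation L := (Lneg B t).
Local Notation Z := (gaussian_field B s).

(** Continuous functionals are bounded, and w_n has norm at most
lambda_n^(-t). *)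
Lemma dual_bound (f : {linear L -> R[i]^o}) : continuous f ->
  exists2 C : R, 0 <= C & forall n, normc (f (Lneg_delta B t n)) <= C * lambda n `^ (- t).
Proof.
move=> cf; have := continuous_linear_bounded 0 (cf 0).
move=> /linear_boundedP /pinfty_ex_gt0[r /gt0_complex[r0 ->] Hr].
exists (complex.Re r); first exact: ltW.
move=> n; have := Hr (Lneg_delta B t n); rewrite Lneg_normE -rmorphM => h.
apply: le_trans (ler_wpM2l (ltW r0) (l2_delta B t n).2).
by rewrite -lecR.
Qed.

(** A continuous functional f of Z is the limit of its values at the partial
sums of Z, that is, of sum_n Z_n f(w_n), and the bound on f(w_n) makes the
variances converge. *)
Lemma gaussian_field_gaussian : complex_gaussian_field P Z.
Proof.
split.
  apply: measurable_Lneg => n; first exact: measurable_gaussian_field_Re.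
  exact: measurable_gaussian_field_Im.
move=> f cf a b; have [C C0 HC] := dual_bound cf.
pose e n := f (Lneg_delta B t n) : R[i].
have [K K0 HK] := sum_eigval_le B d0 mD fD.
have ce : cvgn (fun N => \sum_(n < N) (lambda n `^ s) ^+ 2 * normc (e n) ^+ 2).
  have -> : (fun N => \sum_(n < N) (lambda n `^ s) ^+ 2 * normc (e n) ^+ 2) =
      series (fun n => (lambda n `^ s) ^+ 2 * normc (e n) ^+ 2).
    by apply/funext => N; rewrite /series [RHS]big_mkord.
  apply: nondecreasing_is_cvgn.
    by apply: nondecreasing_series => n _ _; rewrite mulr_ge0 ?sqr_ge0.
  exists (C ^+ 2 * K) => _ [N _ <-]; rewrite /series/=.
  apply: (@le_trans _ _ (C ^+ 2 * \sum_(0 <= n < N) (lambda n ^+ d)^-1 ^+ 2)); last first.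
    by apply: ler_wpM2l => //; exact: sqr_ge0.
  rewrite mulr_sumr; apply: ler_sum => n _; rewrite -(eigval_powM B s) -!exprMn.
  have n0 : 0 <= normc (e n) by case: (e n) => ? ?; exact: sqrtr_ge0.
  rewrite lerXn2r ?nnegrE ?mulr_ge0 ?powR_ge0// mulrCA ler_wpM2l ?powR_ge0//.
  exact: HC.
apply: centered_normal_gaussian; apply: (gaussian_field_series d0 mD fD (f := e) _ ce).
move=> x; have -> : (fun N => \sum_(n < N) Z x n * e n : R[i]^o) = (fun N => f (Lneg_trunc B t
    (Z x) N)).
  apply/funext => N; rewrite /Lneg_trunc linear_sum; apply: eq_bigr => n _.
  by rewrite linearZ.
exact: (cvg_comp _ _ (@Lneg_trunc_cvg _ _ _ B t (Z x)) (cf (Z x))).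
Qed.

(** |a_n| <= |a| lambda_n^t for a in L_(-t), while lambda_n^t <w_n, phi> is
absolutely summable. *)
Lemma pairing_cvg (a : L) phi : test_function D phi ->
  (\sum_(n < N) a n * coef B phi n : R[i]^o) @[N --> \oo] --> (pairing a phi : R[i]^o).
Proof.
move=> [tr ti]; pose A := l2norm (fracLaplacian_series B (- t) a).
have A0 : 0 <= A by exact: l2norm_ge0.
have aA n : normc (a n) <= A * lambda n `^ t.
  have l0 := eigval_gt0 B n.
  have h : lambda n `^ (- t) * normc (a n) <= A.
    have n0 : 0 <= normc (a n) by case: (a n) => ? ?; exact: sqrtr_ge0.
    rewrite -(@ler_pXn2r _ 2) ?nnegrE ?mulr_ge0 ?powR_ge0// -normc_fracLaplacian_series.
    have la : l2 (fracLaplacian_series B (- t) a) by exact: Lneg_l2.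
    apply: le_trans (l2norm_ge n.+1 la); rewrite /series/= big_nat_recr//= lerDr.
    by apply: sumr_ge0 => i _; exact: sqr_ge0.
  by rewrite -ler_pdivrMr ?powR_gt0// mulrC -powRN.
have -> : (fun N => \sum_(n < N) a n * coef B phi n : R[i]^o) =
    series (fun n => a n * coef B phi n : R[i]^o).
  by apply/funext => N; rewrite /series [RHS]big_mkord.
pose v n := A * (lambda n `^ t * `|ip leb D (eigfun B n) (fun x => complex.Re (phi x))| +
                 lambda n `^ t * `|ip leb D (eigfun B n) (fun x => complex.Im (phi x))|).
apply: (@cvg_series_complex R _ v).
  move=> n; rewrite ComplexField.Normc.normcM /v -mulrDr mulrA.
  apply: ler_pM => //.
  - by case: (a n) => ? ?; exact: sqrtr_ge0.
  - by case: (coef B phi n) => ? ?; exact: sqrtr_ge0.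
  - by apply: (le_trans (normc_le _)); rewrite coef_ip.
apply: is_cvg_seriesZ.
have cr := @coef_summable _ _ _ B d0 mD fD t _ tr.
have ci := @coef_summable _ _ _ B d0 mD fD t _ ti.
have -> : series (fun n => lambda n `^ t * `|ip leb D (eigfun B n) (fun x => complex.Re (phi
    x))| +
                 lambda n `^ t * `|ip leb D (eigfun B n) (fun x => complex.Im (phi x))|) =
   series (fun n => lambda n `^ t * `|ip leb D (eigfun B n) (fun x => complex.Re (phi x))|) +
   series (fun n => lambda n `^ t * `|ip leb D (eigfun B n) (fun x => complex.Im (phi x))|).
  by apply/funext => N; rewrite /series/= big_split.
exact: is_cvgD cr ci.
Qed.

Lemma pairing_CN phi : test_function D phi ->
  CN P 0 (Ls_norm B s phi ^+ 2) 0 (fun x => pairing (Z x) phi).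
Proof.
move=> tphi; rewrite (_ : (fun x => pairing (Z x) phi) =
   (fun x => (complex.Re (pairing (Z x) phi) +i* complex.Im (pairing (Z x) phi))%C));
       last first.
  by apply/funext => x; case: (pairing (Z x) phi).
apply: circular_CN; first exact: sqr_ge0.
apply: (gaussian_field_series d0 mD fD (f := coef B phi)).
  by move=> x; exact: pairing_cvg.
have := @test_Ls_norm _ _ _ B d0 mD fD s _ tphi.
rewrite (_ : series _ = fun N => \sum_(n < N) (lambda n `^ s) ^+ 2 * normc (coef B phi n) ^+
    2)//.
by apply/funext => N; rewrite /series [LHS]big_mkord.
Qed.

End field_laws.

Theorem theorem5p8 (R : realType) (d : nat) (D : set 'rV[R]_d)
    (B : dirichlet_eigenbasis D) (s : R)
    (d_gt0 : (0 < d)%N) (s_gt0 : 0 < s)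
    (D_open : open D) (D_bounded : bounded_set D) (D_nonempty : D !=set0) :
  exists t : R, 0 < t /\
  exists (dT : measure_display) (T : measurableType dT) (P : probability T R)
         (Z : T -> Lneg B t),
    complex_gaussian_field P Z /\
    forall phi : 'rV[R]_d -> R[i], test_function D phi ->
      Ls B s phi /\
      CN P 0 (Ls_norm B s phi ^+ 2) 0 (fun x => pairing (Z x) phi).
Proof.
have mD : measurable (D : set (borel 'rV[R]_d)) by exact: sub_sigma_algebra.
have fD : (@lebesgue_vec R d D < +oo)%E by exact: bounded_lebesgue_fin.
exists (s + d%:R); split; first by rewrite addr_gt0// ltr0n.
exists _, (measurableTypeR R), (@unifP R), (gaussian_field B s); split.
  exact: gaussian_field_gaussian.
move=> phi tphi; split; first exact: test_Ls.
exact: pairing_CN.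
Qed.
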